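(* A prime graph with at least $5$ vertices has at least $3$ non-essential vertices if and only if it is not locally equivalent to a graph with two specified vertices $x$ and $y$ consisting of at least two internally-disjoint paths from $x$ to $y$, in which $x$ and $y$ have no common neighbor.
   Context: All graphs are finite and simple. For a vertex $v$ of a graph $G$, $G*v$ is the graph on $V(G)$ with $E(G*v)=E(G)\triangle\{xy: x,y \text{ distinct neighbors of } v\}$ (local complementation); graphs are locally equivalent if one is obtained from the other by a sequence of local complementations. For an edge $vw$, $G\wedge vw := G*v*w*v$. $G/v$ denotes $G\setminus v$ if $v$ is isolated, and otherwise $G\wedge vw\setminus v$ for an arbitrary neighbor $w$ of $v$ (well defined up to local equivalence). A split of a graph is a partition $(A,B)$ of its vertex set with $\min\{|A|,|B|\}\ge 2$ such that for some $A'\subseteq A$, $B'\subseteq B$, vertices $x\in A$, $y\in B$ are adjacent iff $x\in A'$ and $y\in B'$; a graph is prime if it has no split. A vertex $v$ is non-essential if at least two of $G\setminus v$, $G*v\setminus v$, $G/v$ are prime. A graph ''consisting of'' paths means it is the union of these paths (vertex set and edge set are the unions). *)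

(* Defs.v *)
From HB Require Import structures.
From mathcomp Require Import all_boot.

Set Implicit Arguments.
Unset Strict Implicit.
Unset Printing Implicit Defensive.

Record sgraph (V : finType) := SGraph {
  adj : rel V;
  adj_sym : symmetric adj;
  adj_irrefl : irreflexive adj
}.

Section LocalComplementation.
Variable V : finType.
Implicit Types (G H : sgraph V) (v w : V).

Definition local_compl_rel G v : rel V :=
  fun x y => adj G x y (+) [&& x != y, adj G v x & adj G v y].

Lemma local_compl_sym G v : symmetric (local_compl_rel G v).
Proof.
by move=> x y; rewrite /local_compl_rel adj_sym eq_sym [adj G v x && _]andbC.
Qed.

Lemma local_compl_irrefl G v : irreflexive (local_compl_rel G v).
Proof. by move=> x; rewrite /local_compl_rel adj_irrefl eqxx. Qed.

Definition local_compl G v : sgraph V :=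
  SGraph (local_compl_sym G v) (local_compl_irrefl G v).

(* [=2] identifies graphs having the same edges. *)
Definition locally_equivalent G H : Prop :=
  exists s : seq V, adj H =2 adj (foldl local_compl G s).

Definition pivot G v w : sgraph V :=
  local_compl (local_compl (local_compl G v) w) v.

Lemma delete_sym G v :
  symmetric (fun x y : {z : V | z != v} => adj G (val x) (val y)).
Proof. by move=> x y; rewrite adj_sym. Qed.

Lemma delete_irrefl G v :
  irreflexive (fun x y : {z : V | z != v} => adj G (val x) (val y)).
Proof. by move=> x; rewrite adj_irrefl. Qed.

Definition delete G v : sgraph {z : V | z != v} :=
  SGraph (@delete_sym G v) (@delete_irrefl G v).

(* G / v; [pick] supplies the arbitrary neighbor of v, and the result does not
   depend on that choice up to local equivalence. *)
Definition contract G v : sgraph {z : V | z != v} :=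
  if [pick w | adj G v w] is Some w then delete (pivot G v w) v
  else delete G v.

End LocalComplementation.

Section Primality.
Variable V : finType.
Implicit Types (G : sgraph V) (A B : {set V}) (v : V).

Definition is_split G A B : bool :=
  [&& A :|: B == setT, [disjoint A & B], 2 <= minn #|A| #|B| &
      [exists A' : {set V}, exists B' : {set V},
        [&& A' \subset A, B' \subset B &
            [forall x in A, forall y in B,
              adj G x y == ((x \in A') && (y \in B'))]]]].

Definition prime_graph G : bool :=
  ~~ [exists A : {set V}, exists B : {set V}, is_split G A B].

End Primality.

(* The sum of the three booleans, coerced to nat, counts the prime graphs. *)
Definition non_essential (V : finType) (G : sgraph V) (v : V) : bool :=
  2 <= prime_graph (delete G v)
       + prime_graph (delete (local_compl G v) v)
       + prime_graph (contract G v).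

Section PathSystems.
Variable V : finType.
Implicit Types (G : sgraph V) (x y : V) (p : seq V) (ps : seq (seq V)).

(* A path is given by the sequence of its vertices, ends included; it may
   consist of a single edge. *)
Definition is_path_between x y p : bool :=
  [&& uniq p, ohead p == Some x & last x p == y].

Definition path_edge p : rel V :=
  fun u v => infix [:: u; v] p || infix [:: v; u] p.

Definition internally_disjoint x y ps : Prop :=
  forall p q, p \in ps -> q \in ps -> p != q ->
  forall z, z \in p -> z \in q -> z = x \/ z = y.

Definition consists_of G ps : Prop :=
  (forall v, exists2 p, p \in ps & v \in p) /\
  (forall u v, adj G u v <-> exists2 p, p \in ps & path_edge p u v).

Definition is_path_bundle G x y : Prop :=
  x != y /\
  exists ps, [/\ uniq ps, 2 <= size ps,
                 (forall p, p \in ps -> is_path_between x y p),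
                 internally_disjoint x y ps &
                 consists_of G ps].

Definition no_common_neighbor G x y : Prop :=
  forall z, ~ (adj G x z /\ adj G y z).

End PathSystems.

(* Main.v *)
(* A set X of vertices of G gives the vector u with u v = ([v in X], parity of the number of
   neighbours of v in X); these vectors form a Lagrangian subspace L of ((F_2)^2)^V, and local
   complementation changes L only by coordinatewise linear automorphisms. The graph is prime
   iff every A with 2 <= |A|, |V \ A| supports a subspace of L of dimension at most |A| - 2.
   The three reductions at v correspond to the three nonzero directions k of (F_2)^2: keep the
   vectors whose entry at v is 0 or k. So v is essential iff two directions at v destroy
   primality.

   Uncrossing two splits shows that an essential vertex lies in a triplet (a vector of L with
   support of size three) and, as in Tutte's triangle lemma, that a triplet with two essential
   vertices can be prolonged by a second triplet meeting it in two vertices. Iterating produces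
   fans: sequences of vertices whose consecutive triples are triplets. A fan grows until it
   spans V, in which case G is locally equivalent to a cycle, or both its ends x and y are
   non-essential. If at most two vertices are non-essential, all other vertices lie inside fans
   from x to y, every triplet meeting the inside of such a fan consists of consecutive vertices
   of it, and so two fans are disjoint or have the same inside. In a suitable graph locally
   equivalent to G, the triplet centred at an inner vertex v becomes the vector of X = {v}:
   inner vertices have degree two and the fans become the paths of the bundle. *)

Require Import Defs.
From HB Require Import structures.
From mathcomp Require Import all_boot.
From mathcomp Require Import all_algebra.
From mathcomp Require Import zify.

Set Implicit Arguments.
Unset Strict Implicit.
Unset Printing Implicit Defensive.
Import GRing.Theory.

(** The dimension of a box serves both for primality ([A = C]) and for the reduction at [a]
    ([C = a |: A]), so that duality and modularity of boxes replace rank computations. Primality is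
    used by contradiction: a set with two elements inside and two outside is shown to have too large
    a dimension. This is why a fan must leave two vertices outside, and why a fan spanning [V] is a
    case of its own.

    The obstacle is an essential vertex [c] in a triplet [{c, x, y}] with [x] and [y] non-essential:
    no fan need contain [c], and it would become the middle of a path of length two, which the
    condition on common neighbours forbids. A split at [c] has to separate [x] from [y]; a fan from
    [x] to [y] allows shifting it, vertex by vertex, until it no longer does.

    The final graph is found from directions. At each vertex [z] all the triplets of the fans not
    centred at [z] have entry zero or one common entry [e z], and no nonzero vector of [L] has all
    its entries in [{0, e}]. Local complementations can then turn every [e z] into [(0, 1)], the
    direction of deletion. *)

Local Notation K := (bool^o * bool^o)%type.

(** * The symplectic plane over the field with two elements *)

Definition sp (k l : K) : bool := k.1 && l.2 (+) k.2 && l.1.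

Lemma spC k l : sp k l = sp l k.
Proof. by case: k l => [[] []] [[] []]. Qed.
Lemma sp0 l : sp 0%R l = false.
Proof. by case: l => [[] []]. Qed.
Lemma spE k l : sp k l = [&& k != 0%R, l != 0%R & k != l].
Proof. by case: k l => [[] []] [[] []]. Qed.
Lemma K_addr_eq0 (k l : K) : ((k + l)%R == 0%R) = (k == l).
Proof. by case: k l => [[] []] [[] []]. Qed.
Lemma K_addkk (k : K) : (k + k = 0)%R.
Proof. by case: k => [[] []]. Qed.
Lemma K_third (k l m : K) : k != 0%R -> l != 0%R -> m != 0%R -> m != k -> m != l ->
  k != l -> m = (k + l)%R.
Proof. by case: k l m => [[] []] [[] []] [[] []]. Qed.

(** * Boxes in a Lagrangian subspace *)

Section Spaces.
Variable E : vectType bool.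
Implicit Types U W : {vspace E}.

(** Over two elements the hypothesis says that [W] has at most one nonzero class modulo [U]. *)
Lemma dim_succ_bound U W :
  (forall a b, a \in W -> b \in W -> a \notin U -> b \notin U -> (a + b)%R \in U) ->
  \dim W <= (\dim U).+1.
Proof.
move=> h; case: (boolP (W <= U)%VS) => [/dimvS/leqW//|/subvPn[a aW aU]].
have sW : (W <= U + <[a]>)%VS.
  apply/subvP=> b bW; case: (boolP (b \in U)) => bU; first exact: (subvP (addvSl _ _)) bU.
  have -> : b = ((a + b) - a)%R by rewrite addrC addKr.
  by apply: memv_add; [exact: h | rewrite memvN memv_line].
apply: leq_trans (dimvS sW) _; apply: leq_trans (dimv_add_leqif _ _) _.
by rewrite dim_vline -addn1 leq_add2l; case: eqP.
Qed.

Lemma dim_lt U W a : (U <= W)%VS -> a \in W -> a \notin U -> \dim U < \dim W.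
Proof.
move=> sUW aW; apply: contraNltn => hd.
suff -> : U = W by [].
by apply/eqP; rewrite eqEdim sUW.
Qed.

Lemma dim_modular U1 U2 Q R : (U1 :&: U2 <= Q)%VS -> (U1 <= R)%VS -> (U2 <= R)%VS ->
  \dim U1 + \dim U2 <= \dim Q + \dim R.
Proof.
move=> sQ s1 s2; rewrite -dimv_sum_cap addnC leq_add ?dimvS //.
by rewrite subv_add s1.
Qed.

End Spaces.

Section Gather.
Variable V : finType.
Notation E := {ffun V -> K}.

(** For a predicate that contains zero and is closed under addition the span adds nothing, the only
    scalars being 0 and 1; so a boolean test defines a subspace. *)
Definition gather (S : pred E) : {vspace E} := <<enum S>>%VS.

Lemma mem_gather (S : pred E) :
  S 0%R -> (forall u w, S u -> S w -> S (u + w)%R) -> gather S =i S.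
Proof.
move=> S0 SD u; apply/idP/idP => [|Su]; last by rewrite memv_span // mem_enum.
move/coord_span=> ->; apply: (@big_ind _ (fun u => u \in S)) => // i _.
set c := coord _ _ _; have: tnth (enum_tuple S) i \in enum S by rewrite mem_tnth.
rewrite mem_enum (tnth_nth 0%R) /=.
by case: c; rewrite ?scale1r ?scale0r.
Qed.
End Gather.

(** Isotropy bounds the dimension by [#|V|], half of that of the ambient space, so the lower bound
    makes it exact. *)
Record lagrangian (V : finType) := Lagrangian {
  lag_space :> {vspace {ffun V -> K}};
  isoL : forall u w : {ffun V -> K}, u \in lag_space -> w \in lag_space ->
    \big[addb/false]_v sp (u v) (w v) = false;
  dimL : #|V| <= \dim lag_space
}.

Section Boxes.
Variables (V : finType) (L : lagrangian V).
Implicit Types (e : V -> K) (A B C D : {set V}) (u w t : {ffun V -> K}) (a b c v z : V).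

Definition supp u : {set V} := [set v | u v != 0%R].

Lemma in_supp u v : (v \in supp u) = (u v != 0%R).
Proof. by rewrite inE. Qed.

(** With [C = A] this means support in [A]; with [C = a |: A], it describes what the reduction at
    [a] in the direction [e a] leaves on [A]. *)
Definition inbox e A C u :=
  [forall v, [|| v \in A, u v == 0%R | (v \in C) && (u v == e v)]].

Definition box_space e A C := (L :&: gather (inbox e A C))%VS.

Lemma mem_box_space e A C u : (u \in box_space e A C) = (u \in L) && inbox e A C u.
Proof.
rewrite memv_cap mem_gather //.
  by apply/forallP=> v; rewrite ffunE eqxx orbT.
move=> {}u w /forallP hu /forallP hw; apply/forallP=> v; rewrite ffunE.
case: (v \in A) (hu v) (hw v) => //=; case: (v \in C) => /=; last first.
  by rewrite !orbF => /eqP-> /eqP->; rewrite addr0.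
by case/orP=> /eqP->; case/orP=> /eqP->; rewrite ?addr0 ?add0r ?K_addkk ?eqxx ?orbT.
Qed.

Lemma box_spaceP e A C u : reflect
  (u \in L /\ forall v, v \notin A -> u v = 0%R \/ (v \in C /\ u v = e v))
  (u \in box_space e A C).
Proof.
rewrite mem_box_space; apply: (iffP andP) => -[uL hu]; split=> //.
  move=> v vA; move/forallP: hu => /(_ v); rewrite (negbTE vA) /=.
  by case/orP=> [/eqP->|/andP[-> /eqP->]]; [left | right].
apply/forallP=> v; case: (boolP (v \in A)) => //= vA.
by case: (hu v vA) => [->|[-> ->]]; rewrite eqxx ?orbT.
Qed.

Definition box_dim e A C := \dim (box_space e A C).


(** Enlarging a box at one vertex, in [A] here and in [C] in the next lemma, is detected by the
    entry there, hence adds at most one dimension. The induction for duality needs exactly this. *)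
Lemma box_space_line e A C v u : v \in C -> u \in box_space e (v |: A) C ->
  (u \in box_space e A C) = (v \in A) || (u v == 0%R) || (u v == e v).
Proof.
move=> vC /box_spaceP[uL hu]; apply/box_spaceP/idP => [[_ /(_ v)]|h].
  by case: (v \in A) => //= /(_ isT)[->|[_ ->]]; rewrite eqxx ?orbT.
split=> // z zA; have [Ez|nz] := eqVneq z v; last by apply: hu; rewrite !inE negb_or nz.
by move: h; rewrite -Ez (negbTE zA) /= => /orP[]/eqP->; [left | right; rewrite Ez].
Qed.

Lemma box_space_zero e A C v u : v \notin C -> u \in box_space e A (v |: C) ->
  (u \in box_space e A C) = (v \in A) || (u v == 0%R).
Proof.
move=> vC /box_spaceP[uL hu]; apply/box_spaceP/idP => [[_ /(_ v)]|h].
  by case: (v \in A) => //= /(_ isT)[->|[]]; rewrite ?eqxx // (negbTE vC).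
split=> // z zA; case: (hu z zA) => [->|[]]; first by left.
rewrite !inE => /orP[/eqP Ez|zC] h2; last by right.
by move: h; rewrite -Ez (negbTE zA) => /eqP->; left.
Qed.

(* For [A \subset C], the dual of the box [(A, C)] is [(~: C, ~: A)]. *)
Lemma box_dim_dual_le e A C : (forall v, e v != 0%R) -> A \subset C ->
  box_dim e (~: C) (~: A) + #|A| + #|C| <= box_dim e A C + #|V|.
Proof.
move=> he; have [m] := ubnP (#|~: A| + #|~: C|).
elim: m A C => // m IH A C hm sAC.
(* Enlarging [(A, C)] at [v] shrinks the dual box. If both dimensions changed, a vector [u] gained
   on one side and a vector [w] lost on the other would pair to zero everywhere except at [v],
   against isotropy. *)
have step A' C' v : A' \subset C' -> A \subset A' -> C \subset C' ->
    #|A'| + #|C'| = (#|A| + #|C|).+1 ->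
    box_dim e A' C' <= (box_dim e A C).+1 -> box_dim e (~: C) (~: A) <= (box_dim e (~: C') (~: A')).+1 ->
    (forall u w, u \in box_space e A' C' -> u \notin box_space e A C ->
      w \in box_space e (~: C) (~: A) -> w \notin box_space e (~: C') (~: A') ->
      sp (u v) (w v)) ->
    (forall z, z != v -> (z \in A') = (z \in A) /\ (z \in C') = (z \in C)) ->
    box_dim e (~: C) (~: A) + #|A| + #|C| <= box_dim e A C + #|V|.
  move=> sAC' sA sC hc h1 h2 h3 h4.
  have {}IH: box_dim e (~: C') (~: A') + #|A'| + #|C'| <= box_dim e A' C' + #|V|.
    apply: (IH _ _ _ sAC').
    by move: hm hc (cardsC A) (cardsC C) (cardsC A') (cardsC C'); lia.
  suff: (box_dim e A' C' <= box_dim e A C) \/ (box_dim e (~: C) (~: A) <=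
     box_dim e (~: C') (~: A')) by lia.
  case: (boolP (box_space e A' C' <= box_space e A C)%VS) => [/dimvS|/subvPn[u u1 u2]];
    first by left.
  case: (boolP (box_space e (~: C) (~: A) <= box_space e (~: C') (~: A'))%VS)
    => [/dimvS|/subvPn[w w1 w2]].
    by right.
  have := h3 _ _ u1 u2 w1 w2.
  case/box_spaceP: u1 => uL hu; case/box_spaceP: w1 => wL hw.
  have := isoL uL wL; rewrite (bigD1 v) //= big1 ?addbF => [->//|z /h4[zA zC]].
  have := hu z; rewrite zA zC => {}hu; have := hw z; rewrite !inE => {}hw.
  case: (boolP (z \in A)) => zA'.
    case: hw => [|->|[]]; rewrite ?zA' ?(subsetP sAC) //.
    by rewrite spC sp0.
  case: (hu zA') => [->|[zC' ->]]; first by rewrite sp0.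
  case: hw => [|->|[_ ->]]; rewrite ?zC' //; first by rewrite spC sp0.
  by rewrite spE eqxx !andbF.
(* The induction ends at [A = C = setT], where the dual box is zero and the claim is the lower bound
   on the dimension of [L]. *)
have [EA|] := eqVneq A setT.
  have EC : C = setT by apply/eqP; rewrite -subTset -EA.
  have -> : box_dim e (~: C) (~: A) = 0.
    apply/eqP; rewrite /box_dim dimv_eq0 -subv0; apply/subvP=> u /box_spaceP[_ hu].
    rewrite memv0; apply/eqP/ffunP=> v; rewrite ffunE.
    by case: (hu v); rewrite ?EA ?EC ?inE // => -[].
  rewrite EA EC cardsT leq_add2r; apply: leq_trans (dimL L) _.
  by apply: dimvS; apply/subvP=> u uL; apply/box_spaceP; split=> // v; rewrite inE.
rewrite -subTset => /subsetPn[v _ vA].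
case: (boolP (v \in C)) => vC.
  have dA : ~: A = v |: ~: (v |: A).
    by apply/setP=> z; rewrite !inE; case: eqP => //= ->.
  have v1 : v \notin ~: (v |: A) by rewrite !inE eqxx.
  have v2 : v \notin ~: C by rewrite inE negbK.
  apply: (step (v |: A) C v).
  - by apply/subsetP=> z; rewrite !inE => /orP[/eqP->//|/(subsetP sAC)].
  - exact: subsetUr.
  - by [].
  - by rewrite cardsU1 vA; lia.
  - apply: dim_succ_bound => u w uS wS nu nw.
    have uwS := rpredD uS wS.
    move: nu nw; rewrite (box_space_line vC uS) (box_space_line vC wS)
      (box_space_line vC uwS) (negbTE vA) !ffunE /=.
    by move: (he v); case: (u v) (w v) (e v) => [[] []] [[] []] [[] []].
  - rewrite dA; apply: dim_succ_bound => u w uS wS nu nw.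
    have uwS := rpredD uS wS.
    move: (nu) (nw); rewrite (box_space_zero v1 uS) (box_space_zero v1 wS)
      (box_space_zero v1 uwS) (negbTE v2) !ffunE K_addr_eq0 /=.
    case/box_spaceP: uS => _ /(_ v v2)[->|[_ ->]]; rewrite ?eqxx //.
    by case/box_spaceP: wS => _ /(_ v v2)[->|[_ ->]]; rewrite ?eqxx.
  - move=> u w uS; rewrite (box_space_line vC uS) dA => nu wS; rewrite (box_space_zero v1 wS).
    case/box_spaceP: wS => _ /(_ v v2)[->|[_ ->]]; first by rewrite eqxx orbT.
    by move: nu (he v); rewrite (negbTE vA) spE; case: (u v) (e v) => [[] []] [[] []].
  - by move=> z /negbTE nz; rewrite !inE nz.
have dC : ~: C = v |: ~: (v |: C).
  by apply/setP=> z; rewrite !inE; case: eqP => //= ->; rewrite vC.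
have v1 : v \notin ~: (v |: C) by rewrite !inE eqxx.
have v2 : v \in ~: A by rewrite inE.
apply: (step A (v |: C) v).
- by apply: subset_trans sAC _; exact: subsetUr.
- by [].
- exact: subsetUr.
- by rewrite cardsU1 vC; lia.
- apply: dim_succ_bound => u w uS wS nu nw.
  have uwS := rpredD uS wS.
  move: (nu) (nw); rewrite (box_space_zero vC uS) (box_space_zero vC wS)
      (box_space_zero vC uwS) (negbTE vA) !ffunE K_addr_eq0 /=.
  case/box_spaceP: uS => _ /(_ v vA)[->|[_ ->]]; rewrite ?eqxx //.
  by case/box_spaceP: wS => _ /(_ v vA)[->|[_ ->]]; rewrite ?eqxx.
- rewrite dC; apply: dim_succ_bound => u w uS wS nu nw.
  have uwS := rpredD uS wS.
  move: nu nw; rewrite (box_space_line v2 uS) (box_space_line v2 wS)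
      (box_space_line v2 uwS) (negbTE v1) !ffunE /=.
  by move: (he v); case: (u v) (w v) (e v) => [[] []] [[] []] [[] []].
- move=> u w uS; rewrite (box_space_zero vC uS) dC => nu wS; rewrite (box_space_line v2 wS) (negbTE v1) /=.
  case/box_spaceP: uS nu => _ /(_ v vA)[->|[_ ->]]; first by rewrite eqxx orbT.
  by move: (he v); rewrite (negbTE vA) spE; case: (w v) (e v) => [[] []] [[] []].
- by move=> z /negbTE nz; rewrite !inE nz.
Qed.

(** The dual of the dual is the original box, so the inequality for both boxes gives equality. *)
Lemma box_dim_dual e A C : (forall v, e v != 0%R) -> A \subset C ->
  box_dim e (~: C) (~: A) + #|A| + #|C| = box_dim e A C + #|V|.
Proof.
move=> he sAC; have := box_dim_dual_le he sAC.
have sCA : ~: C \subset ~: A by rewrite setCS.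
have := box_dim_dual_le he sCA; rewrite !setCK.
by move: (cardsC A) (cardsC C); lia.
Qed.


Lemma box_dim_modular e A1 A2 C1 C2 : A1 \subset C1 -> A2 \subset C2 ->
  box_dim e A1 C1 + box_dim e A2 C2 <=
  box_dim e (A1 :&: A2) (C1 :&: C2) + box_dim e (A1 :|: A2) (C1 :|: C2).
Proof.
move=> /subsetP s1 /subsetP s2; apply: dim_modular; apply/subvP=> u.
- rewrite memv_cap => /andP[/box_spaceP[uL h1] /box_spaceP[_ h2]]; apply/box_spaceP.
  split=> // v; rewrite !inE negb_and.
  case: (boolP (v \in A1)) => [vA1 /h2[->|[vC2 ->]]|/h1[-> _|[vC1 Eu] _]]; [by left| |by left|].
    by right; rewrite s1.
  case: (boolP (v \in A2)) => [vA2|/h2[->|[vC2 ->]]]; [|by left|].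
    by right; rewrite vC1 s2.
  by right; rewrite vC1 vC2.
- move=> /box_spaceP[uL h1]; apply/box_spaceP; split=> // v; rewrite !inE negb_or.
  by case/andP=> /h1[->|[-> ->]]; auto.
- move=> /box_spaceP[uL h1]; apply/box_spaceP; split=> // v; rewrite !inE negb_or.
  by case/andP=> _ /h1[->|[-> ->]]; rewrite ?orbT; auto.
Qed.

Lemma box_dim_eq e e' A C : (forall v, v \in C -> v \notin A -> e v = e' v) ->
  box_dim e A C = box_dim e' A C.
Proof.
move=> h; congr (\dim _); apply/vspaceP=> u; apply/box_spaceP/box_spaceP => -[uL hu]; split=> // v vA;
  by case: (hu v vA) => [->|[vC ->]]; rewrite ?(h v vC vA); auto.
Qed.

Lemma box_dim_lt e e' A C A' C' t : (box_space e A C <= box_space e' A' C')%VS ->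
  t \in box_space e' A' C' -> t \notin box_space e A C -> box_dim e A C < box_dim e' A' C'.
Proof. exact: dim_lt. Qed.

End Boxes.

(** * Prime Lagrangians and splits *)

Section PrimeLagrangian.
Variables (V : finType) (L : lagrangian V).
Implicit Types (e : V -> K) (A B C D : {set V}) (u w t : {ffun V -> K}) (a b c v z : V)
  (k l : K).

(** The direction is a placeholder: with equal sets no entry is confined to a line. *)
Definition set_dim A := box_dim L (fun=> (true, true)) A A.

Lemma set_dimE e A : box_dim L e A A = set_dim A.
Proof. by apply: box_dim_eq => v ->. Qed.

Lemma set_spaceP e A u : reflect (u \in L /\ supp u \subset A) (u \in box_space L e A A).
Proof.
apply: (iffP (box_spaceP _ _ _ _ _)) => -[uL hu]; split=> //.
  apply/subsetP=> v; rewrite in_supp; apply: contraR => vA.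
  by case: (hu v vA) => [->|[vA']] //; rewrite vA' in vA.
move=> v vA; left; apply/eqP; rewrite -[_ == _]negbK -in_supp.
by apply: contra vA; apply: (subsetP hu).
Qed.

Lemma set_dim_dual A : set_dim (~: A) + #|A| + #|A| = set_dim A + #|V|.
Proof. by rewrite /set_dim box_dim_dual. Qed.

Definition prime_lagrangian := forall A, 2 <= #|A| -> 2 <= #|~: A| -> set_dim A + 2 <= #|A|.

(** The inequality is the mark of a split in the reduced space: the vectors left on [A] fall short
    of [#|A|] by at most one dimension. *)
Definition split_at a k A :=
  [&& a \notin A, 2 <= #|A|, 2 <= #|~: (a |: A)| & #|A| <= (box_dim L (fun=> k) A (a |: A)).+1].

(* Removing [a] in the direction [k] keeps the vectors whose entry at [a] is [0] or [k]. *)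
Definition nonprime_dir a k := [exists A, split_at a k A].

Lemma cardsU1C a A : a \notin A -> #|A| + #|~: (a |: A)| + 1 = #|V|.
Proof. by move=> aA; have := cardsC (a |: A); rewrite cardsU1 aA; lia. Qed.

Lemma setC_U1 a A : a \notin A -> ~: A = a |: ~: (a |: A).
Proof. by move=> aA; apply/setP=> z; rewrite !inE; case: eqP => //= ->. Qed.

Lemma split_at_compl a k A : k != 0%R -> split_at a k A -> split_at a k (~: (a |: A)).
Proof.
move=> k0 /and4P[aA h2 h2' hp]; rewrite /split_at -(setC_U1 aA) setCK h2' h2 !inE eqxx /=.
have := @box_dim_dual _ L (fun=> k) A (a |: A) (fun=> k0) (subsetUr _ _).
by have := cardsU1C aA; rewrite cardsU1 aA; lia.
Qed.

Hypothesis primeL : prime_lagrangian.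

(** A nonzero vector supported in a pair would give this pair dimension one, where primality allows
    zero; [4 <= #|V|] leaves two vertices outside. *)
Lemma supp_ge3 u : 4 <= #|V| -> u \in L -> u != 0%R -> 3 <= #|supp u|.
Proof.
move=> V4 uL u0; rewrite leqNgt; apply/negP=> h.
have [A sA cA] : exists2 A : {set V}, supp u \subset A & #|A| = 2.
  have : exists2 A : {set V}, supp u \subset A & #|A| = 2 - #|supp u| + #|supp u|.
    have : 2 - #|supp u| <= #|~: supp u| by have := cardsC (supp u); lia.
    elim: (2 - #|supp u|) => [|m IH] hm; first by exists (supp u).
    case: IH => [|A sA cA]; first by lia.
    have : ~: A != set0.
      rewrite -card_gt0; have := cardsC A; have := cardsC (supp u); lia.
    case/set0Pn=> z; rewrite inE => zA; exists (z |: A).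
      by apply: subset_trans sA _; apply: subsetUr.
    by rewrite cardsU1 zA cA.
  by case=> A sA cA; exists A => //; lia.
have := primeL (A := A); rewrite cA => /(_ isT).
have := cardsC A; rewrite cA => hc /(_ ltac:(lia)).
have: 0 < set_dim A; last by lia.
rewrite lt0n /set_dim /box_dim dimv_eq0; apply: contraNneq u0 => h0.
by rewrite -memv0 -h0; apply/set_spaceP.
Qed.

Definition trip u a b c := [&& u \in L, uniq [:: a; b; c] & supp u == [set a; b; c]].

Lemma tripP u a b c : trip u a b c ->
  [/\ u \in L, [/\ a != b, a != c & b != c], [/\ u a != 0%R, u b != 0%R & u c != 0%R]
    & forall z, z != a -> z != b -> z != c -> u z = 0%R].
Proof.
case/and3P=> uL; rewrite /= !inE negb_or andbT => /andP[/andP[ab ac] bc] /eqP hs; split=> //.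
  by split; rewrite -in_supp hs !inE eqxx ?orbT.
move=> z za zb zc; apply/eqP; rewrite -[_ == _]negbK -in_supp hs !inE.
by rewrite (negbTE za) (negbTE zb) (negbTE zc).
Qed.

(** Only vanishing outside [a], [b], [c] needs checking: by [supp_ge3] the three vertices are then
    distinct and their entries nonzero. *)
Lemma trip_intro u a b c : 4 <= #|V| -> u \in L -> u != 0%R ->
  (forall z, z != a -> z != b -> z != c -> u z = 0%R) -> trip u a b c.
Proof.
move=> V4 uL u0 hz; have h3 := supp_ge3 V4 uL u0.
have hs : supp u \subset [set a; b; c].
  apply/subsetP=> z; rewrite in_supp !inE; apply: contraR; rewrite !negb_or -andbA.
  by case/and3P=> *; rewrite hz.
have hc : #|[set a; b; c]| <= 3 by rewrite setUC !cardsU1 cards1; do 2!case: (_ \notin _).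
have h3' : #|[set a; b; c]| = 3 by have := subset_leq_card hs; lia.
rewrite /trip uL eqEcard hs h3' h3 /= andbT !inE.
move: h3'; rewrite setUC !cardsU1 cards1 !inE [c == a]eq_sym [c == b]eq_sym.
by case: (a == b); case: (a == c); case: (b == c).
Qed.

Lemma trip_rot u a b c : trip u a b c = trip u b c a.
Proof.
rewrite /trip; congr [&& _, _ & _]; last by rewrite [in RHS]setUC setUA.
by rewrite -[in RHS](rot_uniq 2).
Qed.

Lemma trip_swap u a b c : trip u a b c = trip u b a c.
Proof.
rewrite /trip [in RHS](setUC [set b]) /= !inE [b == a]eq_sym !negb_or.
by case: (a == b); case: (a == c); case: (b == c).
Qed.

Lemma trip_rev u a b c : trip u a b c = trip u c b a.
Proof. by rewrite trip_swap trip_rot trip_rot trip_swap trip_rot. Qed.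

(** The box of a pair that is a split contains a nonzero vector; its support has size three, so it
    includes [a], where the entry can only be [k]. *)
Lemma split_at_pair a k A : 4 <= #|V| -> split_at a k A -> #|A| = 2 ->
  exists u b c, [/\ A = [set b; c], trip u a b c & u a = k].
Proof.
move=> V4 /and4P[aA _ _ hp] /eqP/cards2P[b [c [bc EA]]].
rewrite EA cards2 bc /box_dim /= in hp.
have: box_space L (fun=> k) [set b; c] (a |: [set b; c]) != 0%VS by rewrite -dimv_eq0 -lt0n; lia.
rewrite -vpick0; set u := vpick _; move=> u0.
have /box_spaceP[uL hu] : u \in box_space L (fun=> k) [set b; c] (a |: [set b; c]) by apply: memv_pick.
have T : trip u a b c.
  apply: trip_intro => // z za zb zc; have zA : z \notin [set b; c] by rewrite !inE negb_or zb.
  by case: (hu z zA) => [//|[]]; rewrite !inE (negbTE za) (negbTE zb) (negbTE zc).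
exists u, b, c; split=> //; case/tripP: T => _ [ab ac _] [ua _ _] _.
case: (hu a) => [|/eqP|[]//]; first by rewrite -EA.
by rewrite (negbTE ua).
Qed.

Lemma nonprime_trip a k l : 5 <= #|V| -> k != 0%R -> l != 0%R -> k != l ->
  nonprime_dir a k -> nonprime_dir a l -> exists u b c, trip u a b c.
Proof.
move=> V5 k0 l0 kl /existsP[A1 s1] /existsP[A2 s2].
have V4 : 4 <= #|V| := ltnW V5.
(* Since [k != l], a vector of both boxes vanishes at [a]. So the two box dimensions add up to at
   most those of [A :&: B] and [a |: (A :|: B)]; if primality applied to both of these sets, the sum
   would be too small. *)
have key A B : split_at a k A -> split_at a l B ->
    (#|A :&: B| <= 1) || (#|~: (a |: A) :&: ~: (a |: B)| <= 1).
  case/and4P=> aA hA hA' hpA /and4P[aB hB hB' hpB].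
  have : box_dim L (fun=> k) A (a |: A) + box_dim L (fun=> l) B (a |: B) <=
    set_dim (A :&: B) + set_dim (a |: (A :|: B)).
    apply: dim_modular; apply/subvP=> u.
    - rewrite memv_cap => /andP[/box_spaceP[uL h1] /box_spaceP[_ h2]].
      apply/box_spaceP; split=> // z; rewrite inE negb_and => hz; left.
      have [Ea|za] := eqVneq z a.
        case: (h1 z) => [|//|[_ uk]]; first by rewrite Ea.
        case: (h2 z) => [|//|[_ ul]]; first by rewrite Ea.
        by move: kl; rewrite -uk -ul eqxx.
      case/orP: hz => hz.
        by case: (h1 z hz) => [//|[]]; rewrite !inE (negbTE za) (negbTE hz).
      by case: (h2 z hz) => [//|[]]; rewrite !inE (negbTE za) (negbTE hz).
    - case/box_spaceP=> uL h1; apply/box_spaceP; split=> // z.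
      rewrite !inE !negb_or => /and3P[za zA _]; left.
      by case: (h1 z zA) => [//|[]]; rewrite !inE (negbTE za) (negbTE zA).
    - case/box_spaceP=> uL h1; apply/box_spaceP; split=> // z.
      rewrite !inE !negb_or => /and3P[za _ zB]; left.
      by case: (h1 z zB) => [//|[]]; rewrite !inE (negbTE za) (negbTE zB).
  move=> hsup; have E1 : ~: (a |: (A :|: B)) = ~: (a |: A) :&: ~: (a |: B).
    by apply/setP=> z; rewrite !inE; case: (z == a); case: (z \in A); case: (z \in B).
  have aAB : a \notin A :|: B by rewrite inE negb_or aA.
  have := set_dim_dual (a |: (A :|: B)); have := cardsU1C aAB; rewrite E1 cardsU1 aAB.
  case: leqP => // h1; case: leqP => // h2.
  have := primeL h1; have := primeL h2.
  have := cardsC (A :&: B); have := cardsC (~: (a |: A) :&: ~: (a |: B)).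
  have := cardsUI A B; have := subset_leq_card (subsetIl A B).
  have := subset_leq_card (subsetIl (~: (a |: A)) (~: (a |: B))).
  have := cardsU1C aA; have := cardsU1C aB; lia.
(* Crossing [A1] with both sides of the second split yields two corners of at most one element each.
   Together they make up one of the four sides, which is therefore a pair. *)
have := key _ _ s1 s2; have := key _ _ s1 (split_at_compl l0 s2).
have [a1 a2] : a \notin A1 /\ a \notin A2 by case/and4P: s1; case/and4P: s2.
set B1 := ~: (a |: A1); set B2 := ~: (a |: A2).
have -> : ~: (a |: B2) = A2.
  by apply/setP=> z; rewrite !inE; case: eqP => //= [->|]; rewrite ?(negbTE a2) ?negbK.
have s1' := split_at_compl k0 s1; have s2' := split_at_compl l0 s2.
have done2 m A : m != 0%R -> split_at a m A -> #|A| <= 2 -> exists u b c, trip u a b c.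
  move=> m0 sA cA; have c2 : #|A| = 2 by case/and4P: (sA); lia.
  by case: (split_at_pair V4 sA c2) => u [b [c [_ T _]]]; exists u, b, c.
have part A B : #|A| = #|A :&: B| + #|A :&: ~: B| by rewrite -setDE cardsID.
have EA1 : A1 :&: B2 = A1 :&: ~: A2.
  by apply/setP=> z; rewrite !inE; case: eqP => //= ->; rewrite (negbTE a1).
have EA2 : B1 :&: A2 = A2 :&: ~: A1.
  apply/setP=> z; rewrite !inE; case: eqP => //= [->|_]; rewrite ?(negbTE a2) //.
  by rewrite andbC.
have EB : B1 :&: B2 = B1 :&: ~: A2.
  by apply/setP=> z; rewrite !inE; case: eqP.
have EB' : B2 :&: ~: A1 = B1 :&: B2.
  by apply/setP=> z; rewrite !inE; case: eqP => //= _; rewrite andbC.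
case/orP=> h1; case/orP=> h2.
- by apply: (done2 k A1) => //; rewrite (part A1 A2) -EA1; lia.
- by apply: (done2 l B2) => //; rewrite (part B2 A1) EB' setIC; lia.
- by apply: (done2 l A2) => //; rewrite (part A2 A1) -EA2 setIC; lia.
- by apply: (done2 k B1) => //; rewrite (part B1 A2) -EB; lia.
Qed.

Lemma box_space_sub e e' A C A' C' : A \subset A' -> C \subset C' ->
  (forall v, v \in C -> v \notin A -> v \in A' \/ e v = e' v) ->
  (box_space L e A C <= box_space L e' A' C')%VS.
Proof.
move=> sA sC he; apply/subvP=> u /box_spaceP[uL hu]; apply/box_spaceP; split=> // v vA'.
have vA : v \notin A by apply: contra vA'; apply: (subsetP sA).
case: (hu v vA) => [->|[vC ->]]; first by left.
by right; case: (he v vC vA) => [vA2|->]; rewrite ?(subsetP sC) // vA2 in vA' *.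
Qed.

(** If [b] and [c] were on the same side [B], freeing the entry at [a] would admit [t] as a new
    vector, and [a |: B] would violate primality. *)
Lemma split_at_sep t a b c k A : trip t a b c -> k != 0%R -> k != t a -> split_at a k A ->
  (b \in A) = (c \notin A).
Proof.
move=> T k0 kt.
have key B : split_at a k B -> b \in B -> c \notin B.
  case/and4P=> aB hB hB' hp bB; apply/negP=> cB.
  have [tL _ [ta _ _] tz] := tripP T.
  have : box_dim L (fun=> k) B (a |: B) < set_dim (a |: B).
    apply: (box_dim_lt (t := t)).
    - apply: box_space_sub => //; first exact: subsetUr.
      by move=> v; rewrite !inE => ->; left.
    - apply/set_spaceP; split=> //; apply/subsetP=> z; rewrite in_supp !inE.
      apply: contraR; rewrite negb_or => /andP[za zB]; rewrite tz //.
        by apply: contraNneq zB => ->.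
      by apply: contraNneq zB => ->.
    - apply/negP=> /box_spaceP[_ /(_ a aB)[h|[_ h]]]; first by rewrite h in ta.
      by rewrite h eqxx in kt.
  have := primeL (A := a |: B); rewrite cardsU1 aB => /(_ ltac:(lia) hB'); lia.
move=> sA; apply/idP/idP => [/(key _ sA)//|cA]; apply: contraT => bA.
have [_ [ab ac _] _ _] := tripP T.
have := key _ (split_at_compl k0 sA); rewrite !inE (negbTE bA) (negbTE cA).
by rewrite eq_sym (negbTE ab) eq_sym (negbTE ac) => /(_ isT).
Qed.
End PrimeLagrangian.

(* [lia] preprocesses the whole context, which is prohibitive in the long proofs below. *)
Ltac lia0 := clear; lia.

(** * Uncrossing splits at two vertices of a triplet *)

Section Triangle.
Variables (V : finType) (L : lagrangian V).
Implicit Types (e : V -> K) (A B C D : {set V}) (u w t : {ffun V -> K}) (a b c d v z : V)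
  (k l : K).
Hypothesis primeL : prime_lagrangian L.
Hypothesis V5 : 5 <= #|V|.

Lemma box_dim_full e A C : A \subset C -> box_dim L e A C <= set_dim L C.
Proof. by move=> sAC; apply/dimvS/box_space_sub => // v vC; left. Qed.

Lemma set_dim_small A : #|A| <= 2 -> set_dim L A = 0.
Proof.
move=> hA; apply/eqP; rewrite /set_dim /box_dim dimv_eq0 -subv0; apply/subvP=> u /set_spaceP[uL su].
rewrite memv0; apply: contraTT isT => u0.
have := supp_ge3 primeL (ltnW V5) uL u0; have := subset_leq_card su; lia.
Qed.

(** A set that avoids the triplet is no split at [a] in the direction [e a], because such a split
    separates [b] from [c]. Sizes zero and one are stated apart, as the general bound fails
    there. *)
Lemma split_at_sep_dim e t a b c A : trip L t a b c -> e a != 0%R -> e a != t a ->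
  a \notin A -> b \notin A -> c \notin A ->
  [/\ #|A| = 1 -> box_dim L e A (a |: A) = 0, #|A| = 0 -> box_dim L e A (a |: A) = 0
    & 2 <= #|A| -> box_dim L e A (a |: A) + 2 <= #|A|].
Proof.
move=> T e0 et aA bA cA.
have small : #|A| <= 1 -> box_dim L e A (a |: A) = 0.
  move=> hA; apply/eqP; rewrite -leqn0 -(@set_dim_small (a |: A)); last by rewrite cardsU1 aA.
  exact: box_dim_full (subsetUr _ _).
split=> [h|h|h]; [by apply: small; lia|by apply: small; lia|].
rewrite leqNgt; apply/negP=> hp.
have : split_at L a (e a) A.
  rewrite /split_at aA h /=; apply/andP; split.
    have [_ [ab ac bc] _ _] := tripP T.
    have <- : #|[set b; c]| = 2 by rewrite cards2 bc.
    apply: subset_leq_card; apply/subsetP=> z; rewrite !inE negb_or.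
    by case/orP=> /eqP->; rewrite eq_sym ?ab ?ac.
  rewrite (@box_dim_eq _ _ _ e); first by lia.
  by move=> v; rewrite !inE => /orP[/eqP->|->].
by move/(split_at_sep primeL T e0 et); rewrite (negbTE bA) cA.
Qed.

(* The analogue of Tutte's triangle lemma. Uncrossing the splits [(A, B)] at [a] and [(C, D)]
   at [b] bounds the sizes of [X = A :&: C], [Y = A :&: D], [Z = B :&: C] and
   [W = (B :&: D) :\ c]; the triplet [u] appears when one of them is a singleton. *)
Lemma triangle t a b c k l : trip L t a b c -> k != 0%R -> l != 0%R ->
  k != t a -> l != t b -> nonprime_dir L a k -> nonprime_dir L b l ->
  exists u d, u a = k /\ (trip L u a b d /\ d != c \/ trip L u a c d /\ d != b).
Proof.
move=> T k0 l0 kt lt /existsP[A0 sA0] /existsP[C0 sC0].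
have [tL [ab ac bc] [ta tb tc] tz] := tripP T.
have Tb : trip L t b a c by rewrite trip_swap.
(* The split at [a] separates [b] from [c] and the one at [b] separates [a] from [c]; sides are
   chosen so that [c] is in neither [A] nor [C]. *)
have [A [sA bA cA]] : exists A, [/\ split_at L a k A, b \in A & c \notin A].
  have := split_at_sep primeL T k0 kt sA0; case: (boolP (b \in A0)) => bA.
    by move/esym=> cA; exists A0.
  move/esym/negbFE=> cA; exists (~: (a |: A0)); rewrite split_at_compl // !inE.
  by rewrite (negbTE bA) cA eq_sym (negbTE ab) orbT.
have [C [sC aC cC]] : exists C, [/\ split_at L b l C, a \in C & c \notin C].
  have := split_at_sep primeL Tb l0 lt sC0; case: (boolP (a \in C0)) => aC.
    by move/esym=> cC; exists C0.
  move/esym/negbFE=> cC; exists (~: (b |: C0)); rewrite split_at_compl // !inE.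
  by rewrite (negbTE aC) cC (negbTE ab) orbT.
have aA : a \notin A by case/and4P: sA.
have bC : b \notin C by case/and4P: sC.
pose B := ~: (a |: A); pose D := ~: (b |: C).
have sB : split_at L a k B by apply: split_at_compl.
have sD : split_at L b l D by apply: split_at_compl.
have cB : c \in B by rewrite !inE negb_or eq_sym ac.
have aB : a \notin B by rewrite !inE eqxx.
have bB : b \notin B by rewrite !inE bA orbT.
have cD : c \in D by rewrite !inE negb_or eq_sym bc.
have aD : a \notin D by rewrite !inE aC orbT.
have bD : b \notin D by rewrite !inE eqxx.
have V4 : 4 <= #|V| := ltnW V5.
pose good := exists u d, u a = k /\ (trip L u a b d /\ d != c \/ trip L u a c d /\ d != b).
(* A side of the split at [a] that is a pair already gives the triplet sought. *)
have hA : 3 <= #|A| \/ good.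
  have [cA2|] := eqVneq #|A| 2; last by case/and4P: sA => _ h2 _ _ h3; left; move: h2 h3; lia0.
  right; have [u [b' [c' [EA T' uk]]]] := split_at_pair primeL V4 sA cA2.
  move: bA cA; rewrite EA !inE negb_or => /orP[]/eqP Eb /andP[c1 c2].
    by exists u, c'; split=> //; left; rewrite Eb eq_sym.
  by exists u, b'; split=> //; left; rewrite Eb trip_swap trip_rot eq_sym.
case: hA => // hA.
have hB : 3 <= #|B| \/ good.
  have [cB2|] := eqVneq #|B| 2; last by case/and4P: sB => _ h2 _ _ h3; left; move: h2 h3; lia0.
  right; have [u [b' [c' [EB T' uk]]]] := split_at_pair primeL V4 sB cB2.
  move: cB bB; rewrite EB !inE negb_or => /orP[]/eqP Eb /andP[c1 c2].
    by exists u, c'; split=> //; right; rewrite Eb eq_sym.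
  by exists u, b'; split=> //; right; rewrite Eb trip_swap trip_rot eq_sym.
case: hB => // hB.
pose X := A :&: C; pose Y := A :&: D; pose Z := B :&: C; pose W := (B :&: D) :\ c.
have nA : #|A| = #|X| + #|Y| + 1.
  rewrite -(cardsID C A) -addnA; congr (_ + _).
  have -> : A :\: C = b |: Y.
    by apply/setP=> z; rewrite !inE; case: (eqVneq z b) => [->|]; rewrite ?bA ?bC //= andbC.
  by rewrite cardsU1 !inE eqxx andbF addnC.
have nC : #|C| = #|X| + #|Z| + 1.
  rewrite -(cardsID A C) -addnA [C :&: A]setIC; congr (_ + _).
  have -> : C :\: A = a |: Z.
    by apply/setP=> z; rewrite !inE; case: (eqVneq z a) => [->|]; rewrite ?aA ?aC //= negb_or.
  by rewrite cardsU1 !inE eqxx addnC.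
have nB : #|B| = #|Z| + #|W| + 1.
  rewrite -(cardsID C B) -addnA; congr (_ + _).
  have -> : B :\: C = c |: W.
    apply/setP=> z; rewrite !inE; case: (eqVneq z c) => [->|] /=.
      by rewrite cC negb_or cA eq_sym ac.
    by case: (eqVneq z b) => [->|_]; rewrite ?bA ?orbT //= andbC.
  by rewrite cardsU1 !inE eqxx addnC.
have nD : #|D| = #|Y| + #|W| + 1.
  rewrite -(cardsID A D) -addnA [D :&: A]setIC; congr (_ + _).
  have -> : D :\: A = c |: W.
    apply/setP=> z; rewrite !inE; case: (eqVneq z c) => [->|] /=.
      by rewrite cA negb_or cC eq_sym bc.
    by case: (eqVneq z a) => [->|_]; rewrite ?aC ?orbT ?andbF //= andbC.
  by rewrite cardsU1 !inE eqxx addnC.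
have nV := cardsU1C aA; rewrite -/B in nV.
(* One function serves both splits: in all the boxes below, at most the entries at [a] and [b] are
   confined to a line. *)
pose e v := if v == a then k else l.
have e0 v : e v != 0%R by rewrite /e; case: ifP.
have ea : e a = k by rewrite /e eqxx.
have eb : e b = l by rewrite /e eq_sym (negbTE ab).
have pA : #|A| <= (box_dim L e A (a |: A)).+1.
  rewrite (@box_dim_eq _ _ _ (fun=> k)); first by case/and4P: sA.
  by move=> v; rewrite !inE => /orP[/eqP->|->].
have pC : #|C| <= (box_dim L e C (b |: C)).+1.
  rewrite (@box_dim_eq _ _ _ (fun=> l)); first by case/and4P: sC.
  by move=> v; rewrite !inE => /orP[/eqP->|->].
have pD : #|D| <= (box_dim L e D (b |: D)).+1.
  rewrite (@box_dim_eq _ _ _ (fun=> l)); first by case/and4P: sD.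
  by move=> v; rewrite !inE => /orP[/eqP->|->].
have sepY : [/\ #|Y| = 1 -> box_dim L e Y (b |: Y) = 0, #|Y| = 0 -> box_dim L e Y (b |: Y) = 0
    & 2 <= #|Y| -> box_dim L e Y (b |: Y) + 2 <= #|Y|].
  apply: (split_at_sep_dim Tb); rewrite ?eb // inE negb_and ?bD ?aD ?cA ?orbT //.
have sepZ : [/\ #|Z| = 1 -> box_dim L e Z (a |: Z) = 0, #|Z| = 0 -> box_dim L e Z (a |: Z) = 0
    & 2 <= #|Z| -> box_dim L e Z (a |: Z) + 2 <= #|Z|].
  apply: (split_at_sep_dim T); rewrite ?ea // inE negb_and ?aB ?bB ?cC ?orbT //.
(* Crossing [A] with [D]: the intersection is the box of [Y] at [b], the union is dual to the box of
   [Z] at [a]. With [sepY] and [sepZ], if one of [Y], [Z] has two elements then the other is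
   empty. *)
have ii : #|Y| + #|Z| <= box_dim L e Y (b |: Y) + box_dim L e Z (a |: Z) + 2.
  have := box_dim_modular L e (subsetUr [set a] A) (subsetUr [set b] D).
  have -> : (a |: A) :&: (b |: D) = b |: Y.
    apply/setP=> z; rewrite !inE; case: (eqVneq z a) => [->|_] /=.
      by rewrite (negbTE ab) aC (negbTE aA).
    by case: (eqVneq z b) => [->|]; rewrite ?bA.
  have -> : (a |: A) :|: (b |: D) = a |: (A :|: D).
    by apply/setP=> z; rewrite !inE; case: (eqVneq z b) => [->|]; rewrite ?bA ?orbT //= orbA.
  have aAD : a \notin A :|: D by rewrite inE negb_or aA.
  have := box_dim_dual L e0 (subsetUr [set a] (A :|: D)).
  have -> : ~: (a |: (A :|: D)) = Z.
    apply/setP=> z; rewrite !inE; case: (eqVneq z a) => //= za.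
    by case: (eqVneq z b) => [->|_]; rewrite ?bA //= negb_or negbK.
  have -> : ~: (A :|: D) = a |: Z.
    apply/setP=> z; rewrite !inE; case: (eqVneq z a) => [->|_] /=; first by rewrite aC orbT negb_or aA.
    by case: (eqVneq z b) => [->|_]; rewrite ?bA //= negb_or negbK.
  rewrite cardsU1 aAD; have := cardsUI A D; rewrite -/Y.
  move: pA pD nA nD nB nC nV; lia0.
(* Crossing [A] with [C]: the union contains [a] and [b], and its complement [c |: W] has at least
   two elements. If [X] had two elements, duality and [t] would make [~: X] violate primality; if it
   has one, this is the third vertex of the triplet. *)
have i : 0 < #|W| -> #|X| = 0 \/ good.
  move=> W0.
  have q : #|X| <= box_dim L e X (a |: (b |: X)).
    have := box_dim_modular L e (subsetUr [set a] A) (subsetUr [set b] C).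
    have -> : (a |: A) :&: (b |: C) = a |: (b |: X).
      apply/setP=> z; rewrite !inE; case: (eqVneq z a) => [->|_] /=; first by rewrite aC orbT.
      by case: (eqVneq z b) => [->|]; rewrite ?bA.
    have -> : (a |: A) :|: (b |: C) = A :|: C.
      apply/setP=> z; rewrite !inE; case: (eqVneq z a) => [->|_] /=; first by rewrite aC orbT.
      by case: (eqVneq z b) => [->|]; rewrite ?bA.
    rewrite set_dimE -/X; have := set_dim_dual L (A :|: C).
    have E : ~: (A :|: C) = c |: W.
      apply/setP=> z; rewrite !inE; case: (eqVneq z c) => [->|_] /=; first by rewrite negb_or cA.
      case: (eqVneq z a) => [->|_] /=; first by rewrite aC orbT.
      case: (eqVneq z b) => [->|_] /=; first by rewrite bA.
      by rewrite negb_or.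
    have nE : #|c |: W| = #|W| + 1 by rewrite cardsU1 !inE eqxx addnC.
    have := cardsC (A :|: C); rewrite E.
    have := @primeL (c |: W); have := cardsC (c |: W); have := cardsUI A C.
    have h2: 2 <= #|~: (c |: W)|.
      have <- : #|[set a; b]| = 2 by rewrite cards2 ab.
      apply: subset_leq_card; apply/subsetP=> z; rewrite !inE negb_or negb_and negbK.
      by case/orP=> /eqP->; rewrite ?eqxx ?bA ?bc ?ac ?orbT.
    rewrite -/X nE h2.
    move: pA pC nA nD nB nC nV W0; lia0.
  have aX : a \notin X by rewrite inE negb_and aA.
  have bX : b \notin X by rewrite inE negb_and bC orbT.
  have abX : a \notin b |: X by rewrite in_setU1 negb_or ab aX.
  case: (leqP 2 #|X|) => X2.
    have sX : X \subset a |: (b |: X) by rewrite setUA subsetUr.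
    have := box_dim_dual L e0 sX; rewrite cardsU1 abX cardsU1 bX.
    have := cardsC X.
    have : box_dim L e (~: (a |: (b |: X))) (~: X) < set_dim L (~: X).
      apply: (box_dim_lt (t := t)).
      - by apply: box_space_sub => //; rewrite ?setCS // => v vX; left.
      - apply/set_spaceP; split=> //; apply/subsetP=> z; rewrite in_supp !inE negb_and.
        apply: contraR; rewrite negb_or !negbK => /andP[zA zC].
        by rewrite tz //; [apply: contraNneq aA|apply: contraNneq bC|apply: contraNneq cA]; move=> <-.
      - apply/negP=> /box_spaceP[_ /(_ a)]; rewrite !inE eqxx ea => /(_ isT)[h|[_ h]].
          by rewrite h in ta.
        by rewrite h eqxx in kt.
    have := @primeL (~: X); rewrite setCK X2.
    have := cardsU1C aA; have : 2 <= #|~: X|.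
      have <- : #|[set a; b]| = 2 by rewrite cards2 ab.
      apply: subset_leq_card; apply/subsetP=> z; rewrite !inE => /orP[]/eqP->.
        by rewrite (negbTE aA).
      by rewrite (negbTE bC) andbF.
    move: q X2; lia0.
  case: (posnP #|X|) => X0; first by left.
  right; have /eqP/cards1P[z EX] : #|X| = 1 by move: X0 X2; lia0.
  have: box_space L e X (a |: (b |: X)) != 0%VS by rewrite -dimv_eq0 -lt0n -/(box_dim _ _ _ _); move: q X0; lia0.
  rewrite -vpick0; set u := vpick _; move=> u0.
  have /box_spaceP[uL hu] : u \in box_space L e X (a |: (b |: X)) by apply: memv_pick.
  have Tu : trip L u a b z.
    apply: trip_intro => // y ya yb yz; case: (hu y) => [|//|[]]; first by rewrite EX inE.
    by rewrite EX !inE (negbTE ya) (negbTE yb) (negbTE yz).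
  exists u, z; have [_ _ [ua _ _] _] := tripP Tu; split.
    by case: (hu a aX) => [h|[_ ->]//]; rewrite h in ua.
  left; split=> //; have : z \in X by rewrite EX inE.
  by rewrite inE => /andP[zA _]; apply: contraNneq cA => <-.
(* If [W] is empty then [Z] has two elements and [Y] is nonempty; if [X] is empty, the same holds
   with [Y] and [Z] exchanged. Both contradict [ii]. *)
case: (posnP #|W|) => W0; last case: (i W0) => // X0.
- have Z2 : 2 <= #|Z| by move: nB hB W0; lia0.
  case: sepZ => _ _ /(_ Z2); case: sepY; move: ii Z2 nD W0 sD => ii Z2 nD W0 /and4P[_ D2 _ _].
  case: (leqP 2 #|Y|) => Y2 h1 h2 h3; first by move/(_ isT): h3; move: ii Y2 Z2; lia0.
  have Y1 : #|Y| = 1 by move: nD W0 D2 Y2; lia0.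
  by move: ii Y1 (h1 Y1); lia0.
- have Y2 : 2 <= #|Y| by move: nA hA X0; lia0.
  case: sepY => _ _ /(_ Y2); case: sepZ; move: ii Y2 nC X0 sC => ii Y2 nC X0 /and4P[_ C2 _ _].
  case: (leqP 2 #|Z|) => Z2 h1 h2 h3; first by move/(_ isT): h3; move: ii Y2 Z2; lia0.
  have Z1 : #|Z| = 1 by move: nC X0 C2 Z2; lia0.
  by move: ii Z1 (h1 Z1); lia0.
Qed.
End Triangle.

(** * Fans *)

Section Fans.
Variables (V : finType) (L : lagrangian V).
Implicit Types (e : V -> K) (A B C D : {set V}) (u w t : {ffun V -> K}) (a b c d v z x : V)
  (k l : K) (s : seq V).
Hypothesis primeL : prime_lagrangian L.
Hypothesis V5 : 5 <= #|V|.

Lemma iso1 u w b : u \in L -> w \in L ->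
  (forall z, z != b -> sp (u z) (w z) = false) -> sp (u b) (w b) = false.
Proof. by move=> uL wL h; have := isoL uL wL; rewrite (bigD1 b) //= big1 ?addbF. Qed.

Lemma iso2 u w b c : b != c -> u \in L -> w \in L ->
  (forall z, z != b -> z != c -> sp (u z) (w z) = false) -> sp (u b) (w b) = sp (u c) (w c).
Proof.
move=> bc uL wL h; have := isoL uL wL; rewrite (bigD1 b) //= (bigD1 c) /=; last by rewrite eq_sym.
rewrite big1 ?addbF; last by move=> z /andP[]; apply: h.
by case: sp; case: sp.
Qed.

(** The pair [[set b; c]] is a split at [a]; five vertices leave two on the other side. *)
Lemma trip_nonprime t a b c : trip L t a b c -> nonprime_dir L a (t a).
Proof.
move=> T; have [tL [ab ac bc] [ta tb tc] tz] := tripP T.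
have aA : a \notin [set b; c] by rewrite !inE negb_or ab.
apply/existsP; exists [set b; c]; rewrite /split_at aA cards2 bc /=.
have := cardsU1C aA; rewrite cards2 bc /= => nV.
apply/andP; split; first by move: V5; rewrite -nV addn1.
rewrite ltnS lt0n /box_dim dimv_eq0; apply: contraNneq ta => h0.
suff : t \in 0%VS by rewrite memv0 => /eqP->; rewrite ffunE.
rewrite -h0; apply/box_spaceP; split=> // z; rewrite !inE negb_or => /andP[zb zc].
have [->|za] := eqVneq z a; [by right | by left; apply: tz].
Qed.

Lemma trip_card u a b c : trip L u a b c -> #|[set a; b; c]| = 3.
Proof.
case/tripP=> _ [ab ac bc] _ _; rewrite setUC cardsU1 cards2 ab !inE.
by rewrite [c == a]eq_sym [c == b]eq_sym (negbTE ac) (negbTE bc).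
Qed.

(** Two vectors would give a set of three vertices dimension two, one more than primality allows. *)
Lemma trip_uniq t u a b c : trip L t a b c -> trip L u a b c -> t = u.
Proof.
move=> T U; have [tL _ [ta _ _] _] := tripP T; have [uL _ [ua _ _] _] := tripP U.
apply: contraTeq isT => tu.
have hc := trip_card T; have := cardsC [set a; b; c]; rewrite hc => hc'.
have := @primeL [set a; b; c]; rewrite hc => /(_ isT).
have h2: 2 <= #|~: [set a; b; c]| by move: hc' V5; lia0.
move/(_ h2); suff : 1 < set_dim L [set a; b; c] by lia0.
have t0 : t != 0%R by apply: contraNneq ta => ->; rewrite ffunE.
have <- : \dim <[t]> = 1 by rewrite dim_vline t0.
have mem w : trip L w a b c -> w \in box_space L (fun=> (true, true)) [set a; b; c] [set a; b; c].
  by case/and3P=> wL _ /eqP hw; apply/set_spaceP; rewrite hw.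
apply: (dim_lt (a := u)); [|exact: mem U|].
  by rewrite -memvE; apply: mem T.
apply/vlineP=> -[[] h]; first by rewrite h scale1r eqxx in tu.
by rewrite h scale0r ffunE eqxx in ua.
Qed.

(** By isotropy the entries agree at both of [b] and [c] or at neither; agreement at both would make
    [t + u] a nonzero vector supported on [a] and [d]. *)
Lemma adj_dir t u a b c d : trip L t a b c -> trip L u b c d -> a != d ->
  t b != u b /\ t c != u c.
Proof.
move=> T U ad; have [tL [ab ac bc] [ta tb tc] tz] := tripP T.
have [uL [_ bd cd] [ub uc ud] uz] := tripP U.
have h : sp (t b) (u b) = sp (t c) (u c).
  apply: iso2 => // z zb zc; have [->|za] := eqVneq z a; last by rewrite tz ?sp0.
  by rewrite uz // spC sp0.
suff tub : t b != u b by split=> //; move: h; rewrite !spE tb ub tub tc uc /= => <-.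
apply/eqP=> Eb; have Ec : t c = u c.
  by apply/eqP; move: h; rewrite !spE tb ub tc uc Eb eqxx /= => /esym/negbFE.
have := supp_ge3 primeL (ltnW V5) (rpredD tL uL).
have -> : (t + u)%R != 0%R.
  by apply: contraNneq ta => /ffunP/(_ a); rewrite !ffunE (uz a) // addr0 => ->.
move=> /(_ isT) h3; suff /(leq_trans h3): #|supp (t + u)%R| <= #|[set a; d]|.
  by rewrite cards2 ltnS; case: (a != d).
apply: subset_leq_card; apply/subsetP=> z; rewrite in_supp !inE ffunE.
apply: contraR; rewrite negb_or => /andP[za zd].
have [->|zb] := eqVneq z b; first by rewrite Eb K_addkk.
have [->|zc] := eqVneq z c; first by rewrite Ec K_addkk.
by rewrite tz // uz // addr0.
Qed.

Lemma one_common u w b : u \in L -> w \in L -> u b != 0%R -> w b != 0%R ->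
  (forall z, z != b -> u z = 0%R \/ w z = 0%R) -> u b = w b.
Proof.
move=> uL wL ub wb h; apply/eqP; have := @iso1 u w b uL wL.
rewrite spE ub wb /= => h'; apply: negbFE; apply: h' => z /h[]->; first exact: sp0.
by rewrite spC sp0.
Qed.

Lemma skip_dir t u a b c d z : trip L t a b c -> trip L u c d z -> uniq [:: a; b; c; d; z] ->
  t c = u c.
Proof.
move=> T U; have [tL _ [_ _ tc] tz] := tripP T; have [uL _ [uc _ _] uz] := tripP U.
rewrite /= !inE !negb_or !andbT => /and4P[/and4P[ab ac ad ae] /and3P[bc bd be] _ _].
apply: one_common => // y yc.
have [->|ya] := eqVneq y a; first by right; apply: uz.
have [->|yb] := eqVneq y b; first by right; apply: uz.
by left; apply: tz.
Qed.

Definition tri a b c := [exists u, trip L u a b c].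

Fixpoint chain s :=
  if s is a :: s' then (if s' is b :: c :: _ then tri a b c else true) && chain s' else true.

Lemma tri_rev a b c : tri a b c = tri c b a.
Proof. by apply: eq_existsb => u; rewrite trip_rev. Qed.

Lemma chainP x0 s : reflect
  (forall i, i.+2 < size s -> tri (nth x0 s i) (nth x0 s i.+1) (nth x0 s i.+2)) (chain s).
Proof.
apply: (iffP idP).
  elim: s => //= a s IH /andP[h /IH{}IH] [|i] /=; last by rewrite ltnS => /IH.
  by case: s h {IH} => [|b [|c s]].
elim: s => //= a s IH h; rewrite IH ?andbT; last by move=> i hi; apply: (h i.+1).
by case: s h {IH} => [|b [|c s]] // /(_ 0 isT).
Qed.

Lemma chain_rev s : chain (rev s) = chain s.
Proof.
case: s => // x0 s0; set s := x0 :: s0.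
suff key s1 : chain s1 -> chain (rev s1) by apply/idP/idP => /key; rewrite ?revK.
move/(chainP x0) => h; apply/(chainP x0) => i; rewrite size_rev => hi.
rewrite !nth_rev; try (by move: hi; lia0).
rewrite tri_rev.
have [E1 E2] : size s1 - i.+2 = (size s1 - i.+3).+1 /\ size s1 - i.+1 = (size s1 - i.+3).+2.
  by move: hi; lia0.
by rewrite E1 E2; apply: h; move: hi; lia0.
Qed.

Lemma card_set_seq s : uniq s -> #|[set v in s]| = size s.
Proof. by move=> us; rewrite cardsE; apply/card_uniqP. Qed.

(** Each vertex put in front, except for the last two, comes with a triplet that is nonzero there,
    hence with a new dimension. *)
Lemma chain_dim s : uniq s -> chain s -> size s <= set_dim L [set v in s] + 2.
Proof.
elim: s => //= a s IH /andP[aN us] /andP[h /(IH us){}IH].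
case: s aN us h IH => [|b [|c s]] //; try by move=> *; rewrite addn2.
set s' := [:: b, c & s] => aN us /existsP[t T] IH.
suff : set_dim L [set v in s'] < set_dim L [set v in a :: s'] by move: IH; rewrite -/s' /=; lia0.
have [tL _ [ta _ _] tz] := tripP T.
apply: (box_dim_lt (t := t)).
- by apply: box_space_sub => //; [apply/subsetP=> z|apply/subsetP=> z|move=> z -> //]; rewrite !inE => ->; rewrite orbT.
- apply/set_spaceP; split=> //; apply/subsetP=> z; rewrite in_supp !inE.
  by apply: contraR; rewrite !negb_or => /and4P[? ? ? _]; rewrite tz.
- apply/negP=> /set_spaceP[_ /subsetP/(_ a)]; rewrite in_supp ta => /(_ isT).
  by rewrite inE (negbTE aN).
Qed.

(** Otherwise [u] and [t] would be independent modulo the vectors supported on the rest of the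
    chain, and by [chain_dim] the dimension would reach the size of the chain minus one. *)
Lemma chain_end a b c s t u : uniq [:: a, b, c & s] -> chain [:: a, b, c & s] ->
  size [:: a, b, c & s] + 2 <= #|V| -> trip L t a b c -> u \in L ->
  supp u \subset [set v in [:: a, b, c & s]] -> u a != 0%R -> u a = t a.
Proof.
set s' := [:: b, c & s] => us ch hV T uL su ua; apply/eqP; apply: contraTT isT => uta.
have [tL _ [ta _ _] tz] := tripP T.
have aN : a \notin s' by case/andP: us.
pose S := [set v in s'].
have ES : [set v in a :: s'] = a |: S by apply/setP=> z; rewrite !inE.
have aS : a \notin S by rewrite inE.
have h1 : size s' <= set_dim L S + 2.
  by apply: chain_dim; [case/andP: us | case/andP: ch].
have h2 : set_dim L S < box_dim L (fun=> u a) S (a |: S).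
  apply: (box_dim_lt (t := u)).
  - by apply: box_space_sub => //; [exact: subsetUr | move=> v ->].
  - apply/box_spaceP; split=> // z zS.
    have [->|za] := eqVneq z a; first by right; rewrite !inE eqxx.
    left; apply/eqP; apply: contraNT zS => uz.
    by move/subsetP/(_ z): su; rewrite in_supp uz ES inE => /(_ isT); rewrite inE (negbTE za).
  - apply/negP=> /set_spaceP[_ /subsetP/(_ a)]; rewrite in_supp ua => /(_ isT).
    by rewrite (negbTE aS).
have h3 : box_dim L (fun=> u a) S (a |: S) < set_dim L (a |: S).
  apply: (box_dim_lt (t := t)).
  - by apply: box_space_sub => //; [exact: subsetUr | move=> v h _; left].
  - apply/set_spaceP; split=> //; apply/subsetP=> z; rewrite in_supp !inE.
    by apply: contraR; rewrite !negb_or => /and4P[? ? ? _]; rewrite tz.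
  - apply/negP=> /box_spaceP[_ /(_ a aS)[h|[_ h]]]; first by rewrite h in ta.
    by rewrite h eqxx in uta.
have hc : #|a |: S| = size (a :: s') by rewrite -ES card_set_seq.
have := @primeL (a |: S); have := cardsC (a |: S); rewrite hc.
by move: hV h1 h2 h3; rewrite /s' /=; lia0.
Qed.

(** Four vertices give two overlapping triplets, so that [adj_dir] supplies a second direction next
    to each end. *)
Definition fan s := [&& uniq s, chain s & 4 <= size s].

Lemma fan_rev s : fan (rev s) = fan s.
Proof. by rewrite /fan rev_uniq chain_rev size_rev. Qed.

Hypothesis noncyclic : forall s, fan s -> size s != #|V|.

(** If only [z] were missing, duality applied to the fan without its first two vertices [a], [b]
    would give a triplet on [z], [a], [b]; putting [z] in front would then yield a spanning fan. *)
Lemma fan_gap s : fan s -> size s + 2 <= #|V|.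
Proof.
move=> fs; have /and3P[us cs hs] := fs.
have hV : size s <= #|V| by rewrite -(card_uniqP us) max_card.
have := noncyclic fs; case: (leqP (size s + 2) #|V|) => // h1 h2; exfalso.
have hc : size s + 1 = #|V| by move: h1 h2 hV => + /eqP; lia0.
case: s fs us cs hs hV h1 h2 hc => [|a [|b s]] // fs us cs hs hV _ _ hc.
have cS : #|[set v in s]| = size s by rewrite card_set_seq //; case/and3P: us.
have := set_dim_dual L [set v in s]; rewrite cS.
have : size s <= set_dim L [set v in s] + 2.
  by apply: chain_dim; [case/and3P: us | move: cs => /=; case: (s) => //= c s' /and3P[]].
move=> h1 h2.
have : box_space L (fun=> (true, true)) (~: [set v in s]) (~: [set v in s]) != 0%VS.
  rewrite -dimv_eq0 -/(box_dim _ _ _ _) -/(set_dim _ _) -lt0n.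
  by move: h1 h2 hc => /=; lia0.
rewrite -vpick0; set u := vpick _; move=> u0.
have /set_spaceP[uL su] : u \in box_space L (fun=> (true, true)) (~: [set v in s]) (~: [set v in s]).
  exact: memv_pick.
have [z zN] : exists z, z \notin [:: a, b & s].
  apply/existsP; apply: contraT; rewrite negb_exists => /forallP h.
  have : #|V| <= size [:: a, b & s].
    by rewrite -(card_uniqP us) subset_leq_card //; apply/subsetP=> z _; have := h z; rewrite negbK.
  by move: hc => /=; lia0.
have zall y : y \notin z :: [:: a, b & s] -> False.
  move=> yN; have : size [:: y, z, a, b & s] <= #|V|.
    have uy : uniq [:: y, z, a, b & s] by rewrite cons_uniq yN cons_uniq zN us.
    by rewrite -(card_uniqP uy) max_card.
  by move: hc => /=; lia0.
have U : trip L u z a b.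
  apply: trip_intro => //; first exact: ltnW.
  move=> y yz ya yb; apply/eqP; apply: contraT => uy; exfalso; apply: (zall y).
  have := subsetP su y; rewrite in_supp uy !inE => /(_ isT) ys.
  by rewrite !negb_or yz ya yb.
have : fan (z :: [:: a, b & s]).
  rewrite /fan cons_uniq zN us /= -/(chain [:: a, b & s]) cs andbT.
  by apply/andP; split; [apply/existsP; exists u | move: hs => /=; lia0].
by move/noncyclic; rewrite -hc /= addn1 eqxx.
Qed.

Definition essential a := [exists k : K, exists l : K,
  [&& k != 0%R, l != 0%R, k != l, nonprime_dir L a k & nonprime_dir L a l]].

Lemma essential_dir a k : essential a -> exists l, [/\ l != 0%R, l != k & nonprime_dir L a l].
Proof.
case/existsP=> l /existsP[m /and5P[l0 m0 lm hl hm]].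
by have [E|] := eqVneq l k; [exists m; split=> //; rewrite -E eq_sym | exists l].
Qed.

(** [triangle] is applied at [a] and [b], the direction at [b] being that of the next triplet of the
    fan. The new vertex [z] is outside the fan, since otherwise [chain_end] would force
    [u a = t a]. *)
Lemma fan_extend a s : fan (a :: s) -> essential a ->
  exists s', [/\ fan s', size s' = (size s).+2 & {subset a :: s <= s'}].
Proof.
move=> fs ea; have gap := fan_gap fs; have /and3P[us cs hs] := fs.
case: s fs us cs hs gap => [|b [|c [|d s]]] // fs us cs hs gap.
have /= /and3P[/existsP[t T] /existsP[w W] cs'] := cs.
have [ad' bcd] : a != d /\ uniq [:: a; b; c; d].
  by move: us; rewrite /= !inE !negb_or -!andbA => /and5P[-> -> -> _ /and4P[-> -> _ /andP[-> _]]].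
have [tw _] := adj_dir T W ad'.
have [tL [ab ac bc] [ta tb tc] tz] := tripP T.
have [_ _ [wb _ _] _] := tripP W.
have [k [k0 kt hk]] := essential_dir (t a) ea.
have lt : w b != t b by rewrite eq_sym.
have [u [z [uk hu]]] := triangle primeL V5 T k0 wb kt lt hk (trip_nonprime W).
have [uL ua uz] : [/\ u \in L, u a != 0%R & forall y, y != a -> y != z -> y \in [:: b; c] \/ u y = 0%R].
  by case: hu => -[U _]; have [uL _ [ua _ _] uz] := tripP U; split=> // y ya yz;
    rewrite !inE; [have [->|yb] := eqVneq y b | have [->|yc] := eqVneq y c];
    rewrite ?eqxx ?orbT; auto; right; apply: uz.
have zN : z \notin [:: a, b, c, d & s].
  apply/negP=> zs; case/negP: kt; rewrite -uk; apply/eqP.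
  apply: (chain_end us cs gap T) => //; apply/subsetP=> y; rewrite in_supp => uy.
  have [->|ya] := eqVneq y a; first by rewrite !inE eqxx.
  have [->|yz] := eqVneq y z; first by rewrite inE.
  case: (uz y ya yz) => [|h]; last by rewrite h eqxx in uy.
  by rewrite !inE => /orP[]->; rewrite ?orbT.
case: hu => -[U hz].
  exists (z :: [:: a, b, c, d & s]); split=> //; last by move=> y ys; rewrite inE ys orbT.
  rewrite /fan cons_uniq zN us /=; apply/andP; split=> //; move: cs => /= ->; rewrite andbT.
  by apply/existsP; exists u; rewrite trip_rot.
(* A triplet on [a], [c], [z] extends a fan of four vertices once [b] and [c] are exchanged. In a
   longer fan the triplet [q] agrees at [c] with both [t] and [u], whereas [t] and [u] differ at [a]
   and so, by isotropy, at [c]. *)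
case: s us cs cs' hs gap zN fs uz => [|f s] us cs cs' hs gap zN fs uz.
  exists [:: z; a; c; b; d]; split=> //.
    apply/and3P; split=> //.
      have : perm_eq [:: z; a; c; b; d] (z :: [:: a; b; c; d]).
        by apply/permP=> P /=; rewrite (addnCA (P c)).
      by move/perm_uniq=> ->; rewrite cons_uniq zN.
    rewrite /= !andbT; apply/and3P; split.
    - by apply/existsP; exists u; rewrite trip_rot.
    - by apply/existsP; exists t; rewrite trip_rev -trip_rot.
    - by apply/existsP; exists w; rewrite trip_swap.
  by move=> y; rewrite !inE => /or4P[]->; rewrite ?orbT.
have /andP[/existsP[q Q] _] := cs'.
have abcdf : uniq [:: a; b; c; d; f].
  by move: us; rewrite -[X in uniq X]/([:: a; b; c; d; f] ++ s) cat_uniq => /and3P[].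
have tq := skip_dir T Q abcdf.
have [qL _ [qc _ _] qz] := tripP Q.
have [_ [_ az cz] [_ uc _] uz'] := tripP U.
exfalso; move: kt; rewrite -uk => kt.
have h1 : sp (u a) (t a) = sp (u c) (t c).
  apply: iso2 => // y ya yc; have [->|yz] := eqVneq y z; last by rewrite (uz' y) ?sp0.
  rewrite spC tz ?sp0 //; first by apply: contraNneq zN => ->; rewrite !inE eqxx.
  by apply: contraNneq zN => ->; rewrite !inE eqxx ?orbT.
have h2 : u c = q c.
  apply: one_common => // y yc; have [->|ya] := eqVneq y a.
    right; apply: qz; first by [].
      by move: bcd; rewrite /= !inE !negb_or => /and4P[/and3P[]].
    by move: abcdf; rewrite /= !inE !negb_or => /andP[/and4P[]].
  have [->|yz] := eqVneq y z; last by left; apply: uz'.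
  by right; apply: qz; first (by rewrite eq_sym); apply: contraNneq zN => ->; rewrite !inE eqxx ?orbT.
by move: h1; rewrite h2 tq !spE eqxx ta ua kt !andbF.
Qed.

Lemma fan_complete s : fan s -> exists s',
  [/\ fan s', {subset s <= s'}, (forall a s2, s' = a :: s2 -> ~~ essential a)
    & (forall a s2, s' = rcons s2 a -> ~~ essential a)].
Proof.
have [m] := ubnP (#|V| - size s); elim: m s => // m IH s hm fs.
have gap := fan_gap fs.
have ext s1 : fan s1 -> size s1 = (size s).+1 -> {subset s <= s1} -> exists s',
  [/\ fan s', {subset s <= s'}, (forall a s2, s' = a :: s2 -> ~~ essential a)
    & (forall a s2, s' = rcons s2 a -> ~~ essential a)].
  move=> f1 h1 sub1; case: (IH s1) => //; first by rewrite h1; move: hm gap; lia0.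
  by move=> s' [f' sub' ? ?]; exists s'; split=> // y /sub1/sub'.
case: s fs hm gap ext => [|a s] fs hm gap ext; first by case/and3P: fs.
have [ea|na] := boolP (essential a).
  by have [s1 [f1 h1 sub1]] := fan_extend fs ea; apply: (ext s1).
have [s2 [b E]] : exists s2 b, a :: s = rcons s2 b.
  by exists (belast a s), (last a s); rewrite -lastI.
rewrite E in fs hm gap ext *.
have [eb|nb] := boolP (essential b).
  have fs' : fan (b :: rev s2) by rewrite -rev_rcons fan_rev.
  have [s1 [f1 h1 sub1]] := fan_extend fs' eb; apply: (ext s1) => //.
    by rewrite h1 size_rev size_rcons.
  by move=> y; rewrite mem_rcons => ys; apply: sub1; rewrite inE mem_rev -in_cons.
exists (rcons s2 b); split; [exact: fs | exact | move=> c s3 | move=> c s3].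
  by rewrite -E => -[<- _].
by move/rcons_inj=> [_ <-].
Qed.
End Fans.

(** * Fans with non-essential ends *)

Section Ends.
Variables (V : finType) (L : lagrangian V).
Implicit Types (e : V -> K) (A B C D : {set V}) (u w t q : {ffun V -> K}) (a b c d v z x y : V)
  (k l : K) (s : seq V).
Hypothesis primeL : prime_lagrangian L.
Hypothesis V5 : 5 <= #|V|.

Definition triplet q := (q \in L) && (#|supp q| == 3).

Lemma trip_triplet u a b c : trip L u a b c -> triplet u.
Proof.
move=> T; have := trip_card T; case/and3P: T => uL _ /eqP Es.
by rewrite -Es /triplet uL => ->.
Qed.

Lemma triplet_trip q a : triplet q -> q a != 0%R -> exists b c, trip L q a b c.
Proof.
case/andP=> qL /eqP h3 qa.
have /cards2P[b [c [bc E]]] : #|supp q :\ a| == 2.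
  by have := cardsD1 a (supp q); rewrite h3 in_supp qa add1n => -[<-].
have Es : supp q = a |: [set b; c] by rewrite -E setD1K // in_supp.
have : a \notin [set b; c] by rewrite -E !inE eqxx.
rewrite !inE negb_or => /andP[ab ac].
by exists b, c; rewrite /trip qL /= !inE negb_or ab ac bc Es setUA eqxx.
Qed.

(** Two triplets with different nonzero entries at [x] would exhibit two directions that destroy
    primality. *)
Lemma end_dir x q t : ~~ essential L x -> triplet q -> triplet t -> sp (q x) (t x) = false.
Proof.
move=> nx hq ht; apply: contraNF nx; rewrite spE => /and3P[qx tx qt].
have [b [c Q]] := triplet_trip hq qx; have [b' [c' T]] := triplet_trip ht tx.
apply/existsP; exists (q x); apply/existsP; exists (t x).
by rewrite qx tx qt (trip_nonprime V5 Q) (trip_nonprime V5 T).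
Qed.

(** Functions on [nat] in place of a sequence make reversal a reindexing, so that arguments are
    carried out at one end only. *)
Record fanpath (F : nat -> V) (T : nat -> {ffun V -> K}) (n : nat) : Prop := Fanpath {
  ff_inj : forall i j, i <= n -> j <= n -> F i = F j -> i = j;
  ff_n : 3 <= n;
  ff_T : forall j, 0 < j -> j < n -> trip L (T j) (F j.-1) (F j) (F j.+1)
}.

Section PathFacts.
Variables (F : nat -> V) (T : nat -> {ffun V -> K}) (n : nat).
Hypothesis ff : fanpath F T n.

Let hT := ff_T ff.

Lemma ff_neq i j : i <= n -> j <= n -> (F i == F j) = (i == j).
Proof. by move=> hi hj; apply/eqP/eqP => [/(ff_inj ff hi hj)|->]. Qed.

Lemma ff_T_out j z : 0 < j -> j < n -> z != F j.-1 -> z != F j -> z != F j.+1 -> T j z = 0%R.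
Proof. by move=> j0 jn; have [_ _ _] := tripP (hT j0 jn); apply. Qed.

Lemma ff_T_in j i : 0 < j -> j < n -> i <= j.+1 -> j <= i.+1 -> T j (F i) != 0%R.
Proof.
move=> j0 jn h1 h2; have [_ _ [ha hb hc] _] := tripP (hT j0 jn).
have [->//|[->//|->//]] : i = j.-1 \/ i = j \/ i = j.+1 by move: j0 h1 h2; lia0.
Qed.

Lemma ff_T_far j i : 0 < j -> j < n -> i <= n -> (j.+1 < i) || (i.+1 < j) -> T j (F i) = 0%R.
Proof.
move=> j0 jn hi h; apply: ff_T_out => //; rewrite ff_neq //; move: j0 jn hi h; lia0.
Qed.

Lemma ff_adj j : 0 < j -> j.+1 < n ->
  T j (F j) != T j.+1 (F j) /\ T j (F j.+1) != T j.+1 (F j.+1).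
Proof.
move=> j0 jn; have U := hT (ltn0Sn j) jn; rewrite /= in U.
apply: (adj_dir primeL V5 (hT j0 (ltnW jn)) U).
by rewrite ff_neq; move: j0 jn; lia0.
Qed.

Lemma ff_skip j : 0 < j -> j.+2 < n -> T j (F j.+1) = T j.+2 (F j.+1).
Proof.
move=> j0 jn; have U := hT (ltn0Sn j.+1) jn; rewrite /= in U.
apply: (skip_dir (hT j0 (ltnW (ltnW jn))) U).
rewrite /= !inE !negb_or !ff_neq //; move: j0 jn; lia0.
Qed.

Lemma ff_TL j : 0 < j -> j < n -> T j \in L.
Proof. by move=> j0 jn; case/tripP: (hT j0 jn). Qed.

Lemma ff_triplet j : 0 < j -> j < n -> triplet (T j).
Proof. by move=> j0 jn; apply: trip_triplet (hT j0 jn). Qed.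


End PathFacts.

Record fanfun x y (F : nat -> V) (T : nat -> {ffun V -> K}) (n : nat) : Prop := Fanfun {
  ff_path :> fanpath F T n;
  ff_x : F 0 = x;
  ff_y : F n = y;
  ff_gap : n + 3 <= #|V|;
  ff_nx : ~~ essential L x;
  ff_ny : ~~ essential L y
}.

Lemma fanfun_rev x y F T n : fanfun x y F T n ->
  fanfun y x (fun j => F (n - j)) (fun j => T (n - j)) n.
Proof.
case=> [[inj n3 hT] Fx Fy gap nx ny]; split=> //; [split=> // | |].
- move=> i j hi hj E; have := inj _ _ (leq_subr i n) (leq_subr j n) E.
  by move: hi hj; lia0.
- move=> j j0 jn; have -> : n - j.-1 = (n - j).+1 by move: j0 jn; lia0.
  have -> : n - j.+1 = (n - j).-1 by move: j0 jn; lia0.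
  by rewrite trip_rev; apply: hT; move: j0 jn; lia0.
- by rewrite subn0.
- by rewrite subnn.
Qed.

Section FanFacts.
Variables (x y : V) (F : nat -> V) (T : nat -> {ffun V -> K}) (n : nat).
Hypothesis ff : fanfun x y F T n.

Let n3 := ff_n ff.

(* The symplectic products at the two ends vanish, so only inner vertices matter. *)
Lemma ff_iso q j : triplet q -> 0 < j -> j < n ->
  sp (q (F j)) (T j (F j)) (+) ((1 < j) && sp (q (F j.-1)) (T j (F j.-1)))
    (+) ((j.+1 < n) && sp (q (F j.+1)) (T j (F j.+1))) = false.
Proof.
move=> hq j0 jn; have [qL _] := andP hq.
have := isoL qL (ff_TL ff j0 jn).
have a1 : F j.-1 != F j by rewrite (ff_neq ff); move: j0 jn; lia0.
have a2 : F j.+1 != F j by rewrite (ff_neq ff); move: j0 jn; lia0.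
have a3 : F j.+1 != F j.-1 by rewrite (ff_neq ff); move: j0 jn; lia0.
rewrite (bigD1 (F j)) //= (bigD1 (F j.-1)) //= (bigD1 (F j.+1)) ?a2 ?a3 //=.
rewrite big1 => [|z /andP[/andP[z1 z2] z3]]; last by rewrite spC (ff_T_out ff) ?sp0.
have -> : (1 < j) && sp (q (F j.-1)) (T j (F j.-1)) = sp (q (F j.-1)) (T j (F j.-1)).
  case: ltnP => // j1; have -> : j.-1 = 0 by move: j0 j1; lia0.
  by rewrite (ff_x ff) (end_dir (ff_nx ff) hq) // (ff_triplet ff).
have -> : (j.+1 < n) && sp (q (F j.+1)) (T j (F j.+1)) = sp (q (F j.+1)) (T j (F j.+1)).
  case: ltnP => // j1; have -> : j.+1 = n by move: jn j1; lia0.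
  by rewrite (ff_y ff) (end_dir (ff_ny ff) hq) // (ff_triplet ff).
by rewrite addbF addbA.
Qed.

(** If [F i] were the only inner vertex in the support of [q], isotropy would make [q] agree there
    with every triplet of the fan through [F i], but two consecutive ones differ. *)
Lemma ff_inner2 q i : triplet q -> 0 < i -> i < n -> q (F i) != 0%R ->
  exists j, [/\ 0 < j, j < n, j != i & q (F j) != 0%R].
Proof.
move=> hq i0 iN qi.
case: (boolP [exists j : 'I_n, [&& 0 < j, val j != i & q (F j) != 0%R]]).
  by case/existsP=> j /and3P[? ? ?]; exists j; split.
rewrite negb_exists => /forallP h.
have q0 j : 0 < j -> j < n -> j != i -> q (F j) = 0%R.
  by move=> j0 jn ji; have := h (Ordinal jn); rewrite /= j0 ji /= negbK => /eqP.
have eqT j : 0 < j -> j < n -> i <= j.+1 -> j <= i.+1 -> q (F i) = T j (F i).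
  move=> j0 jn ij ji; apply/eqP; have := ff_iso hq j0 jn.
  suff -> : sp (q (F j)) (T j (F j)) (+) ((1 < j) && sp (q (F j.-1)) (T j (F j.-1)))
    (+) ((j.+1 < n) && sp (q (F j.+1)) (T j (F j.+1))) = sp (q (F i)) (T j (F i)).
    by rewrite spE qi (ff_T_in ff) //= => /negbFE.
  have up : i <= j -> (j.+1 < n) && sp (q (F j.+1)) (T j (F j.+1)) = false.
    by move=> h1; case: ltnP => //= h2; rewrite q0 ?sp0 //; move: h1; lia0.
  have dn : j <= i -> (1 < j) && sp (q (F j.-1)) (T j (F j.-1)) = false.
    by move=> h1; case: ltnP => //= h2; rewrite q0 ?sp0 //; move: h1 h2 jn; lia0.
  have md : i != j -> sp (q (F j)) (T j (F j)) = false.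
    by move=> h1; rewrite q0 ?sp0 // eq_sym.
  have [E|[E|E]] : i = j.-1 \/ i = j \/ i = j.+1 by move: j0 ij ji; lia0.
  - rewrite md ?up ?E ?addbF; try by move: E i0; lia0.
  - by rewrite up ?dn ?E ?addbF.
  - rewrite md ?dn ?E; try by lia0.
    by have -> : j.+1 < n by move: E iN; lia0.
have [i1|i1] := ltnP i.+1 n.
  have [+ _] := ff_adj ff i0 i1.
  have -> : T i (F i) = q (F i) by rewrite -eqT //; lia0.
  by have -> : T i.+1 (F i) = q (F i); [rewrite -eqT //; lia0 | rewrite eqxx].
have i2 : 0 < i.-1 by move: i1 n3; lia0.
have i3 : i.-1.+1 < n by rewrite prednK.
have [_] := ff_adj ff i2 i3; rewrite (prednK i0).
have -> : T i (F i) = q (F i) by rewrite -eqT //; lia0.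
by have -> : T i.-1 (F i) = q (F i); [rewrite -eqT //; move: i0 iN; lia0 | rewrite eqxx].
Qed.
End FanFacts.

End Ends.

(** * No triplet consists of both ends and an essential vertex *)

Section Short.
Variables (V : finType) (L : lagrangian V).
Implicit Types (e : V -> K) (A B C D : {set V}) (u w t q : {ffun V -> K}) (a b c d v z x y : V)
  (k l : K) (s : seq V).
Hypothesis primeL : prime_lagrangian L.
Hypothesis V5 : 5 <= #|V|.

(* If the other side had two elements, it would give a triplet through
   the non-essential vertex [y] in a second direction. *)
Lemma short_side x y c t l A : ~~ essential L y -> trip L t c x y -> l != 0%R -> l != t c ->
  split_at L c l A -> x \in A -> 3 <= #|~: (c |: A)|.
Proof.
move=> ny T l0 lt sA xA; have sB := split_at_compl l0 sA.
have [B2|] := eqVneq #|~: (c |: A)| 2; last by case/and4P: sB => _ + _ _; lia0.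
have [u [b [d [EB U uc]]]] := split_at_pair primeL (ltnW V5) sB B2.
have [tL [cx cy xy] [tc tx ty] tz] := tripP T.
have yA : y \notin A by rewrite -(split_at_sep primeL T l0 lt sA).
have yB : y \in [set b; d] by rewrite -EB !inE negb_or yA eq_sym cy.
have xB : x \notin [set b; d] by rewrite -EB !inE negb_or xA andbF.
have [uL [cb cd bd] [_ ub ud] uz] := tripP U.
have : sp (t c) (u c) = sp (t y) (u y).
  apply: (iso2 (L := L)) => // z zc zy; have [->|zx] := eqVneq z x; last by rewrite tz ?sp0.
  move: xB; rewrite !inE negb_or => /andP[xb xd].
  by rewrite spC uz ?sp0 // eq_sym.
rewrite (end_dir V5 ny (trip_triplet T) (trip_triplet U)) uc spE tc l0 /=.
by rewrite eq_sym lt.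
Qed.

(* Moving the fan vertices one by one to the side of [x] preserves the split at [c], until [y]
   is moved as well. *)
Lemma absorb_up x y F T n c t l A i : fanfun L x y F T n -> trip L t c x y ->
  (forall i, i <= n -> F i != c) -> l != 0%R -> l != t c ->
  split_at L c l A -> x \in A -> i < n -> F i \in A -> F i.+1 \in A -> False.
Proof.
move=> ff R hc l0 lt; have [m] := ubnP (n - i).
elim: m i A => // m IH i A hm sA xA hi iA i1A.
have [E|ni] := eqVneq i.+1 n.
  have := split_at_sep primeL R l0 lt sA; rewrite xA.
  by rewrite -(ff_y ff) -E i1A.
have i2 : i.+1 < n by rewrite ltn_neqAle ni.
have [i2A|i2A] := boolP (F i.+2 \in A).
  by apply: (IH i.+1 A) => //; move: hm hi; lia0.
apply: (IH i.+1 (F i.+2 |: A)); rewrite ?inE ?xA ?i1A ?eqxx ?orbT //; first by move: hm hi; lia0.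
have B3 := short_side (ff_ny ff) R l0 lt sA xA.
have /and4P[cA hA hB hp] := sA.
have Fc : F i.+2 != c by apply: hc.
have cA' : c \notin F i.+2 |: A by rewrite !inE negb_or eq_sym Fc.
apply/and4P; split=> //.
- by rewrite cardsU1 i2A; move: hA; lia0.
- by move: (cardsU1C cA) (cardsU1C cA') B3; rewrite cardsU1 i2A; lia0.
have TT := ff_T ff (ltn0Sn i) i2; rewrite /= in TT.
have [TL _ [_ _ tc] tz] := tripP TT.
rewrite cardsU1 i2A; suff : box_dim L (fun=> l) A (c |: A) <
    box_dim L (fun=> l) (F i.+2 |: A) (c |: (F i.+2 |: A)).
  by move: hp; lia0.
apply: (box_dim_lt (t := T i.+1)).
- apply: box_space_sub => //; first exact: subsetUr.
    by apply: setUS; exact: subsetUr.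
  by move=> v _ _; right.
- apply/box_spaceP; split=> // z; rewrite !inE negb_or => /andP[z2 zA]; left; apply: tz => //.
    by apply: contraNneq zA => ->.
  by apply: contraNneq zA => ->.
- apply/negP=> /box_spaceP[_ /(_ _ i2A)[h|[]]]; first by rewrite h eqxx in tc.
  by rewrite inE (negbTE i2A) orbF inE (negbTE Fc).
Qed.

(** To start [absorb_up], two consecutive vertices of the fan must be on the same side: [F 0] and
    [F 1] with [x], if need be after moving [F 1] between [F 0] and [F 2]; or else [F 2] and [F 1]
    with [y], in the reversed fan. *)
Lemma no_short x y F T n c t : fanfun L x y F T n -> essential L c -> trip L t c x y -> False.
Proof.
move=> ff ec R; have [tL [cx cy xy] [tc tx ty] tz] := tripP R.
have n3 := ff_n ff.
(* An inner [c] would bring a second inner vertex into the triplet, whose other vertices are the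
   ends. *)
have hc i : i <= n -> F i != c.
  move=> hi; apply/eqP=> Fc.
  have i0 : 0 < i by rewrite lt0n; apply: contraNneq cx => E; rewrite -Fc E (ff_x ff).
  have iN : i < n by rewrite ltn_neqAle hi andbT; apply: contraNneq cy => E; rewrite -Fc E (ff_y ff).
  have qi : t (F i) != 0%R by rewrite Fc.
  have [j [j0 jn ji qj]] := ff_inner2 primeL V5 ff (trip_triplet R) i0 iN qi.
  move: qj; rewrite tz ?eqxx //.
  - by rewrite -Fc (ff_neq ff) // ltnW.
  - by rewrite -(ff_x ff) (ff_neq ff) ?(ltnW jn) // -lt0n.
  - by rewrite -(ff_y ff) (ff_neq ff) ?(ltnW jn) // ltn_eqF.
have [l [l0 lt /existsP[A0 sA0]]] := essential_dir (t c) ec.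
have [A [sA xA]] : exists A, split_at L c l A /\ x \in A.
  have [xA|xA] := boolP (x \in A0); first by exists A0.
  exists (~: (c |: A0)); split; first exact: split_at_compl.
  by rewrite !inE negb_or xA eq_sym cx.
have yA : y \notin A by rewrite -(split_at_sep primeL R l0 lt sA).
have F0A : F 0 \in A by rewrite (ff_x ff).
have up B : split_at L c l B -> x \in B -> F 1 \in B -> False.
  move=> sB xB F1B; apply: (absorb_up ff R hc l0 lt sB xB (i := 0)) => //; first by move: n3; lia0.
  by rewrite (ff_x ff).
have [F1A|F1A] := boolP (F 1 \in A); first exact: (up A).
have n1 : 1 < n by move: n3; lia0.
have TT := ff_T ff (ltn0Sn 0) n1; rewrite /= in TT.
have [F2A|F2A] := boolP (F 2 \in A).
  apply: (up (F 1 |: A)); rewrite ?inE ?xA ?eqxx ?orbT //.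
  have B3 := short_side (ff_ny ff) R l0 lt sA xA.
  have /and4P[cA hA hB hp] := sA.
  have Fc : F 1 != c by apply: hc; exact: ltnW.
  have cA' : c \notin F 1 |: A by rewrite !inE negb_or eq_sym Fc.
  apply/and4P; split=> //.
  - by rewrite cardsU1 F1A; move: hA; lia0.
  - by move: (cardsU1C cA) (cardsU1C cA') B3; rewrite cardsU1 F1A; lia0.
  have [TL _ [_ t1 _] tz1] := tripP TT.
  rewrite cardsU1 F1A; suff : box_dim L (fun=> l) A (c |: A) <
    box_dim L (fun=> l) (F 1 |: A) (c |: (F 1 |: A)).
    by move: hp; lia0.
  apply: (box_dim_lt (t := T 1)).
  - apply: box_space_sub => //; first exact: subsetUr.
      by apply: setUS; exact: subsetUr.
    by move=> v _ _; right.
  - apply/box_spaceP; split=> // z; rewrite !inE negb_or => /andP[z2 zA]; left; apply: tz1 => //.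
      by apply: contraNneq zA => ->.
    by apply: contraNneq zA => ->.
  - apply/negP=> /box_spaceP[_ /(_ _ F1A)[h|[]]]; first by rewrite h eqxx in t1.
    by rewrite inE (negbTE F1A) orbF inE (negbTE Fc).
have R' : trip L t c y x by rewrite trip_rev -trip_rot.
have inB z : z \notin A -> z != c -> z \in ~: (c |: A) by move=> ? ?; rewrite !inE negb_or; apply/andP.
apply: (absorb_up (fanfun_rev ff) R' _ l0 lt (split_at_compl l0 sA) (i := n.-2)).
- by move=> j jn; apply: hc; exact: leq_subr.
- by apply: inB => //; rewrite eq_sym.
- by move: n3; lia0.
- have -> : n - n.-2 = 2 by move: n3; lia0.
  by apply: inB => //; apply: hc; exact: ltnW.
- have -> : n - n.-2.+1 = 1 by move: n3; lia0.
  by apply: inB => //; apply: hc; exact: ltnW.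
Qed.
End Short.

(** * Triplets through an inner vertex of a fan belong to the fan *)

Section Consecutive.
Variables (V : finType) (L : lagrangian V).
Implicit Types (u w t q : {ffun V -> K}) (a b c d v z x y : V) (s : seq V).
Hypothesis primeL : prime_lagrangian L.
Hypothesis V5 : 5 <= #|V|.

Lemma two_zero w a b : w \in L -> (forall z, z != a -> z != b -> w z = 0%R) -> w = 0%R.
Proof.
move=> wL h; apply/eqP; apply: contraT => w0.
have := trip_intro primeL (a := a) (b := b) (c := b) (ltnW V5) wL w0.
move/(_ (fun z za zb _ => h z za zb)); case/tripP=> _ [_ _].
by rewrite eqxx.
Qed.

Lemma triplet_trip2 q a b : triplet L q -> q a != 0%R -> q b != 0%R -> a != b ->
  exists c, trip L q a b c.
Proof.
move=> hq qa qb ab; have [c [d Q]] := triplet_trip hq qa.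
have [_ _ _ qz] := tripP Q.
have [->|bc] := eqVneq b c; first by exists d.
have [->|bd] := eqVneq b d; first by exists c; rewrite trip_swap trip_rot.
by rewrite qz ?eqxx // eq_sym in qb.
Qed.

Lemma addK_eq q t : (q + t = 0)%R -> q = t.
Proof.
move/ffunP=> h; apply/ffunP=> z; apply/eqP; rewrite -K_addr_eq0.
by have := h z; rewrite !ffunE => ->.
Qed.

Lemma sp0_eq (k l : K) : k != 0%R -> l != 0%R -> sp k l = false -> k = l.
Proof. by move=> k0 l0; rewrite spE k0 l0 => /negbFE/eqP. Qed.

(** This is [chain_end] for the final segment of the fan that starts at [F i]. *)
Lemma ff_end x y F T n q i : fanfun L x y F T n -> i.+2 <= n -> q \in L ->
  (forall z, q z != 0%R -> exists2 j, (i <= j <= n) & z = F j) -> q (F i) != 0%R ->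
  q (F i) = T i.+1 (F i).
Proof.
move=> ff hi qL hq qi.
have hT := ff_T ff (ltn0Sn i) hi; rewrite /= in hT.
have [m En] : exists m, n = m + i.+2 by exists (n - i.+2); move: hi; lia0.
pose r := [seq F j | j <- iota i m.+3].
have Er : r = [:: F i, F i.+1, F i.+2 & [seq F j | j <- iota i.+3 m]] by [].
have nr j : j < m.+3 -> nth x r j = F (i + j).
  by move=> hj; rewrite (nth_map 0) ?size_iota // nth_iota.
have sr : size r = m.+3 by rewrite size_map size_iota.
have ur : uniq r.
  rewrite map_inj_in_uniq ?iota_uniq // => j1 j2; rewrite !mem_iota => h1 h2 E.
  by apply: (ff_inj ff) E; move: h1 h2; rewrite En; lia0.
have cr : chain L r.
  apply/(chainP L x) => j; rewrite sr => hj; rewrite !nr; try (by move: hj; lia0).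
  apply/existsP; exists (T (i + j).+1).
  have hT' : trip L (T (i + j).+1) (F (i + j)) (F (i + j).+1) (F (i + j).+2).
    by apply: (ff_T ff) => //; move: hj; rewrite En; lia0.
  by rewrite !addnS.
apply: (@chain_end V L primeL (F i) (F i.+1) (F i.+2) [seq F j | j <- iota i.+3 m]) => //.
- have -> : size [:: F i, F i.+1, F i.+2 & [seq F j | j <- iota i.+3 m]] = m.+3 by rewrite -Er sr.
  by move: (ff_gap ff); rewrite En; lia0.
- apply/subsetP=> z; rewrite in_supp => /hq[j hj ->]; rewrite inE -Er.
  by apply/mapP; exists j => //; rewrite mem_iota; move: hj; rewrite En; lia0.
Qed.

(** At [F i] the entry of [q] is that of [T i.+1], which differs from that of [T i]. Isotropy with
    [T i] then needs a second common vertex, and only [F i.+1] can be one. *)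
Lemma ff_three_next x y F T n q i m l : fanfun L x y F T n -> trip L q (F i) (F m) (F l) ->
  0 < i -> i < m -> m < l -> l < n -> m = i.+1.
Proof.
move=> ff Q i0 im ml ln; have [qL _ [qi qm ql] qz] := tripP Q.
have iN : i.+1 < n by move: im ml ln; lia0.
have hq : triplet L q := trip_triplet Q.
have q0 j : j <= n -> j != i -> j != m -> j != l -> q (F j) = 0%R.
  by move=> jn ji jm jl; apply: qz; rewrite (ff_neq ff) //; move: im ml ln; lia0.
have hE : q (F i) = T i.+1 (F i).
  apply: (ff_end ff iN qL) => // z qz0.
  have [->|zi] := eqVneq z (F i); first by exists i => //; move: iN; lia0.
  have [->|zm] := eqVneq z (F m); first by exists m => //; move: im ml ln; lia0.
  have [->|zl] := eqVneq z (F l); first by exists l => //; move: im ml ln; lia0.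
  by rewrite qz ?eqxx in qz0.
have := ff_iso V5 ff hq i0 (ltnW iN).
have [adj _] := ff_adj primeL V5 ff i0 iN.
rewrite spE hE (ff_T_in ff) ?(ff_T_in ff) ?(ltnW iN) //; try by lia0.
rewrite eq_sym adj (q0 i.-1) ?sp0 ?andbF /=; try by move: i0 im ml ln; lia0.
have [//|mi] := eqVneq m i.+1.
rewrite (q0 i.+1) ?sp0 ?andbF //; try by move: i0 im ml ln mi; lia0.
Qed.

(** Reversing the fan also gives [l = m.+1], and a triplet is determined by its support. *)
Lemma ff_three x y F T n q i m l : fanfun L x y F T n -> trip L q (F i) (F m) (F l) ->
  0 < i -> i < m -> m < l -> l < n -> q = T m.
Proof.
move=> ff Q i0 im ml ln; have Em := ff_three_next ff Q i0 im ml ln.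
have Q' : trip L q (F (n - (n - l))) (F (n - (n - m))) (F (n - (n - i))).
  by rewrite !subKn; try (by move: i0 im ml ln; lia0); rewrite trip_rev.
have := ff_three_next (fanfun_rev ff) Q'.
have h1 : 0 < n - l by move: i0 im ml ln; lia0.
have h2 : n - l < n - m by move: i0 im ml ln; lia0.
have h3 : n - m < n - i by move: i0 im ml ln; lia0.
have h4 : n - i < n by move: i0 im ml ln; lia0.
move=> /(_ h1 h2 h3 h4) El.
have El' : l = m.+1 by move: El i0 im ml ln; lia0.
have hm : 0 < m by rewrite Em.
have hT := ff_T ff hm (ltn_trans ml ln).
by apply: (trip_uniq primeL V5 _ hT); rewrite -El' [in F m.-1]Em.
Qed.

(** As [1 < i], isotropy with [T i.-1] fixes the entry at [F i], which is also that of [T i.+1];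
    isotropy with [T i] then forces [l = i.+1]. If [l.+1 < n], then [T l.+1] contradicts this, and
    otherwise [q + T l] is supported on two vertices. *)
Lemma ff_two_far x y F T n q i l c : fanfun L x y F T n -> trip L q (F i) (F l) c ->
  1 < i -> i < l -> l < n -> (forall m, 0 < m -> m < n -> F m != c) ->
  exists2 j, 0 < j < n & q = T j.
Proof.
move=> ff Q i1 il ln hc; have [qL [_ _ lc] [qi ql qc] qz] := tripP Q.
have hq : triplet L q := trip_triplet Q.
have i0 : 0 < i := ltnW i1.
have iN : i.+1 < n by move: il ln; lia0.
have q0 j : 0 < j -> j < n -> j != i -> j != l -> q (F j) = 0%R.
  by move=> j0 jn ji jl; apply: qz; rewrite ?hc // (ff_neq ff) //; move: il ln jn; lia0.
have qiE : q (F i) = T i.-1 (F i).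
  have h1 : 0 < i.-1 by move: i1; lia0.
  have h2 : i.-1 < n by move: iN; lia0.
  have := ff_iso V5 ff hq h1 h2; rewrite (prednK i0) (ltnW iN) (q0 i.-1) ?sp0 //; last 2 first.
  - by move: i0; lia0.
  - by move: il; lia0.
  have -> : (1 < i.-1) && sp (q (F i.-2)) (T i.-1 (F i.-2)) = false.
    by case: ltnP => //= h; rewrite q0 ?sp0 //; move: h il iN; lia0.
  by rewrite /= => /sp0_eq; apply=> //; apply: (ff_T_in ff) => //; move: i1; lia0.
have h1 : 0 < i.-1 by move: i1; lia0.
have skip : T i.-1 (F i) = T i.+1 (F i).
  by have := ff_skip ff h1; rewrite !(prednK i0) => ->.
have [adj _] := ff_adj primeL V5 ff i0 iN.
have s1 : sp (q (F i)) (T i (F i)).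
  rewrite spE qi qiE skip (ff_T_in ff) ?(ltnW iN) //=; by rewrite eq_sym.
have := ff_iso V5 ff hq i0 (ltnW iN); rewrite s1 iN /=.
have -> : (1 < i) && sp (q (F i.-1)) (T i (F i.-1)) = false.
  by rewrite q0 ?sp0 ?andbF //; move: i1 il ln; lia0.
rewrite /= => /negbFE s2.
have El : l = i.+1.
  apply/eqP; rewrite eq_sym; apply: contraTT s2 => h; rewrite q0 ?sp0 //.
  by move: i0; lia0.
have [lN|lN] := ltnP l.+1 n.
  have := ff_iso V5 ff hq (ltn0Sn l) lN.
  rewrite (q0 l.+1) ?sp0 //; try by move: il lN; lia0.
  have -> : (l.+2 < n) && sp (q (F l.+2)) (T l.+1 (F l.+2)) = false.
    by case: ltnP => //= h; rewrite q0 ?sp0 //; move: il; lia0.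
  rewrite /= addbF ?ltnS (ltn_trans i0 il) /= => /sp0_eq E.
  have {}E : q (F l) = T l.+1 (F l) by apply: E => //; apply: (ff_T_in ff) => //; lia0.
  move: s2; rewrite -El E El -(ff_skip ff) ?spE ?eqxx ?andbF //.
  by move: lN; rewrite El.
have l0 : 0 < l by rewrite El.
exists l; first by rewrite l0.
have := ff_iso V5 ff hq l0 ln; rewrite [l.+1 < n]ltnNge lN /= addbF.
have il' : l.-1 = i by rewrite El.
have -> : (1 < l) && sp (q (F l.-1)) (T l (F l.-1)) = false.
  by rewrite il' qiE skip El spE eqxx !andbF.
rewrite addbF => /sp0_eq qlE.
have {}qlE : q (F l) = T l (F l) by apply: qlE => //; apply: (ff_T_in ff).
apply: addK_eq; apply: (two_zero (a := F l.+1) (b := c)).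
  by rewrite rpredD ?(ff_TL ff).
move=> z z1 zc; rewrite ffunE.
have [->|zl] := eqVneq z (F l); first by rewrite qlE K_addkk.
have [->|zi] := eqVneq z (F i); first by rewrite qiE skip El K_addkk.
by rewrite qz // (ff_T_out ff) ?addr0 // il'.
Qed.

(** Here [q] meets the inside in its first and last vertex. For [3 < l] isotropy with [T 1] and
    [T 2] is contradictory; for smaller [l], either [q] is a triplet of the fan or [q + T 1 + T l]
    lives on [c], [x], [y]. *)
Lemma ff_two_ends x y F T n q l c : fanfun L x y F T n -> trip L q (F 1) (F l) c ->
  1 < l -> n = l.+1 -> (forall m, 0 < m -> m < n -> F m != c) ->
  (forall d t, trip L t d x y -> False) ->
  exists2 j, 0 < j < n & q = T j.
Proof.
move=> ff Q l1 En hc noshort; have [qL [_ _ lc] [q1 ql qc] qz] := tripP Q.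
have hq : triplet L q := trip_triplet Q.
have n3 := ff_n ff.
have l0 : 0 < l := ltnW l1.
have ln : l < n by rewrite En.
have n1 : 1 < n := ltnW n3.
have n0 : 0 < n := ltnW n1.
have q0 j : 0 < j -> j < n -> j != 1 -> j != l -> q (F j) = 0%R.
  by move=> j0 jn ji jl; apply: qz; rewrite ?hc // (ff_neq ff) // ltnW.
have xy : x != y by rewrite -(ff_x ff) -(ff_y ff) (ff_neq ff) // En.
have xc j : 0 < j -> j <= n -> F j != x by move=> j0 jn; rewrite -(ff_x ff) (ff_neq ff) // -lt0n.
have yc j : j < n -> F j != y by move=> jn; rewrite -(ff_y ff) (ff_neq ff) ?(ltnW jn) // ltn_eqF.
(* A nonzero sum would be a triplet on [c] and both ends. A zero sum would make [q] nonzero at [x]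
   and at [y], though its only vertex other than [F 1] and [F l] is [c]. *)
have key : (forall z, z != c -> z != x -> z != y -> (q + T 1 + T l)%R z = 0%R) -> False.
  move=> hw; have wL : (q + T 1 + T l)%R \in L by rewrite !rpredD ?(ff_TL ff).
  have [w0|w0] := eqVneq (q + T 1 + T l)%R 0%R; last first.
    exact: (noshort c _ (trip_intro primeL (ltnW V5) wL w0 hw)).
  have h z : q z = (T 1 z + T l z)%R.
    apply/eqP; rewrite -K_addr_eq0; move/ffunP/(_ z): w0; rewrite !ffunE => <-.
    by rewrite addrA.
  have qx : q x != 0%R.
    by rewrite h -(ff_x ff) (ff_T_far ff (j := l)) ?addr0 ?(ff_T_in ff) //.
  have qy : q y != 0%R.
    have h1 : T 1 (F n) = 0%R by apply: (ff_T_far ff); rewrite ?n3.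
    have h2 : T l (F n) != 0%R by apply: (ff_T_in ff) => //; move: En; lia0.
    by rewrite h -(ff_y ff) h1 add0r.
  have Ec z : q z != 0%R -> z != F 1 -> z != F l -> z = c.
    by move=> qz0 z1 zl; apply/eqP; apply: contraTT qz0 => zc; rewrite qz ?eqxx.
  move: xy; rewrite (Ec x) // 1?eq_sym ?xc ?(ltnW ln) ?(ltnW n1) //.
  by rewrite (Ec y) ?eqxx // eq_sym yc.
have Tne j i : 0 < j -> j < n -> i <= j.+1 -> j <= i.+1 -> T j (F i) != 0%R.
  exact: (ff_T_in ff).
have outw z : z != c -> z != x -> z != y -> z != F 1 -> z != F 2 -> z != F l.-1 -> z != F l ->
    (q + T 1 + T l)%R z = 0%R.
  move=> zc zx zy z1 z2 z3 z4; rewrite !ffunE qz //.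
  have -> : T 1 z = 0%R by apply: (ff_T_out ff) => //; rewrite (ff_x ff).
  have -> : T l z = 0%R by apply: (ff_T_out ff) => //; rewrite -En (ff_y ff).
  by rewrite !addr0.
have [l3|l3] := ltnP 3 l.
  have e1 : q (F 1) = T 1 (F 1).
    have := ff_iso V5 ff hq (ltn0Sn 0) n1.
    rewrite (q0 2) ?sp0 ?andbF ?addbF //; try by move: l3 En; lia0.
    by move/sp0_eq; apply => //; apply: Tne.
  have n2 : 2 < n by [].
  have e2 : q (F 1) = T 2 (F 1).
    have := ff_iso V5 ff hq (ltn0Sn 1) n2.
    rewrite (q0 2) ?(q0 3) ?sp0 ?andbF ?addbF /=; try by move: l3 En; lia0.
    by move/sp0_eq; apply => //; apply: Tne.
  have [] := ff_adj primeL V5 ff (ltn0Sn 0) n2.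
  by rewrite -e1 -e2 eqxx.
have [l2|l2] : l = 3 \/ l = 2 by move: l1 l3; lia0.
  exfalso; apply: key => z zc zx zy.
  have e1 : q (F 1) = T 1 (F 1).
    have := ff_iso V5 ff hq (ltn0Sn 0) n1.
    rewrite (q0 2) ?sp0 ?andbF ?addbF //; try by move: l2 En; lia0.
    by move/sp0_eq; apply => //; apply: Tne.
  have e3 : q (F l) = T l (F l).
    have := ff_iso V5 ff hq l0 ln.
    rewrite (q0 l.-1) ?sp0 ?andbF ?addbF; try by move: l2 En; lia0.
    rewrite [l.+1 < n]ltnNge En leqnn /= addbF.
    by move/sp0_eq; apply => //; apply: Tne.
  have [->|z1] := eqVneq z (F 1).
    rewrite !ffunE; have -> : T l (F 1) = 0%R by apply: (ff_T_far ff) => //; rewrite l2.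
    by rewrite e1 K_addkk addr0.
  have [->|z2] := eqVneq z (F 2).
    rewrite !ffunE q0 ?l2 // add0r.
    by have := ff_skip ff (ltn0Sn 0); rewrite En l2 => ->; rewrite ?K_addkk.
  have [->|z3] := eqVneq z (F l).
    have T0 : T 1 (F l) = 0%R by apply: (ff_T_far ff) => //; [exact: ltnW | rewrite l2].
    by rewrite !ffunE T0 e3 addr0 K_addkk.
  by apply: outw => //; rewrite l2.
have n2 : 2 < n by [].
have [a1 a2] := ff_adj primeL V5 ff (ltn0Sn 0) n2.
have i1 := ff_iso V5 ff hq (ltn0Sn 0) n1; rewrite n2 /= addbF in i1.
have i2 := ff_iso V5 ff hq (ltn0Sn 1) n2; rewrite En l2 /= addbF in i2.
rewrite l2 in ql qz Q key outw lc ln En.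
have [E1|E1] := eqVneq (q (F 1)) (T 1 (F 1)).
  exists 1; first by rewrite n1.
  have E2 : q (F 2) = T 1 (F 2).
    by move: i1; rewrite E1 [sp (T 1 _) _]spE eqxx !andbF /= => /sp0_eq; apply=> //; apply: Tne.
  apply: addK_eq; apply: (two_zero (a := x) (b := c)); first by rewrite rpredD ?(ff_TL ff).
  move=> z zx zc; rewrite ffunE.
  have [->|z1] := eqVneq z (F 1); first by rewrite E1 K_addkk.
  have [->|z2] := eqVneq z (F 2); first by rewrite E2 K_addkk.
  by rewrite qz // (ff_T_out ff) ?addr0 //= (ff_x ff).
have [E2|E2] := eqVneq (q (F 1)) (T 2 (F 1)).
  exists 2; first by rewrite n2.
  have E3 : q (F 2) = T 2 (F 2).
    by move: i2; rewrite E2 [sp (T 2 (F 1)) _]spE eqxx !andbF addbF => /sp0_eq; apply=> //; apply: Tne.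
  apply: addK_eq; apply: (two_zero (a := y) (b := c)); first by rewrite rpredD ?(ff_TL ff).
  move=> z zy zc; rewrite ffunE.
  have [->|z1] := eqVneq z (F 1); first by rewrite E2 K_addkk.
  have [->|z2] := eqVneq z (F 2); first by rewrite E3 K_addkk.
  by rewrite qz // (ff_T_out ff) ?addr0 //= -En (ff_y ff).
(* At [F 1], and likewise at [F 2], the entries of [q], [T 1] and [T 2] are the three nonzero
   elements of [K], whose sum is zero. *)
exfalso; apply: key => z zc zx zy.
have [->|z1] := eqVneq z (F 1).
  by rewrite !ffunE (K_third (k := T 1 (F 1)) (l := T 2 (F 1)) (m := q (F 1))) ?Tne //
     -addrA K_addkk.
have [->|z2] := eqVneq z (F 2).
  have F1 : q (F 2) != T 1 (F 2).
    by apply/eqP=> E; move: i1; rewrite E [sp (T 1 (F 2)) _]spE eqxx !andbF addbF spE q1 Tne ?E1.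
  have F2 : q (F 2) != T 2 (F 2).
    by apply/eqP=> E; move: i2; rewrite E [sp (T 2 (F 2)) _]spE eqxx !andbF /= spE q1 Tne ?E2.
  by rewrite !ffunE (K_third (k := T 1 (F 2)) (l := T 2 (F 2)) (m := q (F 2))) ?Tne //
     -addrA K_addkk.
exact: outw.
Qed.

(** [ff_inner2] provides a second inner vertex. Either the third vertex is inner too, or one of the
    two is away from its end of the fan, up to reversal, or both are extreme. *)
Lemma ff_consec x y F T n q i : fanfun L x y F T n -> triplet L q ->
  (forall d t, trip L t d x y -> False) -> 0 < i -> i < n -> q (F i) != 0%R ->
  exists2 j, 0 < j < n & q = T j.
Proof.
move=> ff hq noshort i0 iN qi.
have [j [j0 jn ji qj]] := ff_inner2 primeL V5 ff hq i0 iN qi.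
wlog ij : i j i0 iN qi j0 jn ji qj / i < j.
  move=> W; case: (ltngtP i j) => [ij|ij|E]; [exact: (W i j)|apply: (W j i) => //|].
    by rewrite eq_sym.
  by rewrite E eqxx in ji.
have Fij : F i != F j by rewrite (ff_neq ff) ?(ltnW iN) ?(ltnW jn) // eq_sym.
have [c Q] := triplet_trip2 hq qi qj Fij.
have [_ [_ Fic Fjc] _ _] := tripP Q.
case: (boolP [exists m : 'I_n, (0 < val m) && (F m == c)]) => [/existsP[[m mn]] /andP[/= m0 /eqP Em]|].
  rewrite -Em in Q Fic Fjc.
  have im : i != m by apply: contraNneq Fic => ->.
  have jm : j != m by apply: contraNneq Fjc => ->.
  have [mi|mi] := ltnP m i.
    exists i; rewrite ?i0 //; apply: (ff_three ff _ m0 mi ij jn).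
    by rewrite trip_rot.
  have [mj|mj] := ltnP m j.
    exists m; rewrite ?m0 //; apply: (ff_three ff _ i0 _ mj jn); last by rewrite ltn_neqAle im.
    by rewrite trip_rev -trip_rot.
  exists j; rewrite ?j0 //; apply: (ff_three ff Q i0 ij _ mn).
  by rewrite ltn_neqAle jm.
rewrite negb_exists => /forallP hm.
have hc m : 0 < m -> m < n -> F m != c.
  by move=> m0 mn; have := hm (Ordinal mn); rewrite /= m0.
have [i1|i1] := ltnP 1 i; first exact: (ff_two_far ff Q).
have Ei : i = 1 by move: i0 i1; lia0.
rewrite Ei in Q ij.
have [jN|jN] := ltnP j.+1 n; last first.
  by apply: (ff_two_ends ff Q) => //; move: jn jN; lia0.
have Q' : trip L q (F (n - (n - j))) (F (n - (n - 1))) c.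
  by rewrite !subKn ?(ltnW jn) ?(ltnW (leq_trans j0 jn)) 1?trip_swap // (leq_trans _ jn).
have [|||m m0 mn|m hm' ->] := ff_two_far (fanfun_rev ff) Q'.
- by move: jN; lia0.
- by move: ij jn; lia0.
- by move: ij jn; lia0.
- by apply: hc; move: m0 mn; lia0.
by exists (n - m) => //; move: hm'; lia0.
Qed.
End Consecutive.

(** * Systems of fans and a common direction at each vertex *)

Section Systems.
Variables (V : finType) (L : lagrangian V).
Implicit Types (u t q : {ffun V -> K}) (a b c d v w z x y : V) (s : seq V) (rep : V -> seq V).
Hypothesis primeL : prime_lagrangian L.
Hypothesis V5 : 5 <= #|V|.

(** At the inner positions of a fan the triplet exists and, by [trip_uniq], is unique; zero is only
    a default. *)
Definition tvec x s j : {ffun V -> K} :=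
  odflt 0%R [pick u | trip L u (nth x s j.-1) (nth x s j) (nth x s j.+1)].

Lemma fan_path x s : fan L s -> fanpath L (nth x s) (tvec x s) (size s).-1.
Proof.
case/and3P=> us cs hs; split.
- move=> i j hi hj E; apply/eqP; rewrite -(nth_uniq x _ _ us) ?E //.
    by move: hi hs; move: (size s) => k; lia0.
  by move: hj hs; move: (size s) => k; lia0.
- by move: hs; move: (size s) => k; lia0.
- move=> j j0 jn; rewrite /tvec; case: pickP => //= h.
  have := chainP L x s cs j.-1; rewrite (prednK j0) => /(_ ltac:(move: jn j0; move: (size s) => k2; lia0)).
  by case/existsP=> u; rewrite h.
Qed.

Definition xyfan x y s := [&& fan L s, nth x s 0 == x & last x s == y].

Lemma xyfan_index x y s v : xyfan x y s -> v \in s -> v != x -> v != y ->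
  [/\ 0 < index v s, index v s < (size s).-1 & nth x s (index v s) = v].
Proof.
case/and3P=> fs /eqP h0 /eqP hl vs vx vy.
have hv := nth_index x vs; split=> //.
  by rewrite lt0n; apply: contraNneq vx => E; rewrite -hv E h0.
have : index v s < size s by rewrite index_mem.
have : index v s != (size s).-1 by apply: contraNneq vy => E; rewrite -hv E nth_last hl.
by move/eqP; move: (index v s) (size s) => k1 k2; lia0.
Qed.

(** The last field makes [rep] constant on the inside of each fan, so that distinct fans are
    disjoint there. *)
Record fan_system x y rep : Prop := FanSystem {
  fs_xy : x != y;
  fs_fan : forall v, v != x -> v != y -> xyfan x y (rep v) /\ v \in rep v;
  fs_rep : forall v w, v != x -> v != y -> w != x -> w != y -> w \in rep v -> rep w = rep v
}.

Definition center x rep v := tvec x (rep v) (index v (rep v)).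

Section Compat.
Variables (x y : V) (rep : V -> seq V).
Hypothesis sys : fan_system x y rep.

Lemma center_trip v : v != x -> v != y ->
  trip L (center x rep v) (nth x (rep v) (index v (rep v)).-1) v
    (nth x (rep v) (index v (rep v)).+1).
Proof.
move=> vx vy; have [fv vs] := fs_fan sys vx vy; have [i0 iN hv] := xyfan_index fv vs vx vy.
have /and3P[/(fan_path x) ff _ _] := fv.
by have := ff_T ff i0 iN; rewrite hv.
Qed.

Hypothesis same_rep : forall v z, v != x -> v != y -> z != x -> z != y ->
  center x rep v z != 0%R -> rep v = rep z.
Hypothesis same_end : forall v w z, v != x -> v != y -> w != x -> w != y -> (z == x) || (z == y) ->
  center x rep v z != 0%R -> center x rep w z != 0%R -> center x rep v z = center x rep w z.

(** At an inner vertex the only other triplets are those centred next to it on its fan: they agree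
    by [ff_skip] and differ from its own by [ff_adj]. Their common entry is [e z]; at the ends
    [same_end] supplies it. *)
Lemma center_compat : exists e : V -> K,
  [/\ forall z, e z != 0%R, forall z, z != x -> z != y -> center x rep z z != e z
    & forall v z, v != x -> v != y -> z != v -> center x rep v z != 0%R -> center x rep v z = e z].
Proof.
suff h z : exists k : K, [/\ k != 0%R, z != x -> z != y -> center x rep z z != k
    & forall v, v != x -> v != y -> z != v -> center x rep v z != 0%R -> center x rep v z = k].
  have [e he] := fin_all_exists h; exists e; split=> [z|z zx zy|v z vx vy zv];
    have [h1 h2 h3] := he z; [by []|exact: h2|exact: h3].
have [zE|] := boolP ((z == x) || (z == y)).
  case: (boolP [exists v, [&& v != x, v != y & center x rep v z != 0%R]]).
    case/existsP=> v /and3P[vx vy vz]; exists (center x rep v z); split=> //.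
      by move=> zx zy; rewrite (negbTE zx) (negbTE zy) in zE.
    by move=> w wx wy _ wz; apply: same_end.
  (* No centred triplet contains this end, so any nonzero value will do. *)
  rewrite negb_exists => /forallP h; exists (true, true); split=> //.
    by move=> zx zy; rewrite (negbTE zx) (negbTE zy) in zE.
  by move=> w wx wy _ wz; have := h w; rewrite wx wy wz.
rewrite negb_or => /andP[zx zy].
have [fz zs] := fs_fan sys zx zy; have [i0 iN hz] := xyfan_index fz zs zx zy.
have /and3P[/(fan_path x) ff _ _] := fz.
set s := rep z in fz zs i0 iN hz ff; set i := index z s in i0 iN hz.
have T0 j : 0 < j -> j < (size s).-1 -> i <= j.+1 -> j <= i.+1 -> tvec x s j z != 0%R.
  by move=> *; rewrite -hz (ff_T_in ff).
have [k [k0 kz hk]] : exists k : K, [/\ k != 0%R, tvec x s i z != k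
    & forall j, 0 < j -> j < (size s).-1 -> j != i -> tvec x s j z != 0%R -> tvec x s j z = k].
  have near j : 0 < j -> j < (size s).-1 -> j != i -> tvec x s j z != 0%R -> j = i.-1 \/ j = i.+1.
    move=> j0 jn ji; have [far|] := boolP ((j.+1 < i) || (i.+1 < j)).
      by rewrite -hz (ff_T_far ff) ?eqxx // ltnW.
    by move=> + _; move: ji i0; lia0.
  have [i1|i1] := ltnP i.+1 (size s).-1.
    have [a1 _] := ff_adj primeL V5 ff i0 i1; rewrite hz in a1.
    exists (tvec x s i.+1 z); split=> //; first by apply: T0 => //; lia0.
    move=> j j0 jn ji /(near j j0 jn ji)[] E; rewrite E //.
    have h1 : 0 < i.-1 by rewrite -E.
    by have := ff_skip ff h1; rewrite !(prednK i0) hz; apply.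
  have i2 : 0 < i.-1 by have := ff_n ff; move: i1; lia0.
  have i3 : i.-1.+1 < (size s).-1 by rewrite prednK.
  have [_ a2] := ff_adj primeL V5 ff i2 i3; rewrite (prednK i0) hz eq_sym in a2.
  exists (tvec x s i.-1 z); split=> //; first by apply: T0 => //; move: iN i0; lia0.
  by move=> j j0 jn ji /(near j j0 jn ji)[] E; rewrite E //; move: jn i1; rewrite E; lia0.
exists k; split=> // v vx vy zv vz.
have Erep := same_rep vx vy zx zy vz.
have [fv vs] := fs_fan sys vx vy; have [j0 jN hv] := xyfan_index fv vs vx vy.
rewrite Erep -/s in vs j0 jN hv.
move: vz; rewrite /center Erep -/s => vz; apply: hk => //.
by apply: contraNneq zv => E; rewrite -hv E hz.
Qed.
End Compat.

(** The ends may be essential here, which excludes [end_dir]; but each end lies in a single triplet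
    of the fan, so there is nothing to compare. *)
Lemma spanning_system x s : fan L s -> nth x s 0 = x -> size s = #|V| ->
  fan_system x (last x s) (fun=> s) /\ exists e : V -> K,
  [/\ forall z, e z != 0%R,
      forall z, z != x -> z != last x s -> center x (fun=> s) z z != e z
    & forall v z, v != x -> v != last x s -> z != v ->
      center x (fun=> s) v z != 0%R -> center x (fun=> s) v z = e z].
Proof.
move=> fs h0 hs; have /and3P[us cs s4] := fs; have ff := fan_path x fs.
have all_s v : v \in s.
  have hc : #|s| = #|V| by rewrite (card_uniqP us).
  by rewrite (elimT (subset_cardP hc) (subset_predT _)).
have xl : x != last x s.
  by rewrite -[x in x != _]h0 -nth_last nth_uniq //; move: s4; move: (size s) => k; lia0.
have xyf : xyfan x (last x s) s by rewrite /xyfan fs h0 !eqxx.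
have sys : fan_system x (last x s) (fun=> s) by split.
split=> //; apply: (center_compat sys) => // v w z vx vy wx wy zE.
have [i0 iN hv] := xyfan_index xyf (all_s v) vx vy.
have [j0 jN hw] := xyfan_index xyf (all_s w) wx wy.
rewrite /center; case/orP: zE => /eqP->.
  have one j : 0 < j -> j < (size s).-1 -> tvec x s j x != 0%R -> j = 1.
    move=> k0 kn; have [far|] := boolP ((j.+1 < 0) || (0.+1 < j)).
      by rewrite -[x in tvec _ _ _ x]h0 (ff_T_far ff) ?eqxx.
    by move=> + _; move: k0; lia0.
  by move=> /(one _ i0 iN)-> /(one _ j0 jN)->.
have one j : 0 < j -> j < (size s).-1 -> tvec x s j (last x s) != 0%R -> j = (size s).-2.
  move=> k0 kn; rewrite -nth_last; have [far|] := boolP ((j.+1 < (size s).-1) || ((size s).-1.+1 < j)).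
    by rewrite (ff_T_far ff) ?eqxx.
  by move=> + _; move: k0 kn; move: (size s) => m; lia0.
by move=> /(one _ i0 iN)-> /(one _ j0 jN)->.
Qed.
End Systems.

(** * Covering the essential vertices by fans when no fan spans *)

Section Noncyclic.
Variables (V : finType) (L : lagrangian V).
Implicit Types (u t q : {ffun V -> K}) (a b c d v w z x y : V) (s : seq V) (rep : V -> seq V).
Hypothesis primeL : prime_lagrangian L.
Hypothesis V5 : 5 <= #|V|.
Hypothesis noncyclic : forall s, fan L s -> size s != #|V|.
Hypothesis few : #|[set v | ~~ essential L v]| <= 2.

(** A triplet with a second essential vertex is prolonged by [triangle] to a fan of four vertices,
    whose order depends on the two vertices shared. *)
Lemma essential_fan v : essential L v -> (exists2 s, fan L s & v \in s) \/
  exists u b c, [/\ trip L u v b c, ~~ essential L b & ~~ essential L c].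
Proof.
move=> ev; have /existsP[k /existsP[l /and5P[k0 l0 kl hk hl]]] := ev.
have [u [b [c U]]] := nonprime_trip primeL V5 k0 l0 kl hk hl.
have grow b' c' : trip L u v b' c' -> essential L b' -> exists2 s, fan L s & v \in s.
  move=> {}U eb; have [_ [vb vc bc] _ _] := tripP U.
  have [k1 [k10 k1u hk1]] := essential_dir (u v) ev.
  have [l1 [l10 l1u hl1]] := essential_dir (u b') eb.
  have [t [d [_ hd]]] := triangle primeL V5 U k10 l10 k1u l1u hk1 hl1.
  case: hd => -[T dn]; have [_ [vb' vd bd] _ _] := tripP T.
    exists [:: c'; v; b'; d]; last by rewrite !inE eqxx orbT.
    rewrite /fan /= !inE !negb_or [c' == v]eq_sym vc [c' == b']eq_sym bc [c' == d]eq_sym dn vb vd bd /=.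
    rewrite !andbT; apply/andP; split; apply/existsP; [exists u|exists t]; rewrite ?T //.
    by rewrite trip_rot.
  exists [:: b'; v; c'; d]; last by rewrite !inE eqxx orbT.
  rewrite /fan /= !inE !negb_or [b' == v]eq_sym vb bc [b' == d]eq_sym dn vc vd bd /=.
  rewrite !andbT; apply/andP; split; apply/existsP; [exists u|exists t]; rewrite ?T //.
  by rewrite trip_swap.
have [eb|nb] := boolP (essential L b); first by left; apply: (grow b c).
have [ec|nc] := boolP (essential L c); last by right; exists u, b, c.
by left; apply: (grow c b) => //; rewrite trip_rev -trip_rot.
Qed.

(** Without fans, two essential vertices would have triplets on the same two non-essential ones. By
    [end_dir] these agree there, so their sum lives on two vertices and vanishes, though the
    supports differ. *)
Lemma exists_fan : exists s, fan L s.
Proof.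
have : 1 < #|~: [set v | ~~ essential L v]|.
  by have := cardsC [set v | ~~ essential L v]; move: few V5; lia0.
case/card_gt1P=> v1 [v2 []]; rewrite !inE !negbK => e1 e2 v12.
have [[s fs _]|[u1 [b1 [c1 [U1 nb1 nc1]]]]] := essential_fan e1; first by exists s.
have [[s fs _]|[u2 [b2 [c2 [U2 nb2 nc2]]]]] := essential_fan e2; first by exists s.
exfalso; have [u1L [vb1 vc1 bc1] [uv1 ub1 uc1] uz1] := tripP U1.
have [u2L [vb2 vc2 bc2] [uv2 ub2 uc2] uz2] := tripP U2.
have EN : [set b1; c1] = [set v | ~~ essential L v].
  apply/eqP; rewrite eqEcard cards2 bc1 few andbT; apply/subsetP=> z.
  by rewrite !inE => /orP[]/eqP->.
have inN z : ~~ essential L z -> (z == b1) || (z == c1).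
  by move=> nz; rewrite -in_set2 EN inE.
have u0 z : z \in [set b1; c1] -> u1 z != 0%R /\ u2 z != 0%R.
  move=> zN; split; first by move: zN; rewrite !inE => /orP[]/eqP->.
  have E2 : [set b2; c2] = [set b1; c1].
    apply/eqP; rewrite eqEcard !cards2 bc1 bc2 leqnn andbT; apply/subsetP=> y.
    by rewrite !inE => /orP[]/eqP->; apply: inN.
  by move: zN; rewrite -E2 !inE => /orP[]/eqP->.
have same z : z \in [set b1; c1] -> u1 z = u2 z.
  move=> zN; have [h1 h2] := u0 z zN; apply: sp0_eq => //.
  apply: (end_dir V5 _ (trip_triplet U1) (trip_triplet U2)).
  by move: zN; rewrite EN inE.
have w0 : (u1 + u2)%R = 0%R.
  apply: (two_zero (L := L) primeL V5 (a := v1) (b := v2)); first by rewrite rpredD.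
  move=> z z1 z2; rewrite ffunE; have [zN|] := boolP (z \in [set b1; c1]).
    by rewrite same // K_addkk.
  rewrite !inE negb_or => /andP[zb zc]; rewrite uz1 // add0r uz2 //.
    by apply: contraTneq (inN _ nb2) => <-; rewrite negb_or zb.
  by apply: contraTneq (inN _ nc2) => <-; rewrite negb_or zb.
have h := addK_eq w0; have [z0|] := boolP (v1 \in [set v2; b2; c2]); last first.
  rewrite !inE !negb_or -andbA => /and3P[h1 h2 h3].
  by move: uv1; rewrite h uz2 ?eqxx.
move: z0; rewrite !inE (negbTE v12) /= => /orP[]/eqP E1.
  by move: nb2; rewrite -E1 e1.
by move: nc2; rewrite -E1 e1.
Qed.

Lemma xyfan_rev x y s : xyfan L x y s -> xyfan L y x (rev s).
Proof.
case/and3P=> fs /eqP h0 /eqP hl; rewrite /xyfan fan_rev fs /=.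
case: s fs h0 hl => [|a s] fs h0 hl; first by case/and3P: fs.
have {h0} Ea : a = x by [].
rewrite Ea in fs hl *; rewrite [in last _ _]rev_cons last_rcons eqxx andbT.
by rewrite lastI rev_rcons /=; move: hl => /= ->.
Qed.

Lemma xyfan_fun x y s : ~~ essential L x -> ~~ essential L y -> xyfan L x y s ->
  fanfun L x y (nth x s) (tvec L x s) (size s).-1.
Proof.
move=> nx ny /and3P[fs /eqP h0 /eqP hl]; split=> //; first exact: fan_path.
  by rewrite nth_last.
have /and3P[_ _] := fs; have := fan_gap primeL V5 noncyclic fs.
by move: (size s) => k; lia0.
Qed.

(** The ends of a completed fan are the two non-essential vertices, so all completed fans share
    them. A vertex in no fan would form a triplet with [x] and [y], against [no_short]. *)
Lemma two_ends : exists x y, [/\ x != y, ~~ essential L x, ~~ essential L y,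
  forall v, v != x -> v != y -> essential L v
  & forall v, v != x -> v != y -> exists2 s, xyfan L x y s & v \in s].
Proof.
have [s0 fs0] := exists_fan.
have ends s : fan L s -> exists x y s', [/\ xyfan L x y s', {subset s <= s'}, x != y,
    ~~ essential L x & ~~ essential L y].
  move=> fs; have [s' [fs' sub hx hy]] := fan_complete primeL V5 noncyclic fs.
  have /and3P[us cs s4] := fs'.
  case: s' fs' sub hx hy us cs s4 => [|x s'] // fs' sub hx hy us cs s4.
  exists x, (last x s'), (x :: s'); split=> //.
  - by rewrite /xyfan fs' /= !eqxx.
  - have : last x s' \in s' by case: s' s4 {fs' sub hx hy us cs} => // z s' _; exact: (mem_last z s').
    by case/andP: us => xN _ ls; apply: contraNneq xN => ->.
  - exact: (hx x s').
  - by apply: (hy _ (belast x s')); rewrite -lastI.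
have [x [y [s1 [xy1 _ xy nx ny]]]] := ends _ fs0.
have EN : [set x; y] = [set v | ~~ essential L v].
  apply/eqP; rewrite eqEcard cards2 xy few andbT; apply/subsetP=> z.
  by rewrite !inE => /orP[]/eqP->.
have inN z : ~~ essential L z -> (z == x) || (z == y).
  by move=> nz; rewrite -in_set2 EN inE.
have ess v : v != x -> v != y -> essential L v.
  by move=> vx vy; apply: contraT => /inN; rewrite (negbTE vx) (negbTE vy).
exists x, y; split=> // v vx vy.
have [[s fs vs]|[u [b [c [U nb nc]]]]] := essential_fan (ess v vx vy).
  have [x' [y' [s' [xy' sub xy2 nx' ny']]]] := ends _ fs.
  have vs' := sub _ vs; case/orP: (inN _ nx') => /eqP Ex.
    exists s' => //; case/orP: (inN _ ny') => /eqP Ey; last by rewrite -Ex -Ey.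
    by rewrite Ex Ey eqxx in xy2.
  case/orP: (inN _ ny') => /eqP Ey; last by rewrite Ex Ey eqxx in xy2.
  exists (rev s'); last by rewrite mem_rev.
  by rewrite -Ex -Ey xyfan_rev.
have [_ [_ _ bc] _ _] := tripP U.
have ff1 : fanfun L x y (nth x s1) (tvec L x s1) (size s1).-1.
  exact: xyfan_fun.
exfalso; apply: (no_short primeL V5 ff1 (ess v vx vy) (t := u)).
case/orP: (inN _ nb) => /eqP Eb; case/orP: (inN _ nc) => /eqP Ec; move: U bc; rewrite Eb Ec ?eqxx //.
by rewrite trip_rev -trip_rot.
Qed.

Section Inner.
Variables (x y : V).
Hypotheses (nx : ~~ essential L x) (ny : ~~ essential L y).
Hypothesis ess : forall v, v != x -> v != y -> essential L v.

Lemma no_short_ends s : xyfan L x y s -> forall d t, trip L t d x y -> False.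
Proof.
move=> fs d t T; have [_ [dx dy _] _ _] := tripP T.
exact: (no_short primeL V5 (xyfan_fun nx ny fs) (ess dx dy) T).
Qed.

Lemma triplet_in_fan s q v : xyfan L x y s -> triplet L q -> v \in s -> v != x -> v != y ->
  q v != 0%R -> exists2 j, 0 < j < (size s).-1 & q = tvec L x s j.
Proof.
move=> fs hq vs vx vy; have [i0 iN hv] := xyfan_index fs vs vx vy.
rewrite -{1}hv; apply: (ff_consec primeL V5 (xyfan_fun nx ny fs) hq _ i0 iN).
exact: no_short_ends fs.
Qed.

Lemma tvec_supp s j z : xyfan L x y s -> 0 < j < (size s).-1 -> tvec L x s j z != 0%R -> z \in s.
Proof.
move=> /and3P[fs _ _] /andP[j0 jn]; have ff := fan_path x fs.
have [_ _ _ tz] := tripP (ff_T ff j0 jn); apply: contraNT => zs; apply/eqP; apply: tz.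
- by apply: contraNneq zs => ->; apply: mem_nth; move: jn; move: (size s) => k; lia0.
- by apply: contraNneq zs => ->; apply: mem_nth; move: jn; move: (size s) => k; lia0.
- by apply: contraNneq zs => ->; apply: mem_nth; move: jn; move: (size s) => k; lia0.
Qed.

(** A triplet of [s'] centred at an inner vertex of [s] is a triplet of [s], so the neighbours of
    this vertex along [s'] are in [s]; walking both ways along [s'] reaches [w]. *)
Lemma fans_meet s s' v w : xyfan L x y s -> xyfan L x y s' -> v \in s -> v \in s' ->
  v != x -> v != y -> w \in s' -> w != x -> w != y -> w \in s.
Proof.
move=> fs fs' vs vs' vx vy ws' wx wy.
have ff' := xyfan_fun nx ny fs'; set n := (size s').-1 in ff'.
have step j : 0 < j -> j < n -> nth x s' j \in s ->
    nth x s' j.-1 \in s /\ nth x s' j.+1 \in s.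
  move=> j0 jn js; have hq := ff_triplet ff' j0 jn.
  have jx : nth x s' j != x.
    by rewrite -[X in _ != X](ff_x ff') (ff_neq ff') ?(ltnW jn) // -lt0n.
  have jy : nth x s' j != y by rewrite -(ff_y ff') (ff_neq ff') ?(ltnW jn) // ltn_eqF.
  have Tj i : i <= j.+1 -> j <= i.+1 -> tvec L x s' j (nth x s' i) != 0%R.
    exact: (ff_T_in ff').
  have [m hm Em] := triplet_in_fan fs hq js jx jy (Tj _ (leqnSn _) (leqnSn _)).
  by split; apply: (tvec_supp fs hm); rewrite -Em; apply: Tj; move: j0; lia0.
have [i0 iN hv] := xyfan_index fs' vs' vx vy.
have [j0 jN hw] := xyfan_index fs' ws' wx wy.
have up (d : nat) : index v s' + d < n -> nth x s' (index v s' + d) \in s.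
  elim: d => [|d IH] hd; first by rewrite addn0 hv.
  rewrite addnS; apply: (proj2 (step _ _ _ _)).
  - by rewrite ltn_addr.
  - by move: hd; rewrite addnS => /ltnW.
  - by apply: IH; move: hd; rewrite addnS => /ltnW.
have down (d : nat) : d < index v s' -> nth x s' (index v s' - d) \in s.
  elim: d => [|d IH] hd; first by rewrite subn0 hv.
  rewrite subnS; apply: (proj1 (step _ _ _ _)).
  - by rewrite subn_gt0 ltnW.
  - by apply: leq_ltn_trans iN; apply: leq_subr.
  - by apply: IH; apply: ltnW.
rewrite -hw; case: (leqP (index v s') (index w s')) => h.
  by have := up (index w s' - index v s'); rewrite subnKC //; apply.
have := down (index v s' - index w s'); rewrite subKn ?(ltnW h) //; apply.
by move: h j0 {up down}; move: (index v s') (index w s') => k1 k2; lia0.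
Qed.

End Inner.

Lemma noncyclic_system : exists x y rep, fan_system L x y rep /\ exists e : V -> K,
  [/\ forall z, e z != 0%R, forall z, z != x -> z != y -> center L x rep z z != e z
    & forall v z, v != x -> v != y -> z != v ->
      center L x rep v z != 0%R -> center L x rep v z = e z].
Proof.
have [x [y [xy nx ny ess hs]]] := two_ends.
pose P v := [pred s | xyfan L x y s & v \in s].
have [f hf] : exists f : V -> seq V, forall v, v != x -> v != y -> P v (f v).
  apply: (@fin_all_exists V (fun=> seq V) (fun v s => v != x -> v != y -> P v s)) => v.
  have [->|vx] := eqVneq v x; first by exists [::].
  have [->|vy] := eqVneq v y; first by exists [::].
  by have [s fs vs] := hs v vx vy; exists s => _ _; apply/andP.
(* [choose] depends only on the extension of [P v], so [rep] is constant on each fan. *)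
pose rep v := choose (P v) (f v).
have repP v : v != x -> v != y -> xyfan L x y (rep v) /\ v \in rep v.
  by move=> vx vy; apply/andP; exact: (chooseP (hf v vx vy)).
have sys : fan_system L x y rep.
  split=> // v w vx vy wx wy wv; have [fv vv] := repP v vx vy.
  have EP : P v =1 P w.
    move=> s /=; case: (boolP (xyfan L x y s)) => //= fs; apply/idP/idP => h.
      exact: (fans_meet nx ny ess fs fv h vv).
    exact: (fans_meet nx ny ess fs fv h wv).
  rewrite /rep (eq_choose EP); apply: choose_id; first exact: hf.
  by rewrite -EP; exact: hf.
exists x, y, rep; split=> //; apply: (center_compat primeL V5 sys).
  move=> v z vx vy zx zy vz; have [fz zz] := repP z zx zy.
  have [j hj Ej] := triplet_in_fan nx ny ess fz (trip_triplet (center_trip sys vx vy)) zz zx zy vz.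
  apply: (fs_rep sys) => //; apply: (tvec_supp fz hj); rewrite -Ej.
  by have [_ _ [_ hv _] _] := tripP (center_trip sys vx vy).
move=> v w z vx vy wx wy zE vz wz; apply: sp0_eq => //.
apply: (end_dir V5 _ (trip_triplet (center_trip sys vx vy)) (trip_triplet (center_trip sys wx wy))).
by case/orP: zE => /eqP->.
Qed.
End Noncyclic.

(** * The Lagrangian of a graph *)

Section GraphLagrangian.
Variables (V : finType).
Implicit Types (G H : sgraph V) (A B C : {set V}) (u w t : {ffun V -> K}) (a b v x y z : V).

Definition nbr_sum G u v := \big[addb/false]_z (adj G v z && (u z).1).

Definition ingraph G u := [forall v, (u v).2 == nbr_sum G u v].

Lemma nbsum_add G u w v : nbr_sum G (u + w)%R v = nbr_sum G u v (+) nbr_sum G w v.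
Proof.
rewrite /nbr_sum -big_split /=; apply: eq_bigr => z _; rewrite ffunE.
by case: (adj _ _ _); case: (u z) (w z) => [[] ?] [[] ?].
Qed.

Definition graph_space G := gather (ingraph G).

Lemma graph_spaceP G u : reflect (forall v, (u v).2 = nbr_sum G u v) (u \in graph_space G).
Proof.
rewrite mem_gather; last 2 first.
- apply/forallP=> v; rewrite ffunE /nbr_sum big1 // => z _; by rewrite ffunE andbF.
- move=> {}u w /forallP hu /forallP hw; apply/forallP=> v; rewrite nbsum_add ffunE.
  by rewrite -(eqP (hu v)) -(eqP (hw v)); case: (u v) (w v) => [? []] [? []].
by apply: (iffP forallP) => h v; apply/eqP.
Qed.

Lemma graph_iso G u w : u \in graph_space G -> w \in graph_space G ->
  \big[addb/false]_v sp (u v) (w v) = false.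
Proof.
move=> /graph_spaceP hu /graph_spaceP hw.
rewrite (eq_bigr (fun v => \big[addb/false]_z (adj G v z && ((u v).1 && (w z).1))
    (+) \big[addb/false]_z (adj G v z && ((u z).1 && (w v).1)))); last first.
  move=> v _; rewrite /sp hu hw /nbr_sum; congr (_ (+) _).
    by rewrite big_distrr /=; apply: eq_bigr => z _; rewrite andbCA.
  by rewrite big_distrl /=; apply: eq_bigr => z _; rewrite andbA.
rewrite big_split /= [X in _ (+) X]exchange_big /=.
set a := bigop _ _ _; set b := bigop _ _ _; suff -> : a = b by rewrite addbb.
by apply: eq_bigr => v _; apply: eq_bigr => z _; rewrite adj_sym.
Qed.

(** The first coordinates of the vectors [f a] form an identity matrix on [A], so these vectors are
    independent. *)
Lemma dim_triangular (U : {vspace {ffun V -> K}}) A (f : V -> {ffun V -> K}) :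
  (forall a, a \in A -> f a \in U) -> (forall a, a \in A -> (f a a).1) ->
  (forall a b, a \in A -> b \in A -> a != b -> (f a b).1 = false) -> #|A| <= \dim U.
Proof.
have [m] := ubnP #|A|; elim: m A U => // m IH A U hm h1 h2 h3.
have [->|[a aA]] := set_0Vmem A; first by rewrite cards0.
pose W := (U :&: gather (fun u => ~~ (u a).1))%VS.
have memW u : (u \in W) = (u \in U) && ~~ (u a).1.
  rewrite memv_cap mem_gather ?ffunE //.
  by move=> {}u w; rewrite ffunE; case: (u a) (w a) => [[] ?] [[] ?].
have cA := cardsD1 a A; rewrite aA in cA.
have hW : #|A :\ a| <= \dim W.
  apply: IH; first by move: hm; rewrite cA.
  - by move=> b; rewrite !inE memW => /andP[ba bA]; rewrite h1 // h3.
  - by move=> b; rewrite !inE => /andP[_ /h2].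
  - by move=> b c; rewrite !inE => /andP[_ bA] /andP[_ cA']; apply: h3.
rewrite cA add1n; apply: leq_ltn_trans hW _.
by apply: (dim_lt (a := f a)); rewrite ?capvSl ?h1 // memW h2 // andbF.
Qed.

Definition nvec G v : {ffun V -> K} := [ffun z => (z == v, adj G z v)].

Lemma nvec_in G v : nvec G v \in graph_space G.
Proof.
apply/graph_spaceP=> z; rewrite /nbr_sum ffunE /= (bigD1 v) //= big1 => [|y yv].
  by rewrite ffunE eqxx andbT addbF.
by rewrite ffunE /= (negbTE yv) andbF.
Qed.

Lemma graph_dim G : #|V| <= \dim (graph_space G).
Proof.
rewrite -cardsT; apply: (dim_triangular (f := nvec G)) => [a _|a _|a b _ _ ab].
- exact: nvec_in.
- by rewrite ffunE eqxx.
- by rewrite ffunE eq_sym (negbTE ab).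
Qed.

Definition graph_lag G : lagrangian V := Lagrangian (@graph_iso G) (graph_dim G).

(** The matrix of adjacencies between [A] and [B] has rank at most one. *)
Definition rectangle G A B := exists A' B' : {set V},
  forall x y, x \in A -> y \in B -> adj G x y = (x \in A') && (y \in B').

Notation delk := (fun=> (false, true) : K).

(** The box consists of the subsets of [A] in which each vertex of [B] has an even number of
    neighbours: the kernel of the cut matrix, of codimension at most one. *)
Lemma rectangle_dim G A B : [disjoint A & B] ->
  rectangle G A B -> #|A| <= (box_dim (graph_lag G) delk A (~: B)).+1.
Proof.
move=> dAB [A' [B' h]].
have [E|[a0]] := set_0Vmem (A :&: A').
  apply: leqW; apply: (dim_triangular (f := nvec G)) => [a aA|a _|a b _ _ ab].
  - apply/box_spaceP; split; first exact: nvec_in.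
    move=> v vA; rewrite ffunE; have -> : v == a = false by apply: contraNF vA => /eqP->.
    case: (boolP (v \in B)) => vB; last by rewrite inE vB; case: adj; [right|left].
    left; rewrite adj_sym h //; suff /negbTE-> : a \notin A' by [].
    by apply/negP=> aA'; move/setP/(_ a): E; rewrite !inE aA aA'.
  - by rewrite ffunE eqxx.
  - by rewrite ffunE eq_sym (negbTE ab).
rewrite inE => /andP[a0A a0A'].
rewrite (cardsD1 a0 A) a0A add1n ltnS.
apply: (dim_triangular (f := fun a => if a \in A' then (nvec G a + nvec G a0)%R else nvec G a)).
- move=> a; rewrite !inE => /andP[aa0 aA]; apply/box_spaceP; split.
    by case: ifP => _; rewrite ?rpredD ?nvec_in.
  move=> v vA; have va : (v == a) = false by apply: contraNF vA => /eqP->.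
  have va0 : (v == a0) = false by apply: contraNF vA => /eqP->.
  case: (boolP (v \in B)) => vB.
    left; case: ifP => aA'; rewrite !ffunE ?va ?va0 ![adj G v _]adj_sym !h //.
      by rewrite aA' a0A' /=; case: (v \in B').
    by rewrite aA'.
  rewrite inE vB; case: ifP => aA'; rewrite !ffunE ?va ?va0.
    by case: adj; case: adj; [left|right|right|left].
  by case: adj; [right|left].
- move=> a; rewrite !inE => /andP[/negbTE aa0 aA].
  by case: ifP => _; rewrite !ffunE eqxx // aa0.
- move=> a b; rewrite !inE => /andP[aa0 aA] /andP[/negbTE ba0 bA] ab.
  by case: ifP => _; rewrite !ffunE eq_sym (negbTE ab) // ba0.
Qed.

(** Two distinct nonzero columns of the cut matrix would be two independent conditions on the
    subsets of [A], lowering the dimension by two. *)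
Lemma dim_rectangle G A B : [disjoint A & B] ->
  #|A| <= (box_dim (graph_lag G) delk A (~: B)).+1 -> rectangle G A B.
Proof.
move=> dAB hp.
have pM : box_dim (graph_lag G) delk A setT = #|A|.
  have := @box_dim_dual _ (graph_lag G) delk A setT (fun=> isT) (subsetT A).
  suff -> : box_dim (graph_lag G) delk (~: setT) (~: A) = 0 by rewrite cardsT; lia0.
  apply/eqP; rewrite /box_dim dimv_eq0 -subv0; apply/subvP=> u /box_spaceP[/graph_spaceP hu h].
  have u1 z : (u z).1 = false by case: (h z) => [|->|[_ ->]]; rewrite ?inE.
  rewrite memv0; apply/eqP/ffunP=> z; rewrite ffunE.
  have : (u z).2 = false by rewrite hu /nbr_sum big1 // => y _; rewrite u1 andbF.
  by have := u1 z; case: (u z) => ? ? /= -> ->.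
pose R b := [set a in A | adj G a b].
have same b1 b2 : b1 \in B -> b2 \in B -> R b1 != set0 -> R b2 != set0 -> R b1 \subset R b2.
  move=> b1B b2B n1 n2; apply: contraT => /subsetPn[a1 a1R a1R2].
  have bA b : b \in B -> b \notin A.
    by move=> bB; apply/negP=> bA; move/disjointFr: dAB => /(_ _ bA); rewrite bB.
  move: a1R a1R2; rewrite !inE => /andP[a1A a11]; rewrite a1A /= => a12.
  have vecM a : a \in A -> nvec G a \in box_space (graph_lag G) delk A setT.
    move=> aA; apply/box_spaceP; split; first exact: nvec_in.
    move=> v vA; rewrite ffunE; have -> : v == a = false by apply: contraNF vA => /eqP->.
    by rewrite inE; case: adj; [right|left].
  have inU (D : {set V}) u : u \in box_space (graph_lag G) delk A setT -> D \subset B ->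
      (u \in box_space (graph_lag G) delk A (~: D)) = [forall b in D, ~~ (u b).2].
    move=> /box_spaceP[uL hu] sD; apply/box_spaceP/forall_inP => [[_ h] b bD|h].
      case: (h b (bA _ (subsetP sD _ bD))) => [->//|[]]; by rewrite inE bD.
    split=> // v vA; case: (hu v vA) => [->|[_ E]]; first by left.
    right; split=> //; rewrite inE; apply/negP=> /h; by rewrite E.
  have sub (D D' : {set V}) : D \subset D' ->
      (box_space (graph_lag G) delk A (~: D') <= box_space (graph_lag G) delk A (~: D))%VS.
    by move=> sD; apply: box_space_sub => //; [rewrite setCS | right].
  have sM (D : {set V}) : (box_space (graph_lag G) delk A (~: D) <= box_space (graph_lag G) delk A setT)%VS.
    by rewrite -(setC0 V); apply: sub; exact: sub0set.
  have l1 : box_dim (graph_lag G) delk A (~: B) <= box_dim (graph_lag G) delk A (~: [set b1; b2]).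
    by apply/dimvS/sub/subsetP=> z; rewrite !inE => /orP[]/eqP->.
  have sb : [set b1; b2] \subset B by apply/subsetP=> z; rewrite !inE => /orP[]/eqP->.
  have sb2 : [set b2] \subset B by rewrite sub1set.
  have l2 : box_dim (graph_lag G) delk A (~: [set b1; b2]) < box_dim (graph_lag G) delk A (~: [set b2]).
    apply: (box_dim_lt (t := nvec G a1)).
    - by apply/sub/subsetP=> z; rewrite !inE => /eqP->; rewrite eqxx orbT.
    - rewrite inU ?vecM //; apply/forall_inP=> b; rewrite inE => /eqP->.
      by rewrite ffunE adj_sym.
    - rewrite inU ?vecM //; apply/negP=> /forall_inP/(_ b1); rewrite !inE eqxx => /(_ isT).
      by rewrite ffunE adj_sym a11.
  have l3 : box_dim (graph_lag G) delk A (~: [set b2]) < box_dim (graph_lag G) delk A setT.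
    case/set0Pn: n2 => a2; rewrite inE => /andP[a2A a22].
    apply: (box_dim_lt (t := nvec G a2)); [exact: sM|exact: vecM|].
    rewrite inU ?vecM //; apply/negP=> /forall_inP/(_ b2); rewrite !inE eqxx => /(_ isT).
    by rewrite ffunE adj_sym a22.
  by move: hp pM l1 l2 l3; lia0.
case: (boolP [exists b in B, R b != set0]) => [/existsP[b /andP[bB nb]]|].
  exists (R b), [set c in B | R c != set0] => x z xA zB; rewrite !inE xA zB /=.
  case: (boolP (R z != set0)) => nz; rewrite ?andbT ?andbF.
    have /setP/(_ x) : R z = R b by apply/eqP; rewrite eqEsubset !same.
    by rewrite !inE xA.
  apply/negP=> xz; move: nz; rewrite negbK => /eqP/setP/(_ x).
  by rewrite !inE xA xz.
rewrite negb_exists => /forallP h; exists set0, set0 => x z xA zB; rewrite !inE.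
have := h z; rewrite zB negbK /= => /eqP/setP/(_ x); by rewrite !inE xA.
Qed.
End GraphLagrangian.

(** * Coordinatewise automorphisms and local complementation *)

Section Twists.
Variables (V : finType).
Implicit Types (G H : sgraph V) (A B C : {set V}) (u w t : {ffun V -> K}) (a b v x y z : V)
  (L : lagrangian V).

Definition additive_inj (f : K -> K) := (forall k l, f (k + l)%R = (f k + f l)%R) /\ injective f.

Lemma additive_inj0 f : additive_inj f -> f 0%R = 0%R.
Proof. by case=> fD _; apply: (addrI (f 0%R)); rewrite -fD !addr0. Qed.

Lemma additive_inj_eq0 f k : additive_inj f -> (f k == 0%R) = (k == 0%R).
Proof. by move=> hf; rewrite -{1}(additive_inj0 hf) (inj_eq hf.2). Qed.

Lemma additive_inj_onto f k : additive_inj f -> exists l, f l = k.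
Proof.
case=> _ /injF_bij[g _ fg]; exists (g k); exact: fg.
Qed.

Definition twist (s : V -> K -> K) u : {ffun V -> K} := [ffun v => s v (u v)].

Definition twisted (s : V -> K -> K) L L' :=
  (forall v, additive_inj (s v)) /\ forall u, (twist s u \in L') = (u \in L).

Lemma twist_inj s : (forall v, additive_inj (s v)) -> injective (twist s).
Proof.
move=> hs u w /ffunP h; apply/ffunP=> v; apply: (hs v).2.
by have := h v; rewrite !ffunE.
Qed.

Lemma twist_onto s u : (forall v, additive_inj (s v)) -> exists w, twist s w = u.
Proof.
move=> hs; have [g _ fg] := injF_bij (twist_inj hs); exists (g u); exact: fg.
Qed.

Lemma twist_linear s : (forall v, additive_inj (s v)) -> linear (twist s).
Proof.
move=> hs c u w; apply/ffunP=> v; rewrite !ffunE (hs v).1; congr (_ + _)%R.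
by case: c; rewrite ?scale1r ?scale0r ?(additive_inj0 (hs v)).
Qed.

Lemma twist_dim s (U W : {vspace {ffun V -> K}}) : (forall v, additive_inj (s v)) ->
  (forall u, (twist s u \in W) = (u \in U)) -> \dim U = \dim W.
Proof.
move=> hs h.
pose f : {linear {ffun V -> K} -> {ffun V -> K}} :=
  HB.pack (twist s) (GRing.isLinear.Build _ _ _ _ (twist s) (twist_linear hs)).
rewrite -(limg_ker_dim (linfun f) U).
have -> : (U :&: lker (linfun f) = 0)%VS.
  apply/eqP; rewrite -subv0; apply/subvP=> u; rewrite memv_cap memv_ker lfunE /= memv0 => /andP[_ /eqP E].
  apply/eqP/(twist_inj hs); rewrite E; apply/ffunP=> v.
  by rewrite !ffunE (additive_inj0 (hs v)).
rewrite dimv0 add0n; congr (\dim _); apply/vspaceP=> u; apply/memv_imgP/idP.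
  by case=> w wU ->; rewrite lfunE /= h.
by have [w <-] := twist_onto u hs; rewrite h => wU; exists w => //; rewrite lfunE.
Qed.

Section Twisted.
Variables (s : V -> K -> K) (L L' : lagrangian V).
Hypothesis tws : twisted s L L'.

Let hs := tws.1.

Lemma twist_eq0 u v : (twist s u v == 0%R) = (u v == 0%R).
Proof. by rewrite ffunE additive_inj_eq0. Qed.

Lemma twist_box_dim e A C : box_dim L' (fun v => s v (e v)) A C = box_dim L e A C.
Proof.
apply/esym; apply: (twist_dim hs) => u; apply/box_spaceP/box_spaceP; rewrite tws.2 => -[uL h]; split=> // v vA.
  case: (h v vA) => [/eqP|[vC]]; first by rewrite twist_eq0 => /eqP; left.
  by rewrite ffunE => /(hs v).2; right.
case: (h v vA) => [/eqP|[vC E]].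
  by rewrite -twist_eq0 => /eqP; left.
by right; rewrite ffunE E.
Qed.

Lemma twist_set_dim A : set_dim L' A = set_dim L A.
Proof. by rewrite -(set_dimE L' (fun v => s v (true, true))) (twist_box_dim (fun=> (true, true))). Qed.

Lemma twist_prime : prime_lagrangian L -> prime_lagrangian L'.
Proof. by move=> h A; rewrite twist_set_dim; apply: h. Qed.

Lemma twist_nonprime v k : nonprime_dir L' v (s v k) = nonprime_dir L v k.
Proof.
apply: eq_existsb => A; rewrite /split_at; congr [&& _, _, _ & _].
rewrite -(twist_box_dim (fun=> k)); congr (_ <= (_).+1); apply: box_dim_eq => z.
by rewrite !inE => /orP[/eqP->//|->].
Qed.

Lemma twist_essential v : essential L' v -> essential L v.
Proof.
case/existsP=> k' /existsP[l' /and5P[]].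
have [[k <-] [l <-]] := (additive_inj_onto k' (hs v), additive_inj_onto l' (hs v)).
rewrite !additive_inj_eq0 // (inj_eq (hs v).2) !twist_nonprime => k0 l0 kl nk nl.
by apply/existsP; exists k; apply/existsP; exists l; rewrite k0 l0 kl nk.
Qed.
End Twisted.

Lemma twisted_comp s1 s2 L1 L2 L3 : twisted s1 L1 L2 -> twisted s2 L2 L3 ->
  twisted (fun v => s2 v \o s1 v) L1 L3.
Proof.
move=> [h1 m1] [h2 m2]; split=> [v|u].
  split=> [k l|k l] /=; first by rewrite (h1 v).1 (h2 v).1.
  by move=> E; apply: (h1 v).2; apply: (h2 v).2.
rewrite -m1 -m2; suff -> : twist (fun v => s2 v \o s1 v) u = twist s2 (twist s1 u) by [].
by apply/ffunP=> v; rewrite !ffunE.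
Qed.

Lemma twisted_id L : twisted (fun=> id) L L.
Proof.
split=> [v|u]; first by split.
by suff -> : twist (fun=> id) u = u by []; apply/ffunP=> v; rewrite ffunE.
Qed.

(** Complementing at [v] toggles [v] in [X] when [v] has an odd number of neighbours in [X]; the
    parity then changes exactly at the neighbours of [v] that are in [X]. *)
Definition lc_twist G v z (k : K) : K :=
  if z == v then (k.1 (+) k.2, k.2) else if adj G v z then (k.1, k.2 (+) k.1) else k.

Lemma lc_twist_inj G v z : additive_inj (lc_twist G v z).
Proof.
rewrite /lc_twist; split=> [k l|k l]; case: (z == v); case: (adj G v z);
  by case: k l => [[] []] [[] []].
Qed.

Lemma adj_lc G v z : adj (local_compl G v) v z = adj G v z.
Proof. by rewrite /= /local_compl_rel adj_irrefl andbF addbF. Qed.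

Lemma lc_lc G v : adj (local_compl (local_compl G v) v) =2 adj G.
Proof.
move=> y z; rewrite /= /local_compl_rel -/(local_compl_rel G v) !adj_lc /= /local_compl_rel.
by rewrite -addbA addbb addbF.
Qed.

Lemma lc_twist_in G v u : u \in graph_space G ->
  twist (lc_twist G v) u \in graph_space (local_compl G v).
Proof.
move=> /graph_spaceP hu; apply/graph_spaceP=> z.
(* The terms are the old summand, the neighbours of [v], the toggled [v] and the excluded [y = z];
   after summation the second and third cancel. *)
have E y : adj (local_compl G v) z y && (twist (lc_twist G v) u y).1 =
  (adj G z y && (u y).1) (+) ((adj G v z && (adj G v y && (u y).1)) (+)
   ((y == v) && (adj G v z && (u v).2) (+) ((y == z) && (adj G v z && (u z).1)))).
  rewrite /= /local_compl_rel ffunE /lc_twist eq_sym.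
  have [->|yv] := eqVneq y v.
    rewrite adj_irrefl !andbF addbF /= [adj G v z]adj_sym eq_sym.
    have [->|zv] := eqVneq z v; first by rewrite adj_irrefl.
    by rewrite /= addbF andb_addr.
  have -> : (if adj G v y then ((u y).1, (u y).2 (+) (u y).1) else u y).1 = (u y).1 by case: ifP.
  have [->|yz] := eqVneq y z; first by rewrite adj_irrefl; case: adj; case: (u z).1.
  by rewrite /= !addbF andb_addl andbA.
have -> : nbr_sum (local_compl G v) (twist (lc_twist G v) u) z = _ := eq_bigr _ (fun y _ => E y).
rewrite !big_split /= -/(nbr_sum G u z) -(hu z).
have -> : \big[addb/false]_y (adj G v z && (adj G v y && (u y).1)) = adj G v z && (u v).2.
  by rewrite hu /nbr_sum big_distrr.
have pick1 (y0 : V) (c : bool) : \big[addb/false]_y ((y == y0) && c) = c.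
  rewrite (bigD1 y0) //= eqxx big1 ?addbF // => y /negbTE->; by [].
rewrite !pick1 (addbA (_ && (u v).2)) addbb /= ffunE /lc_twist.
have [->|zv] := eqVneq z v; first by rewrite adj_irrefl addbF.
by case: ifP => _ //=; rewrite addbF.
Qed.

Lemma eq_graph_space G H u : adj G =2 adj H -> (u \in graph_space G) = (u \in graph_space H).
Proof.
move=> E; apply/graph_spaceP/graph_spaceP => h v; rewrite h; apply: eq_bigr => z _;
  by rewrite E.
Qed.

Lemma lc_twisted G v : twisted (lc_twist G v) (graph_lag G) (graph_lag (local_compl G v)).
Proof.
split=> [z|u]; first exact: lc_twist_inj.
apply/idP/idP => [h|]; last exact: lc_twist_in.
have := lc_twist_in v h; rewrite (eq_graph_space _ (lc_lc G v)).
suff -> : twist (lc_twist (local_compl G v) v) (twist (lc_twist G v) u) = u by [].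
apply/ffunP=> z; rewrite !ffunE /lc_twist adj_lc; case: (z == v); case: (adj G v z) => //;
  by case: (u z) => [[] []].
Qed.

Lemma lc_seq_twisted G s : exists f, twisted f (graph_lag G) (graph_lag (foldl (@local_compl V) G s)).
Proof.
elim: s G => [|v s IH] G /=.
  by exists (fun=> id); apply: twisted_id.
by have [f hf] := IH (local_compl G v); exists (fun z => f z \o lc_twist G v z);
  apply: twisted_comp hf; apply: lc_twisted.
Qed.

Lemma locally_equivalent_twisted G H : locally_equivalent G H ->
  exists f, twisted f (graph_lag G) (graph_lag H).
Proof.
case=> s E; have [f [hf h]] := lc_seq_twisted G s; exists f; split=> // u.
by rewrite -h; apply: eq_graph_space.
Qed.

(* A vertex [v] is bad if [e v != (0, 1)]. If [e v = (1, 1)], complementing at [v] repairs it;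
   if two bad vertices are adjacent, complementing at both repairs the second one; otherwise
   the vector of [[set v]] contradicts the second hypothesis. *)
Lemma presentation G (e : V -> K) : (forall v, e v != 0%R) ->
  (forall u, u \in graph_lag G -> (forall v, u v = 0%R \/ u v = e v) -> u = 0%R) ->
  exists s f, twisted f (graph_lag G) (graph_lag (foldl (@local_compl V) G s)) /\
    forall v, f v (e v) = (false, true).
Proof.
have [m] := ubnP #|[set v | e v != (false, true)]|.
elim: m G e => // m IH G e hm e0 he.
have step s f (e' : V -> K) : twisted f (graph_lag G) (graph_lag (foldl (@local_compl V) G s)) ->
    (forall v, e' v = f v (e v)) ->
    #|[set v | e' v != (false, true)]| < #|[set v | e v != (false, true)]| ->
    exists s f, twisted f (graph_lag G) (graph_lag (foldl (@local_compl V) G s)) /\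
      forall v, f v (e v) = (false, true).
  move=> hf he' lt.
  have [|||s2 [f2 [hf2 h2]]] := IH (foldl (@local_compl V) G s) e'.
  - exact: leq_trans lt _.
  - by move=> v; rewrite he' additive_inj_eq0 //; case: hf.
  - move=> u'; have [u <-] := twist_onto u' hf.1; rewrite hf.2 => uL h.
    have -> : u = 0%R.
      apply: he => // v; case: (h v) => [/eqP|]; first by rewrite (twist_eq0 hf) => /eqP; left.
      by rewrite ffunE he' => /(hf.1 v).2; right.
    apply/ffunP=> v; rewrite !ffunE additive_inj0 //; exact: hf.1.
  exists (s ++ s2), (fun v => f2 v \o f v); rewrite foldl_cat; split.
    exact: twisted_comp hf hf2.
  by move=> v; rewrite /= -he' h2.
(* Complementing at [v] spoils [(0, 1)] at [v] only, so complementing at bad vertices leaves the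
   good ones good. *)
have keep G' v z : lc_twist G' v z (false, true) = (false, true) \/ z = v.
  by rewrite /lc_twist; case: eqVneq => [|_]; [right|left; case: ifP].
have lt_of (e' : V -> K) v : e v != (false, true) -> e' v = (false, true) ->
    (forall z, e z = (false, true) -> e' z = (false, true)) ->
    #|[set v | e' v != (false, true)]| < #|[set v | e v != (false, true)]|.
  move=> ev ev' h; apply: proper_card; apply/properP; split.
    apply/subsetP=> z; rewrite !inE; apply: contra => /eqP E; by rewrite h.
  by exists v; rewrite inE // ev' eqxx.
have [/existsP[v /eqP ev]|] := boolP [exists v, e v == (true, true)].
  apply: (step [:: v] (lc_twist G v) (fun z => lc_twist G v z (e z))) => //.
    exact: lc_twisted.
  apply: (lt_of _ v); rewrite ?ev //; first by rewrite /lc_twist eqxx.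
  by move=> z ez; rewrite ez; case: (keep G v z) => // E; rewrite E ev in ez.
rewrite negb_exists => /forallP no11.
have bad v : e v != (false, true) -> e v = (true, false).
  by move: (e0 v) (no11 v); case: (e v) => [[] []].
have [/existsP[v /existsP[w /and3P[bv bw vw]]]|] :=
  boolP [exists v, exists w, [&& e v != (false, true), e w != (false, true) & adj G v w]].
  have nvw : w != v by apply: contraTneq vw => ->; rewrite adj_irrefl.
  pose f z := lc_twist (local_compl G v) w z \o lc_twist G v z.
  apply: (step [:: v; w] f (fun z => f z (e z))) => //.
    by apply: twisted_comp (lc_twisted _ _) (lc_twisted _ _).
  apply: (lt_of _ w bw).
    by rewrite /f /= (bad w bw) /lc_twist (negbTE nvw) vw eqxx.
  move=> z ez; rewrite /f /= ez; have [->|E] := keep G v z; last by rewrite -E ez in bv.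
  by have [->|E] := keep (local_compl G v) w z; last by rewrite -E ez in bw.
rewrite negb_exists => /forallP indep.
exists [::], (fun=> id); split; first exact: twisted_id.
move=> v; apply/eqP; apply: contraT => bv; have ev := bad v bv.
have /ffunP/(_ v) : nvec G v = 0%R; last by rewrite !ffunE eqxx.
apply: he; first exact: nvec_in.
move=> z; rewrite ffunE; have [->|zv] := eqVneq z v; first by rewrite ev adj_irrefl; right.
have [zv'|] := boolP (adj G z v); last by left.
right; apply/esym/eqP; apply: contraT => bz.
have := indep v; rewrite negb_exists => /forallP/(_ z).
by rewrite bv bz adj_sym zv'.
Qed.

End Twists.

(** * Primality and the three reductions of a graph *)

Section Splits.
Variables (V : finType).
Implicit Types (G H : sgraph V) (A B C : {set V}) (v : V).

Lemma prime_graphPn G : reflect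
  (exists A : {set V}, [/\ 2 <= #|A|, 2 <= #|~: A| & rectangle G A (~: A)]) (~~ prime_graph G).
Proof.
rewrite /prime_graph negbK; apply: (iffP existsP) => [[A /existsP[B]]|[A [hA hB [A' [B' h]]]]].
  case/and4P=> /eqP AB dAB; rewrite leq_min => /andP[hA hB] /existsP[A' /existsP[B' /and3P[_ _]]].
  have EB : B = ~: A.
    apply/setP=> z; rewrite inE; have := disjointFr dAB (x := z); move/setP/(_ z): AB; rewrite !inE.
    by case: (z \in A) => //= _ /(_ isT).
  rewrite EB in hB *; move/forall_inP=> h; exists A; split=> //.
  by exists A', B' => x y xA yB; apply/eqP; move/forall_inP: (h x xA); apply.
exists A; apply/existsP; exists (~: A); rewrite /is_split setUCr eqxx leq_min hA hB /=.
apply/andP; split; first by rewrite -setI_eq0 setICr.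
apply/existsP; exists (A :&: A'); apply/existsP; exists (~: A :&: B').
rewrite !subsetIl /=; apply/forall_inP=> x xA; apply/forall_inP=> y yB.
by rewrite h // !inE xA /=; move: yB; rewrite inE => ->.
Qed.

End Splits.

Section Reductions.
Variables (V : finType).
Implicit Types (G H : sgraph V) (A B C : {set V}) (v : V).

Lemma prime_lagrangianP G : prime_graph G <-> prime_lagrangian (graph_lag G).
Proof.
have rect A : rectangle G A (~: A) <-> #|A| <= (set_dim (graph_lag G) A).+1.
  have d : [disjoint A & ~: A] by rewrite -setI_eq0 setICr.
  rewrite -(set_dimE _ (fun=> (false, true))) -[X in box_dim _ _ A X]setCK.
  by split; [apply: rectangle_dim | apply: dim_rectangle].
split=> [pG A hA hB|pL].
  rewrite leqNgt; apply/negP=> h; move: pG; apply/negP/prime_graphPn; exists A; split=> //.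
  by apply/rect; move: h; lia0.
apply: contraT => /prime_graphPn[A [hA hB /rect]]; have := pL A hA hB; lia0.
Qed.

Lemma delete_prime G v : prime_graph (delete G v) = ~~ nonprime_dir (graph_lag G) v (false, true).
Proof.
apply/negb_inj; rewrite negbK.
apply/idP/idP => [/prime_graphPn[A [hA hB [A' [B' h]]]]|/existsP[A /and4P[vA hA hB hp]]].
  apply/existsP; exists (val @: A).
  have vA : v \notin val @: A.
    by apply/imsetP=> -[[z zv] _ /= Ez]; rewrite Ez eqxx in zv.
  have EB : ~: (v |: val @: A) = val @: (~: A).
    apply/setP=> z; rewrite !inE negb_or; apply/andP/imsetP => [[zv zA]|[z' z'A ->]].
      exists (Sub z zv) => //; rewrite inE; apply: contra zA => zA.
      by apply/imsetP; exists (Sub z zv).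
    split; first exact: (valP z').
    by rewrite mem_imset; [rewrite inE in z'A | apply: val_inj].
  have dAB : [disjoint val @: A & val @: (~: A)].
    by rewrite -EB -setI_eq0 -subset0; apply/subsetP=> z; rewrite !inE => /andP[-> ]; rewrite orbT.
  apply/and4P; split=> //; rewrite ?EB ?card_imset //; try exact: val_inj.
  rewrite -(card_imset A val_inj); have := rectangle_dim dAB; rewrite -EB setCK; apply.
  exists (val @: A'), (val @: B') => x y /imsetP[x' xA ->]; rewrite EB => /imsetP[y' yB ->].
  by rewrite !mem_imset; [exact: (h x' y' xA yB) | apply: val_inj | apply: val_inj].
have dAB : [disjoint A & ~: (v |: A)].
  by rewrite -setI_eq0 -subset0; apply/subsetP=> z; rewrite !inE => /andP[->]; rewrite orbT.
have [A' [B' h]] : rectangle G A (~: (v |: A)) by apply: dim_rectangle; rewrite ?setCK.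
pose S (X : {set V}) := [set z : {z : V | z != v} | val z \in X].
have cS (X : {set V}) : v \notin X -> #|S X| = #|X|.
  move=> vX; rewrite -(card_imset (S X) val_inj); congr #|pred_of_set _|; apply/setP=> z.
  apply/imsetP/idP => [[z' + ->]|zX]; first by rewrite inE.
  have zv : z != v by apply: contraNneq vX => <-.
  by exists (Sub z zv); rewrite // inE.
have ES : ~: S A = S (~: (v |: A)).
  by apply/setP=> z; rewrite !inE negb_or (valP z).
apply/prime_graphPn; exists (S A); split; first by rewrite cS.
  by rewrite ES cS // !inE eqxx.
exists (S A'), (S B') => x y; rewrite ES !inE => xA yB.
by rewrite /= h // !inE.
Qed.

Lemma delete_lc_prime G v :
  prime_graph (delete (local_compl G v) v) = ~~ nonprime_dir (graph_lag G) v (true, true).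
Proof.
by rewrite delete_prime -(twist_nonprime (lc_twisted G v)) /lc_twist eqxx.
Qed.

(** The three complementations of the pivot carry the entry [(1, 0)] at [v] to [(1, 0)], [(1, 1)]
    and finally [(0, 1)], the direction of deletion. An isolated [v] would give a vector with
    support of size one. *)
Lemma contract_prime G v : prime_lagrangian (graph_lag G) -> 5 <= #|V| ->
  prime_graph (contract G v) = ~~ nonprime_dir (graph_lag G) v (true, false).
Proof.
move=> pL V5; rewrite /contract; case: pickP => [w vw|h].
  have nwv : v != w by apply: contraTneq vw => ->; rewrite adj_irrefl.
  have wv : adj (local_compl G v) w v by rewrite adj_sym adj_lc.
  rewrite delete_prime; congr (~~ _).
  rewrite -[RHS](twist_nonprime (lc_twisted G v)) -[RHS](twist_nonprime (lc_twisted _ w)).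
  have -> : lc_twist G v v (true, false) = (true, false) by rewrite /lc_twist eqxx.
  have -> : lc_twist (local_compl G v) w v (true, false) = (true, true).
    by rewrite /lc_twist (negbTE nwv) wv.
  by rewrite -[RHS](twist_nonprime (lc_twisted _ v)) /lc_twist eqxx.
have n0 : nvec G v != 0%R by apply/eqP=> /ffunP/(_ v); rewrite !ffunE eqxx.
have := supp_ge3 pL (ltnW V5) (nvec_in G v) n0.
have -> : supp (nvec G v) = [set v].
  apply/setP=> z; rewrite in_supp ffunE inE adj_sym h.
  by case: (z == v).
by rewrite cards1.
Qed.

Lemma non_essentialE G v : prime_lagrangian (graph_lag G) -> 5 <= #|V| ->
  non_essential G v = ~~ essential (graph_lag G) v.
Proof.
move=> pL V5; rewrite /non_essential delete_prime delete_lc_prime contract_prime //.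
apply/idP/negP => [h /existsP[k /existsP[l /and5P[]]]|].
  move: h; case: k l => [[] []] [[] []] //= + _ _ _ nk nl; rewrite nk nl;
  by case: (nonprime_dir _ _ _).
move=> h; apply: contraT => h'; exfalso; apply: h; move: h'.
have W k l : k != 0%R -> l != 0%R -> k != l -> nonprime_dir (graph_lag G) v k ->
    nonprime_dir (graph_lag G) v l -> essential (graph_lag G) v.
  by move=> *; apply/existsP; exists k; apply/existsP; exists l; apply/and5P.
case: (boolP (nonprime_dir _ _ (false, true))) => h1;
  case: (boolP (nonprime_dir _ _ (true, true))) => h2;
  case: (boolP (nonprime_dir _ _ (true, false))) => h3 // _.
- exact: (W _ _ _ _ _ h1 h2).
- exact: (W _ _ _ _ _ h1 h2).
- exact: (W _ _ _ _ _ h1 h3).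
- exact: (W _ _ _ _ _ h2 h3).
Qed.
End Reductions.

(** * Path bundles *)

Section Bundles.
Variables (V : finType).
Implicit Types (G H : sgraph V) (u t : {ffun V -> K}) (a b v w x y z : V) (p s : seq V) (i : nat).

Lemma infix2P x0 a b p :
  reflect (exists i, [/\ i.+1 < size p, nth x0 p i = a & nth x0 p i.+1 = b]) (infix [:: a; b] p).
Proof.
apply: (iffP (@infixP V [:: a; b] p)) => [[s1 [s2 ->]]|[i [hi <- <-]]].
  exists (size s1); split.
  - by rewrite !size_cat /=; move: (size s1) (size s2) => k1 k2; lia0.
  - by rewrite !nth_cat ltnn subnn.
  - by rewrite nth_cat ltnNge leqnSn /= subSnn.
exists (take i p), (drop i.+2 p); rewrite -[LHS](cat_take_drop i); congr (_ ++ _).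
by rewrite (drop_nth x0) ?(ltnW hi) // (drop_nth x0 hi).
Qed.

Lemma system_graph G x y rep (e : V -> K) : prime_lagrangian (graph_lag G) -> 5 <= #|V| ->
  fan_system (graph_lag G) x y rep -> (forall z, e z != 0%R) ->
  (forall z, z != x -> z != y -> center (graph_lag G) x rep z z != e z) ->
  (forall v z, v != x -> v != y -> z != v -> center (graph_lag G) x rep v z != 0%R ->
     center (graph_lag G) x rep v z = e z) ->
  exists H, [/\ locally_equivalent G H, prime_lagrangian (graph_lag H) & forall v z, v != x -> v != y ->
    adj H v z = (z == nth x (rep v) (index v (rep v)).-1) ||
      (z == nth x (rep v) (index v (rep v)).+1)].
Proof.
move=> pG V5 sys e0 ec eo.
have [|s [f [hf fe]]] := presentation (G := G) e0.
  (* A vector with entries in [{0, e}] pairs with the triplet centred at an inner [v] at most at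
     [v], where the directions differ. So it vanishes at [v], and only [x] and [y] remain. *)
  move=> u uL hu; apply: (two_zero pG V5 (a := x) (b := y) uL) => v vx vy.
  have [cL _ [_ cv _] _] := tripP (center_trip sys vx vy).
  case: (hu v) => // Euv; exfalso.
  have := iso1 (b := v) uL cL; rewrite spE Euv e0 cv eq_sym ec //= => h.
  suff: true = false by []; apply: h => z zv.
  have [->|cz] := eqVneq (center (graph_lag G) x rep v z) 0%R; first by rewrite spC sp0.
  by case: (hu z) => ->; rewrite ?sp0 // (eo v) // spE eqxx !andbF.
exists (foldl (@local_compl V) G s); split; [by exists s | exact: (twist_prime hf) |].
set H := foldl _ _ _ in hf *; move=> v z vx vy.
have [cL [c1 _ c2] [_ cv _] co] := tripP (center_trip sys vx vy).
set c := center (graph_lag G) x rep v in cL cv co.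
set a := nth x _ _ in c1 co *; set b := nth x _ _ in c2 co *.
have tL : twist f c \in graph_lag H by rewrite hf.2.
(* Away from [v] the entry is zero or [e], which [f] sends to [(0, 1)]; at [v] it is nonzero and not
   [e v], so its image has first coordinate one. *)
have t1 y' : (twist f c y').1 = (y' == v).
  have [->|yv] := eqVneq y' v.
    have := ec v vx vy; rewrite -/c -(inj_eq (hf.1 v).2) fe => n1.
    have : twist f c v != 0%R by rewrite (twist_eq0 hf).
    by rewrite ffunE; move: n1; case: (f v (c v)) => [[] []].
  rewrite ffunE; have [->|cy] := eqVneq (c y') 0%R; first by rewrite (additive_inj0 (hf.1 y')).
  by rewrite /c eo // fe.
have adjE z' : (twist f c z').2 = adj H z' v.
  move/graph_spaceP: tL => ->; rewrite /nbr_sum (bigD1 v) //= t1 eqxx andbT big1 ?addbF // => y' yv.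
  by rewrite t1 (negbTE yv) andbF.
rewrite adj_sym -adjE; have [->|zv] := eqVneq z v.
  by rewrite adjE adj_irrefl eq_sym (negbTE c1) (negbTE c2).
have -> : (twist f c z).2 = (c z != 0%R).
  rewrite -(twist_eq0 hf); move: (t1 z); rewrite (negbTE zv).
  by case: (twist f c z) => [[] []].
apply/idP/idP => [|/orP[]/eqP->].
- by apply: contraR; rewrite negb_or => /andP[za zb]; rewrite co.
- by have [_ _ []] := tripP (center_trip sys vx vy).
- by have [_ _ []] := tripP (center_trip sys vx vy).
Qed.

Lemma system_bundle L H x y rep : prime_lagrangian (graph_lag H) -> 5 <= #|V| ->
  fan_system L x y rep ->
  (forall v z, v != x -> v != y ->
    adj H v z = (z == nth x (rep v) (index v (rep v)).-1) ||
      (z == nth x (rep v) (index v (rep v)).+1)) ->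
  is_path_bundle H x y /\ no_common_neighbor H x y.
Proof.
move=> pH V5 sys hadj; have xy := fs_xy sys.
have fpath v : v != x -> v != y -> exists n,
    [/\ size (rep v) = n.+1, 3 <= n, uniq (rep v), nth x (rep v) 0 = x & nth x (rep v) n = y].
  move=> vx vy; have [/and3P[/and3P[us cs s4] /eqP h0 /eqP hl] vs] := fs_fan sys vx vy.
  exists (size (rep v)).-1; rewrite nth_last; split=> //; move: s4;
    move: (size (rep v)) => k; lia0.
have pos w i : w != x -> w != y -> 0 < i -> i.+1 < size (rep w) ->
    [/\ nth x (rep w) i != x, nth x (rep w) i != y, rep (nth x (rep w) i) = rep w
      & index (nth x (rep w) i) (rep w) = i].
  move=> wx wy i0 iN; have [n [hs n3 us h0 hn]] := fpath w wx wy.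
  have hx : nth x (rep w) i != x.
    by rewrite -[X in _ != X]h0 nth_uniq ?hs // -?hs ?(ltnW iN) // -lt0n.
  have hy : nth x (rep w) i != y.
    by rewrite -hn nth_uniq ?hs // -?hs ?(ltnW iN) // ltn_eqF // -ltnS -hs.
  split=> //; last by rewrite index_uniq // ltnW.
  by apply: (fs_rep sys) => //; apply: mem_nth; apply: ltnW.
have edge w i : w != x -> w != y -> i.+1 < size (rep w) ->
    adj H (nth x (rep w) i) (nth x (rep w) i.+1).
  move=> wx wy iN; have [n [hs n3 us h0 hn]] := fpath w wx wy.
  have [i0|i0] := posnP i.
    have h2 : 1.+1 < size (rep w) by rewrite hs ltnS ltnW.
    have [p1 p2 p3 p4] := pos w 1 wx wy isT h2.
    by rewrite i0 adj_sym hadj // p3 p4 eqxx.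
  have [p1 p2 p3 p4] := pos w i wx wy i0 iN.
  by rewrite hadj // p3 p4 eqxx orbT.
have inner v : v != x -> v != y -> exists i, [/\ 0 < i, i.+1 < size (rep v),
    index v (rep v) = i & nth x (rep v) i = v].
  move=> vx vy; have [fv vs] := fs_fan sys vx vy; have [i0 iN hv] := xyfan_index fv vs vx vy.
  exists (index v (rep v)); split=> //; move: iN; move: (size (rep v)) (index v (rep v)) => k1 k2; lia0.
have ends z k : z != x -> z != y -> k < size (rep z) ->
    (x == nth x (rep z) k) = (k == 0) /\ (y == nth x (rep z) k) = (k.+1 == size (rep z)).
  move=> zx zy hk; have [n [hs n3 us h0 hn]] := fpath z zx zy; rewrite hs in hk *; split.
    by rewrite -[X in X == _]h0 nth_uniq ?hs // eq_sym.
  by rewrite -[X in X == _]hn nth_uniq ?hs // eqSS eq_sym.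
(* A common neighbour would be the first and the last inner vertex of its fan, while [3 <= n] gives
   two inner vertices. *)
have nocommon : no_common_neighbor H x y.
  move=> z [xz yz].
  have zx : z != x by apply: contraTneq xz => ->; rewrite adj_irrefl.
  have zy : z != y by apply: contraTneq yz => ->; rewrite adj_irrefl.
  have [n [hs n3 us h0 hn]] := fpath z zx zy; have [i [i0 iN ei hz]] := inner z zx zy.
  have [x1 y1] := ends z i.-1 zx zy (leq_ltn_trans (leq_pred i) (ltnW iN)).
  have [x2 y2] := ends z i.+1 zx zy iN.
  move: xz yz; rewrite ![adj H _ z]adj_sym !hadj // ei x1 y1 x2 y2.
  by move: n3 i0 iN; rewrite hs; lia0.
split=> //; split=> //.
have [v0 [v0x v0y]] : exists v, v != x /\ v != y.
  have : 0 < #|~: [set x; y]| by have := cardsC [set x; y]; rewrite cards2 xy; move: V5; lia0.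
  by case/card_gt0P=> v; rewrite !inE negb_or => /andP[? ?]; exists v.
pose rs := undup [seq rep v | v <- enum V & (v != x) && (v != y)].
have rsP q : reflect (exists v, [/\ v != x, v != y & q = rep v]) (q \in rs).
  rewrite mem_undup; apply: (iffP mapP) => [[v]|[v [vx vy ->]]].
    by rewrite mem_filter => /andP[/andP[? ?] _] ->; exists v.
  by exists v; rewrite // mem_filter vx vy mem_enum.
(* An edge between [x] and [y] lies on no fan and is a path of its own. *)
pose ps := rs ++ (if adj H x y then [:: [:: x; y]] else [::]).
have psP q : reflect ((exists v, [/\ v != x, v != y & q = rep v]) \/ (adj H x y /\ q = [:: x; y]))
    (q \in ps).
  rewrite mem_cat; apply: (iffP orP) => -[/rsP|h]; try by left.
    by right; move: h; case: ifP => // _; rewrite inE => /eqP.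
  by case: h => -> ->; right; rewrite inE.
exists ps; split.
- rewrite cat_uniq undup_uniq /=; case: ifP => //= _; rewrite orbF andbT.
  apply/rsP=> -[v [vx vy E]]; have [n [hs n3 _ _ _]] := fpath v vx vy.
  by move: hs n3; rewrite -E => -[<-].
- rewrite size_cat; have v0rs : rep v0 \in rs by apply/rsP; exists v0.
  have rs0 : 0 < size rs by case: (rs) v0rs.
  case: ifP => hxy; first by rewrite addn1 ltnS.
  (* With one fan and no edge between [x] and [y], the vector of [[set x]] would be supported on [x]
     and one neighbour. *)
  rewrite addn0 ltnNge; apply/negP=> rs1.
  have all_rep v : v != x -> v != y -> rep v = rep v0.
    move=> vx vy; have : rep v \in rs by apply/rsP; exists v.
    by case: (rs) v0rs rs1 => // q [|//] + _; rewrite !inE => /eqP-> /eqP.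
  have : nvec H x = 0%R.
    apply: (two_zero pH V5 (a := x) (b := nth x (rep v0) 1) (nvec_in H x)) => z zx z1.
    rewrite ffunE (negbTE zx); have [->|zy] := eqVneq z y; first by rewrite adj_sym hxy.
    have [n [hs n3 us h0 hn]] := fpath z zx zy; have [i [i0 iN ei hz]] := inner z zx zy.
    have [x1 _] := ends z i.-1 zx zy (leq_ltn_trans (leq_pred i) (ltnW iN)).
    have [x2 _] := ends z i.+1 zx zy iN; rewrite hadj // ei x1 x2.
    rewrite orbF; case: eqP => //= Ei; case/eqP: z1.
    by rewrite -hz (all_rep z) //; congr (nth _ _ _); move: Ei i0; lia0.
  by move/ffunP/(_ x); rewrite !ffunE eqxx.
- move=> q /psP[[v [vx vy ->]]|[_ ->]]; rewrite /is_path_between.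
    have [n [hs n3 us h0 hn]] := fpath v vx vy; rewrite us -nth_last hs hn eqxx andbT /=.
    by case: (rep v) hs h0 => //= a p' _ ->.
  by rewrite /= inE xy !eqxx.
- move=> q r /psP[[v [vx vy ->]]|[_ ->]] /psP[[w [wx wy ->]]|[_ ->]] qr z zq zr.
  + have [->|zx] := eqVneq z x; first by left.
    have [->|zy] := eqVneq z y; first by right.
    by move: qr; rewrite -(fs_rep sys vx vy zx zy zq) -(fs_rep sys wx wy zx zy zr) eqxx.
  + by move: zr; rewrite !inE => /orP[]/eqP->; [left|right].
  + by move: zq; rewrite !inE => /orP[]/eqP->; [left|right].
  + by rewrite eqxx in qr.
split=> [v|a b].
  have [vxy|] := boolP ((v == x) || (v == y)).
    exists (rep v0); first by apply/psP; left; exists v0.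
    have [n [hs n3 us h0 hn]] := fpath v0 v0x v0y.
    by case/orP: vxy => /eqP->; [rewrite -{1}h0|rewrite -{1}hn]; apply: mem_nth; rewrite hs.
  rewrite negb_or => /andP[vx vy]; exists (rep v); first by apply/psP; left; exists v.
  by have [] := fs_fan sys vx vy.
split=> [ab|[q]].
  have dir c d : adj H c d -> c != x -> c != y -> exists2 q, q \in ps & path_edge q c d.
    move=> cd cx cy; exists (rep c); first by apply/psP; left; exists c.
    have [i [i0 iN ei hc]] := inner c cx cy; move: cd; rewrite hadj // ei => /orP[]/eqP->.
      apply/orP; right; apply/(infix2P x); exists i.-1; rewrite (prednK i0); split=> //.
      exact: ltnW.
    by apply/orP; left; apply/(infix2P x); exists i.
  have [axy|] := boolP ((a == x) || (a == y)); last first.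
    by rewrite negb_or => /andP[ax ay]; apply: dir.
  have [bxy|] := boolP ((b == x) || (b == y)); last first.
    rewrite negb_or => /andP[bx by_]; have [q qps qe] := dir b a (etrans (adj_sym _ _ _) ab) bx by_.
    by exists q => //; rewrite /path_edge orbC.
  have [[Ea Eb]|[Ea Eb]] : (a = x /\ b = y) \/ (a = y /\ b = x).
    move: axy bxy ab => /orP[]/eqP-> /orP[]/eqP->; rewrite ?adj_irrefl //; by [left|right].
  - exists [:: x; y]; first by apply/psP; right; rewrite -Ea -Eb.
    by rewrite Ea Eb /path_edge infix_refl.
  - exists [:: x; y]; first by apply/psP; right; rewrite -Ea -Eb adj_sym.
    by rewrite Ea Eb /path_edge infix_refl orbT.
move=> /psP qps qe.
wlog h : a b {qe} / infix [:: a; b] q.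
  by move=> W; case/orP: qe => /W //; rewrite adj_sym.
case/(infix2P x): h => i [iN <- <-]; case: qps => [[v [vx vy E]]|[xyE E]].
  by rewrite E; apply: edge => //; rewrite -E.
by move: iN; rewrite E; case: i.
Qed.

(** Inner vertices have degree two, so their vectors are triplets. Without common neighbours of [x]
    and [y], some neighbour [w] of [v] is inner, and the triplets of [v] and [w] have entries
    [(1, 0)] and [(0, 1)] at [v]. *)
Lemma bundle_essential H x y v : prime_lagrangian (graph_lag H) -> 5 <= #|V| ->
  is_path_bundle H x y -> no_common_neighbor H x y -> v != x -> v != y ->
  essential (graph_lag H) v.
Proof.
move=> pH V5 [xy [ps [_ _ hpath disj [cover edges]]]] nocommon.
have inner c : c != x -> c != y -> exists a b, [/\ trip (graph_lag H) (nvec H c) c a b,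
    adj H c a, adj H c b, a != y & b != x].
  move=> cx cy; have [p pps cp] := cover c.
  have /and3P[up /eqP h0 /eqP hl] := hpath p pps.
  have h0' : nth x p 0 = x by case: (p) h0 => [|? ?] //= [->].
  have hc := nth_index x cp; set i := index c p in hc.
  have ip : i < size p by rewrite index_mem.
  have i0 : 0 < i by rewrite lt0n; apply: contraNneq cx => E; rewrite -hc E h0'.
  have iN : i.+1 < size p.
    rewrite ltn_neqAle ip andbT; apply: contraNneq cy => E.
    by rewrite -hc -hl -nth_last -E.
  have adjc z : adj H c z = (z == nth x p i.-1) || (z == nth x p i.+1).
    apply/idP/orP => [/edges[q qps qe]|hz].
      have cq : c \in q.
        by case/orP: qe => /mem_infix; apply; rewrite !inE eqxx ?orbT.
      have Eq : q = p.
        apply/eqP; apply: contraT => qp; have [E|E] := disj q p qps pps qp c cq cp.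
          by rewrite E eqxx in cx.
        by rewrite E eqxx in cy.
      rewrite Eq in qe; case/orP: qe => /(infix2P x)[j [jN]].
        move=> jc <-; right; have -> : i = j by rewrite /i -jc index_uniq // ltnW.
        exact: eqxx.
      move=> <- jc; left; have -> : i = j.+1 by rewrite /i -jc index_uniq.
      exact: eqxx.
    apply/edges; exists p => //; case: hz => /eqP->; apply/orP; [right|left]; apply/(infix2P x).
      by exists i.-1; rewrite (prednK i0).
    by exists i.
  exists (nth x p i.-1), (nth x p i.+1); split.
  - have ab : nth x p i.-1 != nth x p i.+1.
      by rewrite nth_uniq //; move: i0 iN; move: (size p) => k; lia0.
    have ca : c != nth x p i.-1.
      by apply/eqP=> E; have := adj_irrefl H c; rewrite {2}E adjc eqxx.
    have cb : c != nth x p i.+1.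
      by apply/eqP=> E; have := adj_irrefl H c; rewrite {2}E adjc eqxx orbT.
    rewrite /trip nvec_in /= !inE negb_or ca cb ab /=; apply/eqP/setP=> z.
    rewrite in_supp ffunE !inE adj_sym adjc -orbA.
    by case: (z == c); case: (_ || _).
  - by rewrite adjc eqxx.
  - by rewrite adjc eqxx orbT.
  - rewrite -hl -nth_last nth_uniq //; move: i0 iN; move: (size p) => k; lia0.
  - rewrite -[X in _ != X]h0' nth_uniq //; move: i0 iN; move: (size p) => k; lia0.
move=> vx vy; have [a [b [T va vb ay bx]]] := inner v vx vy.
have [w [wx wy vw]] : exists w, [/\ w != x, w != y & adj H v w].
  have [Ea|ax] := eqVneq a x; last by exists a.
  have [Eb|by_] := eqVneq b y; last by exists b.
  by case: (nocommon v); rewrite -Ea -Eb ![adj H _ v]adj_sym.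
have [c [d [U _ _ _ _]]] := inner w wx wy.
have wv : w != v by apply: contraTneq vw => ->; rewrite adj_irrefl.
have Uv : nvec H w v = (false, true) by rewrite ffunE eq_sym (negbTE wv) vw.
have [c' [d' U']] : exists c' d', trip (graph_lag H) (nvec H w) v c' d'.
  by apply: triplet_trip (trip_triplet U) _; rewrite Uv.
apply/existsP; exists (nvec H v v); apply/existsP; exists (nvec H w v).
rewrite (trip_nonprime V5 T) (trip_nonprime V5 U') Uv !ffunE eqxx adj_irrefl.
by [].
Qed.
End Bundles.

Theorem theorem1p4 (V : finType) (G : sgraph V)
    (hprime : prime_graph G) (hcard : 5 <= #|V|) :
  3 <= #|[set v : V | non_essential G v]| <->
  ~ (exists (H : sgraph V) (x y : V),
       [/\ locally_equivalent G H, is_path_bundle H x y &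
           no_common_neighbor H x y]).
Proof.
have pG : prime_lagrangian (graph_lag G) by apply/prime_lagrangianP.
have EN : [set v : V | non_essential G v] = [set v | ~~ essential (graph_lag G) v].
  by apply/setP=> v; rewrite !inE non_essentialE.
rewrite EN; split=> [h3 [H [x [y [GH bH nc]]]]|hn].
  have [f hf] := locally_equivalent_twisted GH; move: h3; apply/negP; rewrite -ltnNge ltnS.
  have le2 : #|[set x; y]| <= 2 by rewrite cards2; case: (_ != _).
  apply: leq_trans le2; apply: subset_leq_card; apply/subsetP=> v; rewrite !inE.
  apply: contraR; rewrite negb_or => /andP[vx vy].
  by apply: (twist_essential hf); apply: (bundle_essential (twist_prime hf pG) hcard bH nc).
rewrite ltnNge; apply/negP=> few; apply: hn.
have [x [y [rep [sys [e [e0 ec eo]]]]]] : exists x y rep, fan_system (graph_lag G) x y rep /\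
    exists e : V -> K, [/\ forall z, e z != 0%R,
      forall z, z != x -> z != y -> center (graph_lag G) x rep z z != e z
      & forall v z, v != x -> v != y -> z != v ->
        center (graph_lag G) x rep v z != 0%R -> center (graph_lag G) x rep v z = e z].
  (* A fan through all vertices is a system by itself, and leads to a cycle: its bundle is one long
     path and the edge between its ends. *)
  case: (boolP [exists s : #|V|.-tuple V, fan (graph_lag G) s]) => [/existsP[s fs]|].
    have [x h0] : exists x, nth x s 0 = x.
      by have /and3P[_ _] := fs; case: (val s) => // a s' _; exists a.
    exists x, (last x s), (fun=> val s).
    by apply: (spanning_system pG hcard fs h0); rewrite size_tuple.
  rewrite negb_exists => /forallP hs; apply: (noncyclic_system pG hcard) => // s fs.
  by apply/eqP=> /eqP E; have := hs (Tuple E); rewrite fs.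
have [H [GH pH hadj]] := system_graph pG hcard sys e0 ec eo.
by have [bH nc] := system_bundle pH hcard sys hadj; exists H, x, y.
Qed.
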